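(* Let $(\pi_{1},\pi_{2})$ be a pair of $2$-sections on a Jacobi algebroid $(A,\phi_{0})$ over a manifold $M$ (i.e. $\pi_1,\pi_2\in\Gamma(\Lambda^2A)$), and set $\tilde{\pi}_{i}:=e^{-t}\pi_{i}\in\Gamma(\Lambda^{2}\tilde{A})$ for $i=1,2$. Then $(\pi_{1},\pi_{2})$ is a Jacobi pair on $(A,\phi_{0})$ if and only if $(\tilde{\pi}_{1},\tilde{\pi}_{2})$ is a Poisson pair on the Lie algebroid $\tilde{A}_{\bar{\phi}_{0}}$ over $M\times\mathbb{R}$.
   Context: Lie algebroids. A Lie algebroid over $M$ is a vector bundle $A\to M$ with a Lie bracket $[\cdot,\cdot]_A$ on $\Gamma(A)$ and a bundle map $\rho_A:A\to TM$ with $[X,fY]_A=f[X,Y]_A+(\rho_A(X)f)Y$. The Schouten bracket on $\Gamma(\Lambda^*A)$ is the unique extension of the Lie bracket with $[f,g]_A=0$, $[X,f]_A=\rho_A(X)f$, $[D_1,D_2\wedge D_3]_A=[D_1,D_2]_A\wedge D_3+(-1)^{(a_1+1)a_2}D_2\wedge[D_1,D_3]_A$, $[D_1,D_2]_A=-(-1)^{(a_1-1)(a_2-1)}[D_2,D_1]_A$ for $D_i\in\Gamma(\Lambda^{a_i}A)$. The differential $d_A$ on $\Gamma(\Lambda^*A^* )$ is the usual Lie algebroid differential: $(d_A\omega)(X_0,\dots,X_k)=\sum_i(-1)^i\rho_A(X_i)(\omega(X_0,\dots,\hat X_i,\dots,X_k))+\sum_{i<j}(-1)^{i+j}\omega([X_i,X_j]_A,X_0,\dots,\hat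 X_i,\dots,\hat X_j,\dots,X_k)$. Jacobi algebroids. A Jacobi algebroid $(A,\phi_0)$ is a Lie algebroid $A$ with $\phi_0\in\Gamma(A^* )$, $d_A\phi_0=0$. For $D_i\in\Gamma(\Lambda^{a_i}A)$, $[D_1,D_2]_{A,\phi_0}:=[D_1,D_2]_A+(a_1-1)D_1\wedge\iota_{\phi_0}D_2-(-1)^{a_1+1}(a_2-1)\iota_{\phi_0}D_1\wedge D_2$. On $\Gamma(\Lambda^*A^* )$, $d_{A,\phi_0}\omega:=d_A\omega+\phi_0\wedge\omega$ and $\mathcal{L}^{A,\phi_0}_X:=\iota_Xd_{A,\phi_0}+d_{A,\phi_0}\iota_X$. A Jacobi structure on $(A,\phi_0)$ is $\pi\in\Gamma(\Lambda^2A)$ with $[\pi,\pi]_{A,\phi_0}=0$. A Poisson structure on a Lie algebroid $A$ is $\pi\in\Gamma(\Lambda^2A)$ with $[\pi,\pi]_A=0$ (the case $\phi_0=0$). The Lie algebroid $\tilde A_{\bar\phi_0}$. $\tilde A:=A\times\mathbb{R}$ is a vector bundle over $M\times\mathbb{R}$, with $t$ the standard coordinate on $\mathbb{R}$; its sections are identified with time-dependent sections of $A$, and operations of $A$ are applied pointwise in $t$. $\tilde A_{\bar\phi_0}$ is $\tilde A$ with bracket $[\tilde X,\tilde Y\bar{]}_A^{\phi_0}:=[\tilde X,\tilde Y]_A+\langle\phi_0,\tilde X\rangle\frac{\partial\tilde Y}{\partial t}-\langle\phi_0,\tilde Y\rangle\frac{\partial\tilde X}{\partial t}$ and anchor $\bar\rho_A^{\phi_0}(\tilde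 X):=\rho_A(\tilde X)+\langle\phi_0,\tilde X\rangle\frac{\partial}{\partial t}$. Dirac structures on a Jacobi algebroid $(A,\phi_0)$. On $A\oplus A^*$ let $(X+\xi,Y+\eta)_\pm:=\frac12(\langle\xi,Y\rangle\pm\langle\eta,X\rangle)$ and $[\![X+\xi,Y+\eta]\!]:=[X,Y]_A+\big(\mathcal{L}^{A,\phi_0}_X\eta-\mathcal{L}^{A,\phi_0}_Y\xi+d_{A,\phi_0}(X+\xi,Y+\eta)_-\big)$. A Dirac structure on $(A,\phi_0)$ is a subbundle $L\subset A\oplus A^*$ maximally isotropic for $(\cdot,\cdot)_+$ with $\Gamma(L)$ closed under $[\![\cdot,\cdot]\!]$. A Dirac structure on a Lie algebroid $A$ is one on $(A,0)$. For $\pi\in\Gamma(\Lambda^2A)$, $\langle\pi^\sharp\xi,\eta\rangle:=\pi(\xi,\eta)$, and $\overline{\mathrm{graph}\,\pi^\sharp}:=\{(\pi^\sharp\xi,\xi)\mid\xi\in A^*\}\subset A\times A^*$ (fibrewise; identified with a subbundle of $A\oplus A^*$). Relations. Relations between vector bundles over the same base are understood fibrewise. For $R\subset A\times A$, $R^*:=\{(\beta,\alpha)\in A^*\times A^*\mid\langle\alpha,u\rangle=\langle\beta,v\rangle\ \forall(u,v)\in R\}$ fibrewise; $\underline{R}$ is the set of pairs of sections with values in $R$ at every point. The Nijenhuis torsion is $\mathcal{T}_R((X_1,Y_1),(X_2,Y_2),(\alpha,\beta,\gamma)):=\langle\alpha,[Y_1,Y_2]_A\rangle-\langle\beta,[Y_1,X_2]_A+[X_1,Y_2]_A\rangle+\langle\gamma,[X_1,X_2]_A\rangle$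 for $(X_i,Y_i)\in\underline{R}$ and $(\alpha,\beta),(\beta,\gamma)\in\underline{R^*}$; $R$ is Nijenhuis if $\mathcal{T}_R\equiv0$. Dirac, Poisson and Jacobi pairs. For $L,L'\subset A\times A^*$, $\mathrm{N}_{L,L'}:=\{(x,y)\in A\times A\mid\exists\alpha\in A^*:(x,\alpha)\in L',\ (y,\alpha)\in L\}$ (fibrewise). A pair $(L,L')$ of Dirac structures on $(A,\phi_0)$ is a Dirac pair on $(A,\phi_0)$ if $\mathrm{N}_{L,L'}$ is a Nijenhuis relation; a Dirac pair on a Lie algebroid $A$ is one on $(A,0)$. A pair of Jacobi structures $(\pi_1,\pi_2)$ on $(A,\phi_0)$ is a Jacobi pair if $(\overline{\mathrm{graph}\,\pi_1^\sharp},\overline{\mathrm{graph}\,\pi_2^\sharp})$ is a Dirac pair on $(A,\phi_0)$. A pair of Poisson structures $(\pi_1,\pi_2)$ on a Lie algebroid $A$ is a Poisson pair if $(\overline{\mathrm{graph}\,\pi_1^\sharp},\overline{\mathrm{graph}\,\pi_2^\sharp})$ is a Dirac pair on $A$. *)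

(* Defs.v *)
From HB Require Import structures.
From mathcomp Require Import all_boot all_order all_algebra.
From mathcomp Require Import all_classical all_reals all_analysis.
Import Order.TTheory GRing.Theory Num.Theory.
Import numFieldNormedType.Exports.

Set Implicit Arguments.
Unset Strict Implicit.
Unset Printing Implicit Defensive.

Local Open Scope classical_set_scope.
Local Open Scope ring_scope.

(** Manifolds, bundles and algebroids are split into a record of data and a
    predicate stating the axioms ([is_manifold], [is_bundle],
    [is_lie_algebroid]).  A field indexed by points (a section, a covector
    field, ...) is an arbitrary function on points; smoothness is a predicate.
    The operations of an algebroid are total functions which are only ever
    applied to, and only constrained on, smooth arguments. *)

(** * Smooth functions on open subsets of R^n *)

Fixpoint Ck (R : realType) (n k : nat) (U : set 'rV[R]_n) (f : 'rV[R]_n -> R)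
    : Prop :=
  (forall x, U x -> {for x, continuous f}) /\
  (if k is k'.+1 then
     forall i : 'I_n,
       (forall x, U x -> derivable f x (delta_mx 0 i)) /\
       Ck k' U (fun x => 'D_(delta_mx 0 i) f x)
   else True).

Definition Cinfty (R : realType) (n : nat) (U : set 'rV[R]_n)
    (f : 'rV[R]_n -> R) : Prop :=
  forall k, Ck k U f.

(** * Smooth manifolds *)

(* [cmap] is meaningful on [cdom], and [cinv] on the image of [cdom]. *)
Record chart (R : realType) (T : topologicalType) (n : nat) := Chart {
  cdom : set T;
  cmap : T -> 'rV[R]_n;
  cinv : 'rV[R]_n -> T }.

Definition is_chart (R : realType) (T : topologicalType) (n : nat)
    (c : chart R T n) : Prop :=
  [/\ open (cdom c),
      open (cmap c @` cdom c),
      forall x, cdom c x -> cinv c (cmap c x) = x,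
      forall x, cdom c x -> {for x, continuous (cmap c)} &
      forall v, (cmap c @` cdom c) v -> {for v, continuous (cinv c)}].

Record manifold_data (R : realType) := ManifoldData {
  points :> topologicalType;
  mdim : nat;
  atlas : set (chart R points mdim) }.

(* [U] is meant to be open. *)
Definition smooth_on (R : realType) (M : manifold_data R) (U : set M)
    (f : M -> R) : Prop :=
  forall c, atlas c -> Cinfty (cmap c @` (cdom c `&` U)) (f \o cinv c).

Definition smooth_fun (R : realType) (M : manifold_data R) (f : M -> R) : Prop :=
  smooth_on setT f.

Definition is_manifold (R : realType) (M : manifold_data R) : Prop :=
  [/\ hausdorff_space M,
      @second_countable M,
      forall c : chart R M (mdim M), atlas c -> is_chart c,
      forall x : M, exists2 c : chart R M (mdim M), atlas c & cdom c x &
      forall c : chart R M (mdim M), atlas c ->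
        forall j, smooth_on (cdom c) (fun x => cmap c x 0 j)].

(* A tangent vector at [x] is a derivation at [x] of the smooth functions. *)
Definition is_tangent (R : realType) (M : manifold_data R) (x : M)
    (v : (M -> R) -> R) : Prop :=
  forall f g, smooth_fun f -> smooth_fun g ->
    (forall a : R, v (fun y => a * f y + g y) = a * v f + v g) /\
    v (fun y => f y * g y) = f x * v g + g x * v f.

Definition prod_chart (R : realType) (T : topologicalType) (n : nat)
    (c : chart R T n) : chart R (T * R)%type (n + 1) :=
  @Chart R (T * R)%type (n + 1)
    (cdom c `*` setT)
    (fun p => row_mx (cmap c p.1) (p.2)%:M)
    (fun v => (cinv c (lsubmx v), rsubmx v 0 0)).

(* The manifold M x R. *)
Definition line_prod (R : realType) (M : manifold_data R) : manifold_data R :=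
  @ManifoldData R (M * R)%type (mdim M + 1)
    [set prod_chart c | c in @atlas R M].

(** * Vector bundles *)

(* [tinv x] inverts [tmap x] for [x] in [tdom]. *)
Record triv (R : realType) (T : Type) (E : T -> vectType R) (r : nat) := Triv {
  tdom : set T;
  tmap : forall x, 'Hom(E x, 'rV[R]_r);
  tinv : forall x, 'Hom('rV[R]_r, E x) }.

Record bundle_data (R : realType) (M : manifold_data R) := BundleData {
  fib :> M -> vectType R;
  rank : nat;
  trivs : set (triv fib rank) }.

Definition section (R : realType) (M : manifold_data R) (E : bundle_data M) :=
  forall x : M, E x.

Definition dual (R : realType) (V : vectType R) := 'Hom(V, R^o).

Definition cosection (R : realType) (M : manifold_data R) (E : bundle_data M) :=
  forall x : M, dual (E x).

Definition frame (R : realType) (T : Type) (E : T -> vectType R) (r : nat)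
    (tau : triv E r) (i : 'I_r) (x : T) : E x :=
  tinv tau x (delta_mx 0 i).

Definition coframe (R : realType) (T : Type) (E : T -> vectType R) (r : nat)
    (tau : triv E r) (i : 'I_r) (x : T) : dual (E x) :=
  linfun (fun v => tmap tau x v 0 i : R^o).

Definition smooth_section_on (R : realType) (M : manifold_data R)
    (E : bundle_data M) (U : set M) (X : section E) : Prop :=
  forall tau : triv E (rank E), trivs tau ->
    forall i, smooth_on (tdom tau `&` U) (fun x => tmap tau x (X x) 0 i).

Definition smooth_cosection_on (R : realType) (M : manifold_data R)
    (E : bundle_data M) (U : set M) (xi : cosection E) : Prop :=
  forall tau : triv E (rank E), trivs tau ->
    forall i, smooth_on (tdom tau `&` U) (fun x => xi x (frame tau i x)).

Definition smooth_section (R : realType) (M : manifold_data R)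
    (E : bundle_data M) (X : section E) : Prop :=
  smooth_section_on setT X.

Definition smooth_cosection (R : realType) (M : manifold_data R)
    (E : bundle_data M) (xi : cosection E) : Prop :=
  smooth_cosection_on setT xi.

Definition is_bundle (R : realType) (M : manifold_data R)
    (E : bundle_data M) : Prop :=
  [/\ forall tau : triv E (rank E), trivs tau -> open (tdom tau),
      forall x : M, exists2 tau : triv E (rank E), trivs tau & tdom tau x,
      forall tau : triv E (rank E), trivs tau -> forall x, tdom tau x ->
        cancel (tmap tau x) (tinv tau x) /\ cancel (tinv tau x) (tmap tau x) &
      forall tau : triv E (rank E), trivs tau ->
        forall i, smooth_section_on (tdom tau) (frame tau i)].

(* The bundle A x R over M x R: its fibre at (x, t) is that of A at x. *)
Definition line_bundle_prod (R : realType) (M : manifold_data R)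
    (E : bundle_data M) : bundle_data (line_prod M) :=
  @BundleData R (line_prod M) (fun p => E p.1) (rank E)
    [set Triv (E := fun p : line_prod M => E p.1)
           (tdom tau `*` setT) (fun p => tmap tau p.1) (fun p => tinv tau p.1)
     | tau in @trivs R M E].

(** * Multivectors *)

(** An element of the exterior algebra of V is encoded as a function on finite
    lists of covectors: an element of degree k is an alternating k-linear form
    on the dual of V, extended by zero to the lists of length other than k. *)
Definition multivector (R : realType) (V : vectType R) (k : nat)
    (D : seq (dual V) -> R) : Prop :=
  [/\ forall s, size s != k -> D s = 0,
      forall (s1 s2 : seq (dual V)) (a : R) (xi eta : dual V),
        D (s1 ++ (a *: xi + eta) :: s2) =
        a * D (s1 ++ xi :: s2) + D (s1 ++ eta :: s2) &
      forall (s1 s2 : seq (dual V)) (xi : dual V),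
        D (s1 ++ [:: xi, xi & s2]) = 0].

(* The exterior product is determined by its degree-0 part and by contraction
   with a covector being an antiderivation.  Thus
   (X /\ Y)(xi, eta) = xi(X) eta(Y) - eta(X) xi(Y). *)
Fixpoint wedge (R : realType) (V : Type) (D E : seq V -> R) (s : seq V) : R :=
  if s is xi :: s' then
    wedge (fun u => D (xi :: u)) E s' +
    wedge (fun u => (-1) ^+ size u * D u) (fun u => E (xi :: u)) s'
  else D [::] * E [::].

Definition multisection (R : realType) (M : manifold_data R)
    (E : bundle_data M) :=
  forall x : M, seq (dual (E x)) -> R.

(* Membership in Gamma(Lambda^k E). *)
Definition smooth_multisection (R : realType) (M : manifold_data R)
    (E : bundle_data M) (k : nat) (D : multisection E) : Prop :=
  (forall x, multivector k (D x)) /\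
  (forall tau : triv E (rank E), trivs tau ->
    forall J : seq 'I_(rank E),
      smooth_on (tdom tau) (fun x => D x [seq coframe tau j x | j <- J])).

Definition msec0 (R : realType) (M : manifold_data R) (E : bundle_data M)
    (f : M -> R) : multisection E :=
  fun x s => if s is [::] then f x else 0.
Arguments msec0 {R M E} f x s.

Definition msec1 (R : realType) (M : manifold_data R) (E : bundle_data M)
    (X : section E) : multisection E :=
  fun x s => if s is [:: xi] then xi (X x) else 0.
Arguments msec1 {R M E} X x s.

Definition mwedge (R : realType) (M : manifold_data R) (E : bundle_data M)
    (D D' : multisection E) : multisection E :=
  fun x => wedge (D x) (D' x).
Arguments mwedge {R M E} D D' x s.

Definition contract (R : realType) (M : manifold_data R) (E : bundle_data M)
    (phi : cosection E) (D : multisection E) : multisection E :=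
  fun x s => D x (phi x :: s).
Arguments contract {R M E} phi D x s.

(** * Lie algebroids *)

Record algebroid_data (R : realType) := AlgebroidData {
  base : manifold_data R;
  bundle :> bundle_data base;
  bracket : section bundle -> section bundle -> section bundle;
  anchor : forall x : base, bundle x -> (base -> R) -> R }.

(* The function rho_A(X) f. *)
Definition act (R : realType) (A : algebroid_data R) (X : section A)
    (f : base A -> R) : base A -> R :=
  fun x => anchor (X x) f.

Definition is_lie_algebroid (R : realType) (A : algebroid_data R) : Prop :=
  [/\ is_manifold (base A) /\ is_bundle A,
      (* the anchor is a smooth bundle map from A to TM *)
      [/\ forall (x : base A) (v : A x), is_tangent x (anchor v),
          forall (x : base A) (a : R) (v w : A x) f, smooth_fun f ->
            anchor (a *: v + w) f = a * anchor v f + anchor w f &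
          forall (X : section A) f, smooth_section X -> smooth_fun f ->
            smooth_fun (act X f)],
      (* the bracket is a Lie bracket on the smooth sections *)
      [/\ forall X Y : section A, smooth_section X -> smooth_section Y ->
            smooth_section (bracket X Y),
          forall (a : R) (X Y Z : section A),
            smooth_section X -> smooth_section Y -> smooth_section Z ->
            bracket (fun x => a *: X x + Y x) Z =
            (fun x => a *: bracket X Z x + bracket Y Z x),
          forall X Y : section A, smooth_section X -> smooth_section Y ->
            bracket X Y = (fun x => - bracket Y X x) &
          forall X Y Z : section A,
            smooth_section X -> smooth_section Y -> smooth_section Z ->
            forall x, bracket X (bracket Y Z) x + bracket Y (bracket Z X) x +
                      bracket Z (bracket X Y) x = 0] &
      forall (X Y : section A) f,
        smooth_section X -> smooth_section Y -> smooth_fun f ->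
        bracket X (fun x => f x *: Y x) =
        (fun x => f x *: bracket X Y x + act X f x *: Y x)].

(** The Schouten bracket [B].  The sign (-1)^((a1-1)(a2-1)) is written with
    a1+1, a2+1, to avoid negative exponents.  Smoothness of
    [B D1 D2] need not be imposed: the axioms determine [B] on smooth
    multisections (which are locally, and even globally, sums of exterior
    products of smooth sections), and hence force it. *)
Definition is_schouten (R : realType) (A : algebroid_data R)
    (B : multisection A -> multisection A -> multisection A) : Prop :=
  [/\ forall a b (D1 D2 : multisection A),
        smooth_multisection a D1 -> smooth_multisection b D2 ->
        forall x, multivector (a + b).-1 (B D1 D2 x),
      forall a b (c : R) (D1 D2 D2' : multisection A),
        smooth_multisection a D1 ->
        smooth_multisection b D2 -> smooth_multisection b D2' ->
        B D1 (fun x s => c * D2 x s + D2' x s) =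
        (fun x s => c * B D1 D2 x s + B D1 D2' x s),
      [/\ forall f g, smooth_fun f -> smooth_fun g ->
            B (msec0 f) (msec0 g) = (fun x s => 0),
          forall (X : section A) f, smooth_section X -> smooth_fun f ->
            B (msec1 X) (msec0 f) = msec0 (act X f) &
          forall X Y : section A, smooth_section X -> smooth_section Y ->
            B (msec1 X) (msec1 Y) = msec1 (bracket X Y)],
      forall a1 a2 a3 (D1 D2 D3 : multisection A),
        smooth_multisection a1 D1 -> smooth_multisection a2 D2 ->
        smooth_multisection a3 D3 ->
        B D1 (mwedge D2 D3) =
        (fun x s => mwedge (B D1 D2) D3 x s +
                    (-1) ^+ (a1.+1 * a2) * mwedge D2 (B D1 D3) x s) &
      forall a1 a2 (D1 D2 : multisection A),
        smooth_multisection a1 D1 -> smooth_multisection a2 D2 ->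
        B D1 D2 = (fun x s => - ((-1) ^+ (a1.+1 * a2.+1) * B D2 D1 x s))].

(* d_A on functions and on 1-forms; a form is given by its values on sections *)
Definition dA0 (R : realType) (A : algebroid_data R) (f : base A -> R)
    (X : section A) : base A -> R :=
  act X f.

Definition dA1 (R : realType) (A : algebroid_data R) (eta : cosection A)
    (X Y : section A) : base A -> R :=
  fun x => act X (fun y => eta y (Y y)) x - act Y (fun y => eta y (X y)) x
           - eta x (bracket X Y x).

(** * Jacobi algebroids *)

Definition jacobi_algebroid (R : realType) (A : algebroid_data R)
    (phi0 : cosection A) : Prop :=
  [/\ is_lie_algebroid A,
      smooth_cosection phi0 &
      forall X Y : section A, smooth_section X -> smooth_section Y ->
        forall x, dA1 phi0 X Y x = 0].

(* d_{A,phi0} = d_A + phi0 /\ _ on functions and on 1-forms *)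
Definition dAphi0 (R : realType) (A : algebroid_data R) (phi0 : cosection A)
    (f : base A -> R) (X : section A) : base A -> R :=
  fun x => dA0 f X x + phi0 x (X x) * f x.

Definition dAphi1 (R : realType) (A : algebroid_data R) (phi0 : cosection A)
    (eta : cosection A) (X Y : section A) : base A -> R :=
  fun x => dA1 eta X Y x +
           (phi0 x (X x) * eta x (Y x) - phi0 x (Y x) * eta x (X x)).

(* the Lie derivative of a 1-form, by Cartan's formula *)
Definition lie_der (R : realType) (A : algebroid_data R) (phi0 : cosection A)
    (X : section A) (eta : cosection A) (Z : section A) : base A -> R :=
  fun x => dAphi1 phi0 eta X Z x + dAphi0 phi0 (fun y => eta y (X y)) Z x.

(* [D1, D2]_{A,phi0} for [D1], [D2] of degrees [a1], [a2] *)
Definition jacobi_bracket (R : realType) (A : algebroid_data R)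
    (phi0 : cosection A)
    (B : multisection A -> multisection A -> multisection A)
    (a1 a2 : nat) (D1 D2 : multisection A) : multisection A :=
  fun x s => B D1 D2 x s
    + (a1%:R - 1) * mwedge D1 (contract phi0 D2) x s
    - (-1) ^+ a1.+1 * (a2%:R - 1) * mwedge (contract phi0 D1) D2 x s.
Arguments jacobi_bracket {R A} phi0 B a1 a2 D1 D2 x s.

Definition jacobi_structure (R : realType) (A : algebroid_data R)
    (phi0 : cosection A) (pi : multisection A) : Prop :=
  smooth_multisection 2 pi /\
  exists2 B, is_schouten B &
    forall x s, jacobi_bracket phi0 B 2 2 pi pi x s = 0.

Definition poisson_structure (R : realType) (A : algebroid_data R)
    (pi : multisection A) : Prop :=
  smooth_multisection 2 pi /\
  exists2 B : multisection A -> multisection A -> multisection A,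
    is_schouten B & forall x s, B pi pi x s = 0.

(** * Relations *)

(* a family of subsets of the fibres of A (+) A^* *)
Definition dual_relation (R : realType) (A : algebroid_data R) :=
  forall x : base A, set (A x * dual (A x)).

(* a family of subsets of the fibres of A x A *)
Definition relation (R : realType) (A : algebroid_data R) :=
  forall x : base A, set (A x * A x).

(* [costar Q x (beta, alpha)] is membership of (beta, alpha) in Q^*. *)
Definition costar (R : realType) (A : algebroid_data R) (Q : relation A)
    (x : base A) : set (dual (A x) * dual (A x)) :=
  [set p : (dual (A x) * dual (A x))%type |
    forall u v, Q x (u, v) -> p.2 u = p.1 v].

Definition torsion (R : realType) (A : algebroid_data R)
    (X1 Y1 X2 Y2 : section A) (alpha beta gamma : cosection A) : base A -> R :=
  fun x => alpha x (bracket Y1 Y2 x)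
           - beta x (bracket Y1 X2 x + bracket X1 Y2 x)
           + gamma x (bracket X1 X2 x).

Definition nijenhuis (R : realType) (A : algebroid_data R)
    (Q : relation A) : Prop :=
  forall X1 Y1 X2 Y2 : section A,
    smooth_section X1 -> smooth_section Y1 ->
    smooth_section X2 -> smooth_section Y2 ->
    (forall x, Q x (X1 x, Y1 x)) -> (forall x, Q x (X2 x, Y2 x)) ->
  forall alpha beta gamma : cosection A,
    smooth_cosection alpha -> smooth_cosection beta -> smooth_cosection gamma ->
    (forall x, costar Q (alpha x, beta x)) ->
    (forall x, costar Q (beta x, gamma x)) ->
  forall x, torsion X1 Y1 X2 Y2 alpha beta gamma x = 0.

(** * Dirac structures *)

Definition pairing_plus (R : realType) (V : vectType R) (p q : V * dual V) : R :=
  2^-1 * (p.2 q.1 + q.2 p.1).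

Definition pairing_minus (R : realType) (V : vectType R) (p q : V * dual V) : R :=
  2^-1 * (p.2 q.1 - q.2 p.1).

(* [L] has a smooth local frame around every point. *)
Definition is_subbundle (R : realType) (A : algebroid_data R)
    (L : dual_relation A) : Prop :=
  forall x0 : base A, exists (U : set (base A)) (k : nat)
      (X : 'I_k -> section A) (xi : 'I_k -> cosection A),
    [/\ open U, U x0,
        forall i, smooth_section_on U (X i) /\ smooth_cosection_on U (xi i) &
        forall x, U x ->
          let b := [tuple (X i x, xi i x) | i < k] in
          free b /\ (forall p, L x p <-> p \in <<b>>%VS)].

Definition isotropic (R : realType) (V : vectType R) (S : set (V * dual V))
    : Prop :=
  forall p q, S p -> S q -> pairing_plus p q = 0.

Definition maximally_isotropic (R : realType) (V : vectType R)
    (S : set (V * dual V)) : Prop :=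
  isotropic S /\
  forall W : {vspace (V * dual V)%type},
    isotropic [set p | p \in W] -> S `<=` [set p | p \in W] ->
    [set p | p \in W] `<=` S.

(* the values on [Z] of the A^*-component of [[X + xi, Y + eta]] *)
Definition courant_form (R : realType) (A : algebroid_data R)
    (phi0 : cosection A) (X : section A) (xi : cosection A)
    (Y : section A) (eta : cosection A) (Z : section A) : base A -> R :=
  fun x => lie_der phi0 X eta Z x - lie_der phi0 Y xi Z x +
    dAphi0 phi0 (fun y => pairing_minus (X y, xi y) (Y y, eta y)) Z x.

(** In the last clause [zeta] is the 1-form with the prescribed values; it is
    unique, and it is smooth because those values are. *)
Definition dirac_structure (R : realType) (A : algebroid_data R)
    (phi0 : cosection A) (L : dual_relation A) : Prop :=
  [/\ is_subbundle L,
      forall x, maximally_isotropic (L x) &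
      forall (X : section A) (xi : cosection A)
             (Y : section A) (eta : cosection A),
        smooth_section X -> smooth_cosection xi ->
        smooth_section Y -> smooth_cosection eta ->
        (forall x, L x (X x, xi x)) -> (forall x, L x (Y x, eta x)) ->
        exists2 zeta : cosection A,
          forall Z, smooth_section Z ->
            forall x, zeta x (Z x) = courant_form phi0 X xi Y eta Z x &
          forall x, L x (bracket X Y x, zeta x)].

(* The pairs (v, xi) with v = pi^sharp xi, that is <v, eta> = pi(xi, eta). *)
Definition graph_sharp (R : realType) (A : algebroid_data R)
    (pi : multisection A) : dual_relation A :=
  fun x => [set p : (A x * dual (A x))%type |
    forall eta : dual (A x), eta p.1 = pi x [:: p.2; eta]].

Definition N_rel (R : realType) (A : algebroid_data R)
    (L L' : dual_relation A) : relation A :=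
  fun x => [set p : (A x * A x)%type | exists alpha, L' x (p.1, alpha) /\ L x (p.2, alpha)].

Definition dirac_pair (R : realType) (A : algebroid_data R)
    (phi0 : cosection A) (L L' : dual_relation A) : Prop :=
  [/\ dirac_structure phi0 L, dirac_structure phi0 L' & nijenhuis (N_rel L L')].

Definition jacobi_pair (R : realType) (A : algebroid_data R)
    (phi0 : cosection A) (pi1 pi2 : multisection A) : Prop :=
  [/\ jacobi_structure phi0 pi1, jacobi_structure phi0 pi2 &
      dirac_pair phi0 (graph_sharp pi1) (graph_sharp pi2)].

Definition poisson_pair (R : realType) (A : algebroid_data R)
    (pi1 pi2 : multisection A) : Prop :=
  [/\ poisson_structure pi1, poisson_structure pi2 &
      dirac_pair (fun x => 0 : dual (A x)) (graph_sharp pi1) (graph_sharp pi2)].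

(** * The Lie algebroid associated with a Jacobi algebroid *)

Definition slice (R : realType) (M : manifold_data R) (E : bundle_data M)
    (X : section (line_bundle_prod E)) (t : R) : section E :=
  fun x => X (x, t).

(* The t-derivative in the fixed vector space E x, computed in a basis. *)
Definition dt (R : realType) (M : manifold_data R) (E : bundle_data M)
    (X : section (line_bundle_prod E)) : section (line_bundle_prod E) :=
  fun p =>
    let b := vbasis (fullv : {vspace E p.1}) in
    \sum_i derive1 (fun s : R => coord b i (slice X s p.1) : R) p.2 *: b`_i.

Definition tilde_bracket (R : realType) (A : algebroid_data R)
    (phi0 : cosection A) (X Y : section (line_bundle_prod A))
    : section (line_bundle_prod A) :=
  fun p => bracket (slice X p.2) (slice Y p.2) p.1
           + (phi0 p.1 (X p) : R) *: dt Y p - (phi0 p.1 (Y p) : R) *: dt X p.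

Definition tilde_anchor (R : realType) (A : algebroid_data R)
    (phi0 : cosection A) (p : line_prod (base A)) (v : line_bundle_prod A p)
    (f : line_prod (base A) -> R) : R :=
  @anchor R A p.1 v (fun x => f (x, p.2))
  + phi0 p.1 v * derive1 (fun s : R => f (p.1, s)) p.2.

Definition tilde (R : realType) (A : algebroid_data R) (phi0 : cosection A)
    : algebroid_data R :=
  @AlgebroidData R (line_prod (base A)) (line_bundle_prod A)
    (tilde_bracket phi0) (tilde_anchor phi0).

(* e^{-t} pi *)
Definition tilde_multisection (R : realType) (A : algebroid_data R)
    (phi0 : cosection A) (pi : multisection A) : multisection (tilde phi0) :=
  fun p s => expR (- p.2) * pi p.1 s.
Arguments tilde_multisection {R A} phi0 pi x s.

(* Main.v *)
From HB Require Import structures.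
Require Import Defs.
From mathcomp Require Import all_boot all_order all_algebra.
From mathcomp Require Import all_classical all_reals all_analysis.
From mathcomp Require Import ring zify.
Import Order.TTheory GRing.Theory Num.Theory.
Import numFieldNormedType.Exports.

Set Implicit Arguments.
Unset Strict Implicit.
Unset Printing Implicit Defensive.

Local Open Scope classical_set_scope.
Local Open Scope ring_scope.

(** A section pair (X, xi) lies in the graph of e^{-t} pi exactly when (e^t X, xi) lies in
    the graph of pi, and (X, xi) |-> (X, e^t xi) embeds the sections over M into those over
    M x R.  Under this rescaling the two Courant brackets correspond: differentiating
    X = e^{-t} pi^sharp xi in t turns the d/dt terms of the extended bracket into the
    phi0-terms of the Jacobi one.  The relation N_{L,L'} is the same at (x, t) and at x, and
    its extra torsion terms vanish because a pair (alpha, beta) in the costar annihilates the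
    t-derivative of a curve in the relation.  A Schouten bracket [,] on A extends to
      [D1, D2] + (-1)^{a1-1} iota_phi0 D1 /\ dD2/dt - dD1/dt /\ iota_phi0 D2,
    and conversely a Schouten bracket over M x R is evaluated on t-independent multisections;
    the identity [pi~, pi~] = e^{-2t} [pi, pi]_{phi0} then only needs
    [e^{-t}, P] = e^{-t} iota_phi0 P for every bivector P, which is algebraic for products of
    sections and reduces to them by cutting off a local frame with a bump function. *)

(** * Smooth functions on open sets of R^n *)

(** A Schouten bracket enters [jacobi_structure] and [poisson_structure] only through an existential
    quantifier, and its axioms constrain it only on global smooth multisections. Each direction
    therefore builds one bracket out of another. Forwards an explicit formula serves; backwards the
    bracket over M x R is known through its axioms alone, and these do not mention locality. This is
    what calls for bump functions, hence for a flat function on R and for compactness in charts: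
    multiplied by chi^3, a bivector becomes a finite sum of products of global sections. The weight
    of e^{-t} is forced: for e^{ct} pi the extended bracket gives e^{2ct} ([pi, pi] - 2c pi /\
    iota_phi0 pi), while [pi, pi]_{phi0} is [pi, pi] + 2 pi /\ iota_phi0 pi. Sections over M x R are
    differentiated in t inside a fixed fibre, in a basis of that fibre, whereas smoothness is known
    in trivialisations; testing a curve against all covectors reconciles the two. *)

Section CkCalculus.
Context (R : realType) (n : nat).
Implicit Types (U V : set 'rV[R]_n) (f g : 'rV[R]_n -> R) (k : nat).

Lemma derive_line f x v : 'D_v f x = derive1 (fun h : R => f (h *: v + x)) 0.
Proof.
rewrite derive1E /derive; set a := fun h => _; set b := fun h => _.
suff -> : a = b by [].
by rewrite funeqE /a /b => h /=; rewrite addr0 scale0r add0r [_%:A]mulr1.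
Qed.

Lemma is_derive1_comp (phi F : R -> R) (l x : R) :
  derivable F x 1 -> is_derive (F x) 1 phi l ->
  derivable (phi \o F) x 1 /\ derive1 (phi \o F) x = l * derive1 F x.
Proof.
move=> dF [dphi lE]; split.
  by move/derivable1_diffP in dF; move/derivable1_diffP in dphi;
    exact/derivable1_diffP/differentiable_comp.
by have := derive1_comp dF dphi; rewrite [in X in _ = X * _]derive1E lE.
Qed.

Lemma is_derive_comp1 (phi : R -> R) f x v (l : R) :
  is_derive (f x) 1 phi l -> derivable f x v ->
  is_derive x v (phi \o f) (l * 'D_v f x).
Proof.
move=> dphi /derivable1P df.
have f0 : (fun h : R => f (h *: v + x)) 0 = f x by rewrite scale0r add0r.
have [d e] : derivable (phi \o (fun h : R => f (h *: v + x))) 0 1 /\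
    derive1 (phi \o (fun h : R => f (h *: v + x))) 0 =
    l * derive1 (fun h : R => f (h *: v + x)) 0.
  by apply: (is_derive1_comp df); rewrite f0; exact: dphi.
by split; [exact/derivable1P | rewrite !derive_line].
Qed.

Lemma continuous_near_eq f g x :
  {near x, f =1 g} -> {for x, continuous f} -> {for x, continuous g}.
Proof.
move=> fg fc; have fgx : f x = g x := nbhs_singleton fg.
have {}fc : f @ x --> g x by rewrite -fgx; exact: fc.
apply: cvg_trans fc; exact: (near_eq_cvg (F := nbhs x) fg).
Qed.

(** Continuity and derivability at a point involve nearby values; openness of [U] turns equality on
    [U] into equality near each of its points. *)
Lemma Ck_ext k U f g : open U -> (forall x, U x -> f x = g x) ->
  Ck k U f -> Ck k U g.
Proof.
move=> oU; elim: k f g => [|k IH] f g fg /= [fc fd]; have nfg x : U x ->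
    {near x, f =1 g} by [move=> Ux; near=> y; apply: fg; near: y;
    exact: open_nbhs_nbhs].
  by split=> // x Ux; apply: continuous_near_eq (fc x Ux); exact: nfg.
split=> [x Ux|i]; first by apply: continuous_near_eq (fc x Ux); exact: nfg.
have [fdi fk] := fd i; split=> [x Ux|].
  by apply: near_eq_derivable (fdi x Ux); exact: nfg.
by apply: IH fk => x Ux; apply: near_eq_derive; exact: nfg.
Unshelve. all: by end_near. Qed.

Lemma Ck_subset k U V f : V `<=` U -> Ck k U f -> Ck k V f.
Proof.
move=> VU; elim: k f => [|k IH] f /= [fc fd].
  by split=> // x /VU; exact: fc.
split=> [x /VU|i]; first exact: fc.
have [fdi fk] := fd i; split=> [x /VU|]; first exact: fdi.
exact: IH.
Qed.

(** [Ck] is a conjunction, over the points of [U], of conditions on the iterated derivatives at that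
    point, so it can be checked one point at a time. *)
Lemma Ck_local k U f :
  (forall x, U x -> exists2 V, V x & Ck k V f) -> Ck k U f.
Proof.
elim: k f => [|k IH] f h /=.
  by split=> // x /h [V Vx [fc _]]; exact: fc.
split=> [x /h [V Vx [fc _]]|i]; first exact: fc.
split=> [x /h [V Vx [_ /(_ i) [fdi _]]]|]; first exact: fdi.
by apply: IH => x /h [V Vx [_ /(_ i) [_ fk]]]; exists V.
Qed.

Lemma Ck_cont k U f x : Ck k U f -> U x -> {for x, continuous f}.
Proof. by case: k => [|k] [fc _]; exact: fc. Qed.

Lemma Ck_le k U f : Ck k.+1 U f -> Ck k U f.
Proof.
elim: k f => [|k IH] f [fc fd]; first by split.
by split=> // i; have [fdi fk] := fd i; split=> //; exact: IH.
Qed.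

Lemma CkS_is_derive k U f (df : 'I_n -> 'rV[R]_n -> R) : open U ->
  (forall x, U x -> {for x, continuous f}) ->
  (forall i x, U x -> is_derive x (delta_mx 0 i) f (df i x)) ->
  (forall i, Ck k U (df i)) -> Ck k.+1 U f.
Proof.
move=> oU fc fd fk; split=> // i; split=> [x /(fd i) []//|].
by apply: Ck_ext (fk i) => // x /(fd i) [].
Qed.

Lemma Ck_cst k U (a : R) : Ck k U (cst a).
Proof.
elim: k U a => [|k IH] U a; first by split=> [x _|]; [exact: cst_continuous|].
split=> [x _|i]; first exact: cst_continuous.
split=> [x _|]; first exact: derivable_cst.
rewrite (_ : (fun x => _) = cst 0) //.
by apply/funext => x; rewrite derive_cst.
Qed.

Lemma Ck_add k U f g : open U -> Ck k U f -> Ck k U g ->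
  Ck k U (fun x => f x + g x).
Proof.
move=> oU; elim: k f g => [|k IH] f g fk gk.
  by split=> // x Ux; exact: (continuousD (Ck_cont fk Ux) (Ck_cont gk Ux)).
apply: (@CkS_is_derive _ _ _
  (fun i x => 'D_(delta_mx 0 i) f x + 'D_(delta_mx 0 i) g x)) => //.
- by move=> x Ux; exact: (continuousD (Ck_cont fk Ux) (Ck_cont gk Ux)).
- move=> i x Ux; have [_ /(_ i) [fd _]] := fk; have [_ /(_ i) [gd _]] := gk.
  exact: (is_deriveD (derivableP (fd x Ux)) (derivableP (gd x Ux))).
- by move=> i; apply: IH; [case: fk|case: gk] => _ /(_ i) [].
Qed.

Lemma Ck_mul k U f g : open U -> Ck k U f -> Ck k U g ->
  Ck k U (fun x => f x * g x).
Proof.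
move=> oU; elim: k f g => [|k IH] f g fk gk.
  by split=> // x Ux; exact: (continuousM (Ck_cont fk Ux) (Ck_cont gk Ux)).
apply: (@CkS_is_derive _ _ _
  (fun i x => f x * 'D_(delta_mx 0 i) g x + g x * 'D_(delta_mx 0 i) f x)) => //.
- by move=> x Ux; exact: (continuousM (Ck_cont fk Ux) (Ck_cont gk Ux)).
- move=> i x Ux; have [_ /(_ i) [fd _]] := fk; have [_ /(_ i) [gd _]] := gk.
  exact: (is_deriveM (derivableP (fd x Ux)) (derivableP (gd x Ux))).
- move=> i; apply: Ck_add => //; apply: IH; try exact: Ck_le.
    by case: gk => _ /(_ i) [].
  by case: fk => _ /(_ i) [].
Qed.

Lemma Ck_coord k U (i : 'I_n) : Ck k U (fun x => x 0 i).
Proof.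
have coordE (x v : 'rV[R]_n) : is_derive x v (fun x : 'rV[R]_n => x 0 i) (v 0 i).
  have E : (fun h => h^-1 *: (((fun x : 'rV[R]_n => x 0 i) \o shift x) (h *: v)
      - x 0 i)) @ 0^' --> v 0 i.
    apply: (@cvg_trans _ (cst (v 0 i) @ 0^')); last exact: cvg_cst.
    apply: near_eq_cvg; near=> h; rewrite /= !mxE addrK /cst.
    by rewrite [_ *: _]mulrA mulVf ?mul1r //; near: h; exact: nbhs_dnbhs_neq.
  split; first by apply/cvg_ex; exists (v 0 i).
  exact: cvg_lim.
have c x : {for x, continuous (fun x : 'rV[R]_n => x 0 i)}.
  exact: coord_continuous.
case: k => [|k]; first by split.
split=> // j; split=> [x _|]; first by case: (coordE x (delta_mx 0 j)).
have E : 'D_(delta_mx 0 j) (fun x : 'rV[R]_n => x 0 i) =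
    cst ((delta_mx 0 j : 'rV[R]_n) 0 i).
  by apply/funext => x; case: (coordE x (delta_mx 0 j)).
by have := @Ck_cst k U ((delta_mx 0 j : 'rV[R]_n) 0 i); rewrite -E.
Unshelve. all: by end_near. Qed.

Lemma Cinfty_cst U (a : R) : Cinfty U (cst a).
Proof. by move=> k; exact: Ck_cst. Qed.

Lemma Cinfty_add U f g : open U -> Cinfty U f -> Cinfty U g ->
  Cinfty U (fun x => f x + g x).
Proof. by move=> oU hf hg k; exact: Ck_add. Qed.

Lemma Cinfty_mul U f g : open U -> Cinfty U f -> Cinfty U g ->
  Cinfty U (fun x => f x * g x).
Proof. by move=> oU hf hg k; exact: Ck_mul. Qed.

Lemma Cinfty_ext U f g : open U -> (forall x, U x -> f x = g x) ->
  Cinfty U f -> Cinfty U g.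
Proof. by move=> oU fg hf k; exact: Ck_ext (hf k). Qed.

Lemma Cinfty_subset U V f : V `<=` U -> Cinfty U f -> Cinfty V f.
Proof. by move=> VU hf k; exact: Ck_subset (hf k). Qed.

Lemma Cinfty_local U f :
  (forall x, U x -> exists2 V, V x & Cinfty V f) -> Cinfty U f.
Proof.
by move=> h k; apply: Ck_local => x /h [V Vx fV]; exists V.
Qed.

Lemma Cinfty_sum U (I : Type) (r : seq I) (F : I -> 'rV[R]_n -> R) : open U ->
  (forall i, Cinfty U (F i)) -> Cinfty U (fun x => \sum_(i <- r) F i x).
Proof.
move=> oU hF; elim: r => [|i r IH].
  by apply: (Cinfty_ext oU _ (Cinfty_cst U 0)) => x _; rewrite big_nil.
apply: (Cinfty_ext oU _ (Cinfty_add oU (hF i) IH)) => x _.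
by rewrite big_cons.
Qed.

(** The chain rule replaces [phi] by its derivative, so the induction on the order runs over a whole
    class [P] stable under derivation: the partial derivatives of [phi \o f] are products of
    [q \o f], with [q] in [P], and partial derivatives of [f]. *)
Lemma Cinfty_comp1 (P : (R -> R) -> Prop) (phi : R -> R) U f : open U ->
  (forall p, P p -> exists2 q, P q & forall x : R, is_derive x 1 p (q x)) ->
  P phi -> Cinfty U f -> Cinfty U (phi \o f).
Proof.
move=> oU HP Pphi hf k; elim: k phi Pphi => [|k IH] phi Pphi.
  have [q _ dq] := HP _ Pphi; split=> // x Ux.
  apply: continuous_comp; first exact: (Ck_cont (hf 0%N) Ux).
  by apply/differentiable_continuous/derivable1_diffP; case: (dq (f x)).
have [q Pq dq] := HP _ Pphi.
apply: (@CkS_is_derive _ _ _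
  (fun i x => (q \o f) x * 'D_(delta_mx 0 i) f x)) => //.
- move=> x Ux; apply: continuous_comp; first exact: (Ck_cont (hf 0%N) Ux).
  by apply/differentiable_continuous/derivable1_diffP; case: (dq (f x)).
- by move=> i x Ux; apply: is_derive_comp1 => //; have [_ /(_ i) [fd _]] := hf 1%N;
    exact: fd.
- move=> i; apply: Ck_mul => //; first exact: IH.
  by have [_ /(_ i) []] := hf k.+1.
Qed.

End CkCalculus.

(** * A flat function *)

Section FlatFunctions.
Context (R : realType).
Implicit Types (n : nat) (x : R).

Definition flat_exp n x : R := if 0 < x then x ^- n * expR (- x^-1) else 0.

(** One term of the exponential series at 1/x, of order n + 2, beats x^-n with a factor x^2 to
    spare; a quadratic bound is what makes the derivative at 0 vanish. *)
Lemma flat_exp_le n x : 0 < x -> flat_exp n x <= n.+2`!%:R * x ^+ 2.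
Proof.
move=> x0; rewrite /flat_exp x0.
have xn k : 0 < x ^+ k by rewrite exprn_gt0.
have fn : 0 < n.+2`!%:R :> R by rewrite ltr0n fact_gt0.
have /(expR_ge1Dxn n.+1) h : 0 <= x^-1 by rewrite invr_ge0 ltW.
have {}h : x ^- n.+2 <= n.+2`!%:R * expR x^-1.
  rewrite mulrC -ler_pdivrMr // -exprVn; apply: le_trans h.
  by rewrite lerDr.
rewrite expRN ler_pdivrMr ?expR_gt0 //.
rewrite mulrAC -ler_pdivrMr ?xn // -invfM -exprD addn2.
exact: h.
Qed.

Lemma flat_exp_ge0 n x : 0 <= flat_exp n x.
Proof.
rewrite /flat_exp; case: ifP => // x0.
by rewrite mulr_ge0 ?expR_ge0 // invr_ge0 exprn_ge0 // ltW.
Qed.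

Lemma flat_exp_norm_le n x : `|flat_exp n x| <= n.+2`!%:R * x ^+ 2.
Proof.
rewrite ger0_norm ?flat_exp_ge0 //; have [x0|x0] := ltP 0 x.
  exact: flat_exp_le.
by rewrite /flat_exp ltNge x0 /= mulr_ge0 ?sqr_ge0.
Qed.

(** For x > 0 this is the product rule for x^-n and exp(-1/x). The derivative is a combination of
    functions of the same family, which is why the exponent [n] is a parameter. *)
Lemma is_derive_flat_exp n x :
  is_derive x 1 (flat_exp n) (flat_exp n.+2 x + (- n%:R) * flat_exp n.+1 x).
Proof.
have [x0|x0|x0] := ltgtP x 0.
- have -> : flat_exp n.+2 x + (- n%:R) * flat_exp n.+1 x = 0.
    by rewrite /flat_exp ltNge (ltW x0) /= mulr0 addr0.
  apply: (near_eq_is_derive _ (is_derive_cst (0 : R) x (1 : R))).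
  near=> y; rewrite /flat_exp ltNge ltW //=; near: y; exact: lt_nbhsl.
- have xn0 : x != 0 by rewrite gt_eqF.
  have dV : is_derive x 1 (fun y : R => y^-1) (- x ^- 2 *: 1).
    split; first by apply: derivableV.
    by rewrite deriveV // derive_id.
  have dN : is_derive x 1 (fun y : R => - y^-1) (- (- x ^- 2 *: 1)).
    exact: is_deriveN.
  have dE : is_derive x 1 (expR \o (fun y : R => - y^-1))
      (expR (- x^-1) * 'D_1 (fun y : R => - y^-1) x).
    have [d1 d2] := is_derive1_comp (ex_derive (is_derive := dN))
      (is_derive_expR (- x^-1)).
    by split; [exact: d1 | rewrite -derive1E d2 derive1E].
  have dX : is_derive x 1 ((fun y : R => y^-1) ^+ n)
    (n%:R * (x^-1) ^+ n.-1 *: (- x ^- 2 *: 1)) by exact: is_deriveX.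
  have := is_deriveM dX dE.
  have -> : 'D_1 (fun y : R => - y^-1) x = - (- x ^- 2 *: 1).
    by case: dN.
  rewrite (_ : ((fun y : R => y^-1) ^+ n) * (expR \o (fun y : R => - y^-1)) =
    (fun y => (y^-1) ^+ n * expR (- y^-1))); last first.
    by apply/funext => y; rewrite /= exprfctE.
  have nE : \forall y \near x, (fun y => (y^-1) ^+ n * expR (- y^-1)) y = flat_exp n y.
    near=> y; rewrite /flat_exp ifT ?exprVn //; near: y.
    exact: (open_nbhs_nbhs (conj (@open_gt R 0) x0)).
  move=> /(near_eq_is_derive nE) h; apply: (is_derive_eq h); rewrite /flat_exp x0 exprfctE /=.
  rewrite ![_ *: _]mulrA /= /GRing.scale /= !mulr1 -!exprVn !exprS expr0.
  case: n {dX nE h} => [|m] /=; first by rewrite !mul0r oppr0 !mul0r; ring.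
  by rewrite !exprS; ring.
- rewrite x0 (_ : _ + _ = 0); last by rewrite /flat_exp ltxx mulr0 addr0.
  have E : (fun h => h^-1 *: ((flat_exp n \o shift 0) (h *: (1 : R)) - flat_exp n 0))
      @ 0^' --> (0 : R).
    (* By the quadratic bound the difference quotient at 0 is at most (n + 2)! |h|. *)
    apply/cvgr0Pnorm_lt => e e0.
    have C0 : 0 < n.+2`!%:R :> R by rewrite ltr0n fact_gt0.
    near=> h.
    have h0 : h != 0 by near: h; exact: nbhs_dnbhs_neq.
    rewrite /= addr0 [flat_exp n 0]/flat_exp ltxx subr0 [h%:A]mulr1.
    rewrite normrZ normfV mulrC ltr_pdivrMr ?normr_gt0 //.
    apply: le_lt_trans (flat_exp_norm_le n h) _.
    rewrite -real_normK ?num_real // expr2 mulrA ltr_pM2r ?normr_gt0 //.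
    rewrite mulrC -ltr_pdivlMr //.
    near: h; apply: dnbhs0_lt; exact: divr_gt0.
  split; first by apply/cvg_ex; exists 0.
  exact: cvg_lim.
Unshelve. all: by end_near. Qed.

(** The class to which [Cinfty_comp1] is applied: unlike [flat_exp 0] alone, it is stable under
    derivation. *)
Inductive flat_span : (R -> R) -> Prop :=
| flat_span_exp n : flat_span (flat_exp n)
| flat_span_add a p q : flat_span p -> flat_span q ->
    flat_span (fun x => p x + a * q x).

Lemma flat_span_derive p : flat_span p ->
  exists2 q, flat_span q & forall x : R, is_derive x 1 p (q x).
Proof.
elim=> [n|a {}p q _ [p' hp dp] _ [q' hq dq]].
  exists (fun x => flat_exp n.+2 x + (- n%:R) * flat_exp n.+1 x).
    by apply: flat_span_add; exact: flat_span_exp.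
  exact: is_derive_flat_exp.
exists (fun x => p' x + a * q' x); first exact: flat_span_add.
by move=> x; exact: (is_deriveD (dp x) (is_deriveZ a (dq x))).
Qed.

Lemma Cinfty_flat_exp n (U : set 'rV[R]_n) (f : 'rV[R]_n -> R) : open U ->
  Cinfty U f -> Cinfty U (flat_exp 0 \o f).
Proof.
by move=> oU; apply: (Cinfty_comp1 oU flat_span_derive); exact: flat_span_exp.
Qed.

Lemma Cinfty_expR n (U : set 'rV[R]_n) (f : 'rV[R]_n -> R) : open U ->
  Cinfty U f -> Cinfty U (expR \o f).
Proof.
move=> oU; apply: (@Cinfty_comp1 _ _ (fun p => p = expR)) => // p ->.
by exists expR => // x; exact: is_derive_expR.
Qed.

End FlatFunctions.

(** * Smooth functions on manifolds and bump functions *)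

Section SmoothFunctions.
Context (R : realType) (M : manifold_data R).
Hypothesis charts : forall c : chart R M (mdim M), atlas c -> is_chart c.
Implicit Types (U V : set M) (f g : M -> R).

Lemma chart_image_open (c : chart R M (mdim M)) U : is_chart c -> open U ->
  open (cmap c @` (cdom c `&` U)).
Proof.
move=> [odom oim cK cc ic] oU; rewrite openE => _ [x [dx Ux] <-].
have im : (cmap c @` cdom c) (cmap c x) by exists x.
have nU : \forall v \near cmap c x, U (cinv c v).
  by apply: (ic _ im); rewrite cK //; exact: open_nbhs_nbhs.
have nim : \forall v \near cmap c x, (cmap c @` cdom c) v.
  exact: open_nbhs_nbhs.
rewrite /interior; near=> v.
have [y dy yv] : (cmap c @` cdom c) v by near: v.
exists y => //; split=> //.
have : U (cinv c v) by near: v.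
by rewrite -yv cK.
Unshelve. all: by end_near. Qed.

Lemma smooth_on_subset U V f : V `<=` U -> smooth_on U f -> smooth_on V f.
Proof.
move=> VU sf c ac; apply: Cinfty_subset (sf c ac) => _ [x [dx Vx] <-].
by exists x => //; split=> //; exact: VU.
Qed.

Lemma smooth_on_ext U f g : open U -> (forall x, U x -> f x = g x) ->
  smooth_on U f -> smooth_on U g.
Proof.
move=> oU fg sf c ac; apply: Cinfty_ext (sf c ac).
  exact: chart_image_open (charts ac) oU.
move=> _ [x [dx Ux] <-]; have [_ _ cK _ _] := charts ac.
by rewrite /= cK // fg.
Qed.

Lemma smooth_on_local U f :
  (forall x, U x -> exists2 V, V x & smooth_on V f) -> smooth_on U f.
Proof.
move=> h c ac; apply: Cinfty_local => _ [x [dx Ux] <-].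
have [V Vx sf] := h _ Ux; exists (cmap c @` (cdom c `&` V)); last exact: sf.
by exists x.
Qed.

Lemma smooth_on_cst U (a : R) : smooth_on U (fun=> a).
Proof. by move=> c _; exact: Cinfty_cst. Qed.

Lemma smooth_on_add U f g : open U -> smooth_on U f -> smooth_on U g ->
  smooth_on U (fun x => f x + g x).
Proof.
move=> oU sf sg c ac; apply: Cinfty_add (sf c ac) (sg c ac).
exact: chart_image_open (charts ac) oU.
Qed.

Lemma smooth_on_mul U f g : open U -> smooth_on U f -> smooth_on U g ->
  smooth_on U (fun x => f x * g x).
Proof.
move=> oU sf sg c ac; apply: Cinfty_mul (sf c ac) (sg c ac).
exact: chart_image_open (charts ac) oU.
Qed.

Lemma smooth_on_sum U (I : Type) (r : seq I) (F : I -> M -> R) : open U ->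
  (forall i, smooth_on U (F i)) -> smooth_on U (fun x => \sum_(i <- r) F i x).
Proof.
move=> oU sF c ac; apply: (@Cinfty_sum _ _ _ _ r (fun i => F i \o cinv c)).
  exact: chart_image_open (charts ac) oU.
by move=> i; exact: sF.
Qed.

Lemma smooth_on_expR U f : open U -> smooth_on U f ->
  smooth_on U (fun x => expR (f x)).
Proof.
move=> oU sf c ac; apply: Cinfty_expR (sf c ac).
exact: chart_image_open (charts ac) oU.
Qed.

Lemma smooth_on_flat_exp U f : open U -> smooth_on U f ->
  smooth_on U (fun x => flat_exp 0 (f x)).
Proof.
move=> oU sf c ac; apply: Cinfty_flat_exp (sf c ac).
exact: chart_image_open (charts ac) oU.
Qed.

(** [V] is covered by [U], where both factors are smooth, and by the open complement of [K], where
    the product is zero whatever [f] is. *)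
Lemma smooth_on_cutoff (K U V : set M) (chi f : M -> R) :
  closed K -> K `<=` U -> open U -> open V -> smooth_fun chi ->
  (forall x, ~ K x -> chi x = 0) -> smooth_on (U `&` V) f ->
  smooth_on V (fun x => chi x * f x).
Proof.
move=> cK KU oU oV schi chi0 sf; apply: smooth_on_local => x Vx.
have [Kx|nKx] := pselect (K x).
  exists (U `&` V); first by split=> //; exact: KU.
  apply: smooth_on_mul => //; first exact: openI.
  exact: smooth_on_subset schi.
exists (~` K) => //; apply: (smooth_on_ext (f := fun=> 0)).
- by rewrite openC.
- by move=> y nKy; rewrite chi0 ?mul0r.
- exact: smooth_on_cst.
Qed.

End SmoothFunctions.

(** In a chart around [p], exp(-1/r) with r = e^2 - |v - a|^2 is positive inside a ball and flat at
    its boundary, so it extends smoothly by zero. *)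
Lemma bump_function (R : realType) (M : manifold_data R) (U : set M) (p : M) :
  is_manifold M -> open U -> U p ->
  exists (chi : M -> R) (K : set M),
    [/\ smooth_fun chi, chi p != 0, closed K, K `<=` U &
        forall x, ~ K x -> chi x = 0].
Proof.
move=> [haus _ charts cover scoord] oU Up.
have [c ac cp] := cover p.
have [odom oim cK cc ic] := charts c ac.
pose a := cmap c p.
have oO := chart_image_open (charts c ac) oU.
have : nbhs a (cmap c @` (cdom c `&` U)) by apply: open_nbhs_nbhs; split => //; exists p.
move=> /nbhs_ballP [d /= d0 dO].
(* Half the radius puts the closed Euclidean ball of radius [e] inside the open sup-norm ball of
   radius [d]. The topology of row vectors comes from the sup norm, but [r] has to be smooth, hence
   the sum of squares. *)
pose e := d / 2; have e0 : 0 < e by exact: divr_gt0.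
pose r (v : 'rV[R]_(mdim M)) := e ^+ 2 - \sum_j (v 0 j - a 0 j) ^+ 2.
pose S := [set v | 0 <= r v].
have Scoord v j : S v -> `|v 0 j - a 0 j| <= e.
  rewrite /S /r /= subr_ge0 => h.
  suff : `|v 0 j - a 0 j| ^+ 2 <= e ^+ 2.
    by rewrite ler_pXn2r // nnegrE ltW.
  rewrite real_normK ?num_real //.
  apply: le_trans h; rewrite (bigD1 j) //= lerDl.
  by apply: sumr_ge0 => k _; exact: sqr_ge0.
have SO : S `<=` cmap c @` (cdom c `&` U).
  move=> v Sv; apply: dO; split => // i j.
  rewrite (ord1 i) /ball /= distrC (le_lt_trans (Scoord v j Sv)) //.
  by rewrite /e ltr_pdivrMr // ltr_pMr // ltr1n.
have rcont : continuous r.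
  move=> v; have oT : open [set: 'rV[R]_(mdim M)] by exact: openT.
  have sub j : Cinfty setT (fun v : 'rV[R]_(mdim M) => v 0 j + - a 0 j).
    by apply: Cinfty_add => //; [move=> k; exact: Ck_coord|exact: Cinfty_cst].
  apply: (Ck_cont (k := 0) (U := setT)) => //.
  apply: (Cinfty_ext oT _ (Cinfty_add oT (Cinfty_cst setT (e ^+ 2))
    (Cinfty_mul oT (Cinfty_cst setT (-1)) (Cinfty_sum (index_enum _) oT
      (fun j => Cinfty_mul oT (sub j) (sub j)))))) => x _.
  by rewrite /r /cst mulN1r.
have Scompact : compact S.
  apply: bounded_closed_compact; last first.
    rewrite (_ : S = r @^-1` [set x | 0 <= x]) //.
    by apply: closed_comp; [move=> v _; exact: rcont|exact: closed_ge].
  exists (\sum_j `|a 0 j| + e); split; first exact: num_real.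
  move=> z ze v Sv; apply: le_trans (ltW ze).
  rewrite [leLHS]/Num.norm /= mx_normrE; apply: bigmax_le.
    by apply: addr_ge0; [apply: sumr_ge0 => ? _; exact: normr_ge0|exact: ltW].
  move=> [i j] _ /=; rewrite (ord1 i) -(subrK (a 0 j) (v 0 j)) addrC.
  apply: le_trans (ler_normD _ _) _; apply: lerD; last exact: Scoord.
  by rewrite (bigD1 j) //= lerDl; apply: sumr_ge0 => ? _; exact: normr_ge0.
pose K := cinv c @` S.
(* The image of the compact ball is compact, hence closed since the manifold is Hausdorff;
   closedness is what makes the extension of [chi] by zero smooth outside the chart. *)
have Kclosed : closed K.
  apply: compact_closed => //; apply: continuous_compact => //.
  apply: continuous_in_subspaceT => v; rewrite inE => Sv.
  have [y [dy _] <-] := SO v Sv; apply: ic; by exists y.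
have KU : K `<=` cdom c `&` U.
  by move=> _ [v /SO [y [dy Uy] <-] <-]; rewrite cK.
pose chi x := if `[< cdom c x >] then flat_exp 0 (r (cmap c x)) else 0.
have chi0 x : ~ K x -> chi x = 0.
  rewrite /chi; case: asboolP => // dx nKx; rewrite /flat_exp; case: ifP => // r0.
  by case: nKx; exists (cmap c x); [exact: ltW|exact: cK].
exists chi, K; split => //.
- apply: smooth_on_local => x _; have [dx|nKx] := pselect (cdom c x).
    exists (cdom c) => //.
    apply: (smooth_on_ext charts (f := fun x => flat_exp 0 (r (cmap c x)))) => //.
      by move=> y dy; rewrite /chi asboolT.
    apply: smooth_on_flat_exp => //.
    have cst b : smooth_on (cdom c) (fun=> b) by exact: smooth_on_cst.
    have sub j : smooth_on (cdom c) (fun y => cmap c y 0 j + - a 0 j).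
      by apply: smooth_on_add => //; exact: scoord.
    apply: (smooth_on_ext charts (f := fun y => e ^+ 2 +
      (-1) * \sum_j (cmap c y 0 j + - a 0 j) * (cmap c y 0 j + - a 0 j))) => //.
      by move=> y _; rewrite /r mulN1r.
    apply: smooth_on_add => //; apply: smooth_on_mul => //.
    by apply: smooth_on_sum => // j; exact: smooth_on_mul.
  have nK : ~ K x by move/KU => [].
  exists (~` K) => //; apply: (smooth_on_ext charts (f := fun=> 0)).
  + by rewrite openC.
  + by move=> y nKy; rewrite chi0.
  + exact: smooth_on_cst.
- rewrite /chi asboolT // /flat_exp /r.
  rewrite [X in _ - X]big1 ?subr0 => [|j _]; last by rewrite subrr expr0n.
  by rewrite exprn_gt0 // expr0 invr1 mul1r gt_eqF ?expR_gt0.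
- by move=> x /KU [].
Qed.

(** * The manifold M x R *)

Lemma continuous_pair (T U V : topologicalType) (f : T -> U) (g : T -> V) x :
  {for x, continuous f} -> {for x, continuous g} ->
  {for x, continuous (fun y => (f y, g y))}.
Proof. by move=> cf cg; exact: (cvg_pair cf cg). Qed.

Section LineCoordinates.
Context (R : realType) (n : nat).

Lemma continuous_row_mx (T : topologicalType) (f : T -> 'rV[R]_n) (g : T -> R) x :
  {for x, continuous f} -> {for x, continuous g} ->
  {for x, continuous (fun y => row_mx (f y) (g y)%:M : 'rV[R]_(n + 1))}.
Proof.
move=> cf cg A /nbhs_ballP [e /= e0 eA].
have nf : \forall y \near x, ball (f x) e (f y).
  by apply: cf; exact: nbhsx_ballx.
have ng : \forall y \near x, ball (g x) e (g y).
  by apply: cg; exact: nbhsx_ballx.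
rewrite nbhs_simpl /=; near=> y; apply: eA.
have [_ bf] : ball (f x) e (f y) by near: y.
have bg : ball (g x) e (g y) by near: y.
split=> // i j; case: (splitP j) => k jk.
  have -> : j = lshift 1 k by exact: val_inj.
  by rewrite !row_mxEl; exact: bf.
have -> : j = rshift n k by exact: val_inj.
by rewrite !row_mxEr !mxE (ord1 i) (ord1 k).
Unshelve. all: by end_near. Qed.

(** Derivatives along the first n directions are those of [f] composed with [lsubmx], and the
    derivative along the last one is zero, so the induction stays within functions of this form. *)
Lemma Ck_comp_lsubmx k (W : set 'rV[R]_n) (f : 'rV[R]_n -> R) :
  Ck k W f -> Ck k [set v : 'rV[R]_(n + 1) | W (lsubmx v)] (f \o lsubmx).
Proof.
have cl (g : 'rV[R]_n -> R) (v : 'rV[R]_(n + 1)) :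
    {for lsubmx v, continuous g} -> {for v, continuous (g \o lsubmx)}.
  by move=> cg; exact: (continuous_comp (@continuous_lsubmx R 1 n 1 v) cg).
elim: k f => [|k IH] f [fc fd]; split=> //=.
- by move=> v Wv; apply: cl; exact: fc.
- by move=> v Wv; apply: cl; exact: fc.
move=> i.
have quot (v : 'rV[R]_(n + 1)) : (fun h : R => h^-1 *: (((f \o lsubmx) \o shift v)
      (h *: delta_mx 0 i) - (f \o lsubmx) v)) =
    (fun h : R => h^-1 *: ((f \o shift (lsubmx v))
      (h *: lsubmx (delta_mx 0 i)) - f (lsubmx v))).
  by apply/funext => h /=; rewrite linearP.
have Dv v : 'D_(delta_mx 0 i) (f \o lsubmx) v =
    'D_(lsubmx (delta_mx 0 i)) f (lsubmx v) by rewrite /derive quot.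
have dv v : derivable f (lsubmx v) (lsubmx (delta_mx 0 i)) ->
    derivable (f \o lsubmx) v (delta_mx 0 i) by rewrite /derivable quot.
case: (splitP i) => j ij.
- have E : lsubmx (delta_mx 0 i : 'rV[R]_(n + 1)) = delta_mx 0 j.
    by rewrite (_ : i = lshift 1 j) ?delta_mx_lshift ?row_mxKl //; exact: val_inj.
  have [fdj fk] := fd j; split=> [v Wv|].
    by apply: dv; rewrite E; exact: fdj.
  have -> : (fun v => 'D_(delta_mx 0 i) (f \o lsubmx) v) =
    (fun x => 'D_(delta_mx 0 j) f x) \o lsubmx.
    by apply/funext => v; rewrite Dv E.
  exact: IH.
- have E : lsubmx (delta_mx 0 i : 'rV[R]_(n + 1)) = 0.
    by rewrite (_ : i = rshift n j) ?delta_mx_rshift ?row_mxKl //; exact: val_inj.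
  split=> [v Wv|]; first by apply: dv; rewrite E; exact: derivable0.
  have -> : (fun v => 'D_(delta_mx 0 i) (f \o lsubmx) v) = cst 0.
    by apply/funext => v; rewrite Dv E derive0.
  exact: Ck_cst.
Qed.

Lemma Ck_row_mx k (W : set 'rV[R]_(n + 1)) (f : 'rV[R]_(n + 1) -> R) (t : R) :
  Ck k W f ->
  Ck k [set v : 'rV[R]_n | W (row_mx v t%:M)] (fun v => f (row_mx v t%:M)).
Proof.
have cl (g : 'rV[R]_(n + 1) -> R) (v : 'rV[R]_n) :
    {for row_mx v t%:M, continuous g} ->
    {for v, continuous (fun v => g (row_mx v t%:M))}.
  move=> cg; apply: (continuous_comp (f := fun v => row_mx v t%:M)) cg.
  by apply: (@continuous_row_mx _ id (cst t)); [exact: cvg_id|exact: cst_continuous].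
elim: k f => [|k IH] f [fc fd]; split=> //=.
- by move=> v Wv; apply: cl; exact: fc.
- by move=> v Wv; apply: cl; exact: fc.
move=> i; have [fdi fk] := fd (lshift 1 i).
have quot (v : 'rV[R]_n) : (fun h : R => h^-1 *: (((fun v => f (row_mx v t%:M)) \o
      shift v) (h *: delta_mx 0 i) - f (row_mx v t%:M))) =
    (fun h : R => h^-1 *: ((f \o shift (row_mx v t%:M))
      (h *: delta_mx 0 (lshift 1 i)) - f (row_mx v t%:M))).
  apply/funext => h /=; rewrite delta_mx_lshift scale_row_mx add_row_mx.
  by rewrite scaler0 add0r.
split=> [v Wv|]; first by rewrite /derivable quot; exact: fdi.
have -> : (fun v => 'D_(delta_mx 0 i) (fun v => f (row_mx v t%:M)) v) =
  (fun v => (fun w => 'D_(delta_mx 0 (lshift 1 i)) f w) (row_mx v t%:M)).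
  by apply/funext => v; rewrite /derive quot.
exact: (IH _ fk).
Qed.

End LineCoordinates.

Section LineProduct.
Context (R : realType) (M : manifold_data R).
Hypothesis charts : forall c : chart R M (mdim M), atlas c -> is_chart c.
Let L := line_prod M.

Lemma open_cylinder (U : set M) : open U -> open (U `*` [set: R] : set L).
Proof.
move=> oU; have -> : (U `*` [set: R]) = (fst : L -> M) @^-1` U.
  by apply/seteqP; split=> p /=; [case|split].
by apply: open_comp => // p _; exact: cvg_fst.
Qed.

Lemma prod_chart_image (c : chart R M (mdim M)) (U : set M) :
  cmap (prod_chart c) @` (cdom (prod_chart c) `&` (U `*` setT)) =
  [set v | (cmap c @` (cdom c `&` U)) (lsubmx v)].
Proof.
apply/seteqP; split=> [_ [[x t] [[/= dx _] [/= Ux _]] <-]|v [x [dx Ux] xv]].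
  by rewrite /= row_mxKl; exists x.
exists (x, rsubmx v 0 0) => //=; rewrite xv.
rewrite -[RHS]hsubmxK; congr row_mx; apply/matrixP => i j.
by rewrite (ord1 i) (ord1 j) !mxE eqxx mulr1n.
Qed.

Lemma line_charts (c : chart R L (mdim L)) : atlas c -> is_chart c.
Proof.
move=> [d /charts dch <-]; have [odom oim cK cc ic] := dch.
have imE : cmap (prod_chart d) @` cdom (prod_chart d) =
    [set v | (cmap d @` cdom d) (lsubmx v)].
  have := prod_chart_image d setT.
  rewrite setIT => <-; congr (_ @` _).
  by apply/seteqP; split=> [[x t] [/= dx _]|[x t] [[/= dx _] _]].
split.
- exact: open_cylinder.
- rewrite imE; apply: (open_comp (f := lsubmx) (D := cmap d @` cdom d)) => // v _.
  exact: continuous_lsubmx.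
- by move=> [x t] [/= dx _]; rewrite row_mxKl row_mxKr cK // mxE eqxx mulr1n.
- move=> [x t] [/= dx _]; apply: continuous_row_mx; last exact: cvg_snd.
  apply: (continuous_comp (f := (fst : L -> M)) (g := cmap d)); first exact: cvg_fst.
  exact: cc.
- rewrite imE => v /= Wv.
  apply: (@continuous_pair _ _ _ (fun v => cinv d (lsubmx v))
    (fun v : 'rV[R]_(mdim M + 1) => rsubmx v 0 0)).
    apply: (continuous_comp (f := lsubmx) (g := cinv d)); first exact: continuous_lsubmx.
    exact: ic.
  apply: (continuous_comp (f := rsubmx) (g := fun w : 'rV[R]_1 => w 0 0)).
    exact: continuous_rsubmx.
  exact: coord_continuous.
Qed.

Lemma smooth_on_fst (U : set M) (f : M -> R) :
  smooth_on U f -> @smooth_on R L (U `*` setT) (fun p => f p.1).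
Proof.
move=> sf _ [c ac <-] k; rewrite (prod_chart_image c U).
exact: Ck_comp_lsubmx (sf c ac k).
Qed.

Lemma smooth_fun_fst (f : M -> R) :
  smooth_fun f -> smooth_fun (fun p : L => f p.1).
Proof. by move=> /smooth_on_fst; rewrite setXTT. Qed.

Lemma smooth_on_slice (U : set M) (f : L -> R) t :
  @smooth_on R L (U `*` setT) f -> smooth_on U (fun x => f (x, t)).
Proof.
move=> sf c ac k; have := sf (prod_chart c) _ k.
rewrite (prod_chart_image c U) => /(_ (ex_intro2 _ _ c ac erefl)).
move=> /(Ck_row_mx t) h.
have E : (fun v : 'rV_(mdim M) => (f \o cinv (prod_chart c)) (row_mx v t%:M)) =
    (fun x => f (x, t)) \o cinv c.
  by apply/funext => v /=; rewrite row_mxKl row_mxKr mxE eqxx mulr1n.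
rewrite E in h; apply: Ck_subset h => v Wv /=.
by rewrite row_mxKl.
Qed.

Lemma smooth_fun_slice (f : L -> R) t :
  smooth_fun f -> smooth_fun (fun x => f (x, t)).
Proof. by move=> sf; apply: smooth_on_slice; rewrite setXTT. Qed.

Lemma smooth_fun_snd : smooth_fun (fun p : L => p.2).
Proof.
move=> _ [c ac <-] k.
have -> : (fun p : L => p.2) \o cinv (prod_chart c) =
  (fun v : 'rV_(mdim M + 1) => v 0 (rshift (mdim M) 0)).
  by apply/funext => v /=; rewrite mxE.
exact: Ck_coord.
Qed.

Lemma smooth_fun_expRM (a : R) : smooth_fun (fun p : L => expR (a * p.2)).
Proof.
apply: (smooth_on_expR line_charts openT).
apply: (smooth_on_mul line_charts openT); first exact: smooth_on_cst.
exact: smooth_fun_snd.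
Qed.

(** In a product chart the curve s -> (x, s) is a coordinate line, the last one. *)
Lemma smooth_on_derivable_line (V : set L) (f : L -> R) x t :
  (exists2 c : chart R M (mdim M), atlas c & cdom c x) ->
  smooth_on V f -> V (x, t) -> derivable (fun s => f (x, s)) t 1.
Proof.
move=> [c ac dx] sf Vxt; have [_ _ cK _ _] := charts ac.
have [_ /(_ (rshift (mdim M) 0)) [fd _]] := sf _ (ex_intro2 _ _ c ac erefl) 1%N.
have /fd : (cmap (prod_chart c) @` (cdom (prod_chart c) `&` V)) (row_mx (cmap c x) t%:M).
  by exists (x, t).
rewrite /derivable.
set a := fun h => _; set b := fun h => _; suff -> : a = b by [].
rewrite funeqE /a /b => h /=.
rewrite delta_mx_rshift scale_row_mx add_row_mx scaler0 add0r !row_mxKl !row_mxKr.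
by rewrite cK // !mxE !eqxx !mulr1n.
Qed.

End LineProduct.

(** * Dual spaces and derivatives of curves *)

Section DualSpaces.
Context (R : realType).
Implicit Types V W : vectType R.

Lemma linfun_linear V W (f : V -> W) : linear f -> linfun f =1 f.
Proof.
move=> lf; pose F := GRing.isLinear.Build _ _ _ _ f lf.
pose g : {linear V -> W} := HB.pack f F.
exact: (lfunE g).
Qed.

Definition vcoord V (i : 'I_(\dim (fullv : {vspace V}))) : dual V :=
  linfun (fun v : V => coord (vbasis (fullv : {vspace V})) i v : R^o).

Lemma vcoordE V i (v : V) : vcoord i v = coord (vbasis fullv) i v.
Proof. by rewrite /vcoord linfun_linear // => a u w; rewrite linearP. Qed.

Lemma vcoord_sum V (v : V) : v = \sum_i vcoord i v *: (vbasis (fullv : {vspace V}))`_i.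
Proof.
rewrite {1}(coord_vbasis (memvf v)); apply: eq_bigr => i _.
by rewrite vcoordE.
Qed.

Lemma dual_sum V (l : dual V) (v : V) :
  l v = \sum_i vcoord i v * l (vbasis (fullv : {vspace V}))`_i.
Proof.
rewrite {1}(vcoord_sum v) linear_sum; apply: eq_bigr => i _.
by rewrite linearZ.
Qed.

Lemma dualP V (l : dual V) a (v w : V) : l (a *: v + w) = a * l v + l w.
Proof. by rewrite linearP. Qed.

Lemma dualZ V (l : dual V) a (v : V) : l (a *: v) = a * (l v : R) :> R.
Proof. by rewrite linearZ. Qed.

Lemma dualD V (l : dual V) (v w : V) : l (v + w) = (l v : R) + (l w : R) :> R.
Proof. by rewrite linearD. Qed.

Lemma dualN V (l : dual V) (v : V) : l (- v) = - (l v : R) :> R.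
Proof. by rewrite linearN. Qed.

Lemma dual_scaleE V a (l : dual V) (v : V) : (a *: l) v = a * (l v : R) :> R.
Proof. by rewrite scale_lfunE. Qed.

Lemma dual_addE V (l m : dual V) (v : V) : (l + m) v = (l v : R) + (m v : R) :> R.
Proof. by rewrite add_lfunE. Qed.

Lemma dual_oppE V (l : dual V) (v : V) : (- l) v = - (l v : R) :> R.
Proof. by rewrite opp_lfunE. Qed.

(** Reflexivity in finite dimension: [v] is the vector whose coordinates are the values of [phi] on
    the coordinate forms. *)
Lemma dual_reflexive V (phi : dual V -> R) :
  (forall a l l', phi (a *: l + l') = a * phi l + phi l') ->
  exists v : V, forall l : dual V, l v = phi l.
Proof.
move=> lphi; pose b := vbasis (fullv : {vspace V}).
exists (\sum_(i < \dim (fullv : {vspace V})) phi (vcoord i) *: b`_i) => l.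
have phi0 : phi 0 = 0.
  by have := lphi (-1) 0 0; rewrite scaler0 addr0 mulN1r addNr.
have phiZ a m : phi (a *: m) = a * phi m.
  by have := lphi a m 0; rewrite !addr0 phi0 addr0.
have phiD m m' : phi (m + m') = phi m + phi m'.
  by have := lphi 1 m m'; rewrite scale1r mul1r.
have {2}-> : l = \sum_(i < \dim (fullv : {vspace V})) l b`_i *: vcoord i.
  apply/lfunP => v; rewrite sum_lfunE dual_sum; apply: eq_bigr => i _.
  by rewrite scale_lfunE mulrC.
rewrite linear_sum (big_morph phi phiD phi0); apply: eq_bigr => i _.
by rewrite linearZ phiZ; exact: mulrC.
Qed.

Definition evalv V (v : V) : dual (dual V) := linfun (fun l : dual V => l v : R^o).

Lemma evalvE V (v : V) (l : dual V) : evalv v l = l v.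
Proof.
by rewrite /evalv linfun_linear // => a m m'; rewrite add_lfunE scale_lfunE.
Qed.

Lemma dual_separates V (v w : V) : (forall l : dual V, l v = l w) -> v = w.
Proof.
by move=> vw; rewrite (vcoord_sum v) (vcoord_sum w); apply: eq_bigr => i _; rewrite vw.
Qed.

End DualSpaces.

Section Curves.
Context (R : realType).
Implicit Types V : vectType R.

(** The sum that defines [dt], for a curve in a single vector space: [dt X (x, t)] is
    [dvec (fun s => X (x, s)) t] by conversion. *)
Definition dvec V (c : R -> V) (t : R) : V :=
  \sum_i derive1 (fun s : R => coord (vbasis (fullv : {vspace V})) i (c s) : R) t
    *: (vbasis (fullv : {vspace V}))`_i.

(** Weak derivability. Being independent of a basis, it can be checked in a trivialisation and then
    used in the basis of [dvec]. *)
Definition vderivable V (c : R -> V) (t : R) : Prop :=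
  forall l : dual V, derivable (fun s : R => l (c s) : R) t 1.

Lemma is_derive_bigsum (n : nat) (f : 'I_n -> R -> R) (df : 'I_n -> R) (t : R) :
  (forall i, is_derive t 1 (f i) (df i)) ->
  is_derive t 1 (fun s => \sum_i f i s) (\sum_i df i).
Proof.
move=> h; rewrite (_ : (fun s => _) = \sum_i f i); first exact: is_derive_sum.
by apply/funext => s; rewrite fct_sumE.
Qed.

Lemma is_derive_mulr (f : R -> R) (d a t : R) :
  is_derive t 1 f d -> is_derive t 1 (fun s => f s * a) (d * a).
Proof.
move=> h; have E : is_derive t (1 : R) (fun s => a *: f s) (a *: d) := is_deriveZ a h.
rewrite (_ : (fun s => f s * a) = (fun s => a *: f s)); last first.
  by apply/funext => s; exact: mulrC.
by rewrite (_ : d * a = a *: d) //; exact: mulrC.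
Qed.

Lemma is_derive_dual V (c : R -> V) t : vderivable c t -> forall l : dual V,
  is_derive t 1 (fun s : R => l (c s) : R) (l (dvec c t)).
Proof.
move=> dc l; rewrite /dvec linear_sum.
rewrite (_ : (fun s => _) = (fun s => \sum_i vcoord i (c s) * l (vbasis fullv)`_i)).
  apply: is_derive_bigsum => i; rewrite linearZ /=.
  rewrite (_ : (fun s : R => coord _ i (c s) : R) = (fun s => vcoord i (c s) : R)).
    rewrite derive1E; exact: is_derive_mulr (derivableP (dc (vcoord i))).
  by apply/funext => s; rewrite vcoordE.
by apply/funext => s; rewrite -dual_sum.
Qed.

(** By reflexivity every covector on the dual space is the evaluation at a vector. *)
Lemma vderivable_dualP V (xi : R -> dual V) t :
  (forall v : V, derivable (fun s : R => xi s v : R) t 1) -> vderivable xi t.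
Proof.
move=> h L; have [v vL] := @dual_reflexive R V (fun l => L l) (fun a l l' => dualP L a l l').
by rewrite (_ : (fun s => _) = (fun s => xi s v : R)) //; apply/funext => s.
Qed.

Lemma is_derive_eval V (xi : R -> dual V) t : vderivable xi t -> forall v : V,
  is_derive t 1 (fun s : R => xi s v : R) (dvec xi t v).
Proof.
move=> dxi v; have := is_derive_dual dxi (evalv v); rewrite evalvE.
by rewrite (_ : (fun s => _) = (fun s => xi s v : R)) //; apply/funext => s;
  rewrite evalvE.
Qed.

Lemma is_derive_pairing V (xi : R -> dual V) (c : R -> V) t :
  vderivable xi t -> vderivable c t ->
  is_derive t 1 (fun s : R => xi s (c s) : R)
    (dvec xi t (c t) + xi t (dvec c t)).
Proof.
move=> dxi dc.
rewrite (_ : (fun s => _) =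
  (fun s => \sum_i vcoord i (c s) * xi s (vbasis fullv)`_i)); last first.
  by apply/funext => s; rewrite -dual_sum.
rewrite (dual_sum (dvec xi t)) (dual_sum (xi t)) -big_split /=.
apply: is_derive_bigsum => i.
have := is_deriveM (is_derive_dual dc (vcoord i))
  (is_derive_eval dxi (vbasis fullv)`_i).
by rewrite /GRing.scale /= [X in _ + X]mulrC.
Qed.

End Curves.

(** * Smooth sections *)

Section Bundles.
Context (R : realType) (M : manifold_data R) (E : bundle_data M).
Hypothesis charts : forall c : chart R M (mdim M), atlas c -> is_chart c.
Hypothesis bundleE : is_bundle E.
Implicit Types (U V : set M) (X Y : section E) (xi eta : cosection E).

Lemma coframeE (tau : triv E (rank E)) j x (v : E x) :
  coframe tau j x v = tmap tau x v 0 j.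
Proof.
by rewrite /coframe linfun_linear // => a u w; rewrite linearP !mxE.
Qed.

Lemma frame_sum (tau : triv E (rank E)) x (v : E x) : trivs tau -> tdom tau x ->
  v = \sum_i tmap tau x v 0 i *: frame tau i x.
Proof.
move=> ttau dx; have [_ _ /(_ _ ttau _ dx) [tK _] _] := bundleE.
rewrite -{1}(tK v) {1}(row_sum_delta (tmap tau x v)) linear_sum.
by apply: eq_bigr => i _; rewrite linearZ.
Qed.

Lemma tmap_frame (tau : triv E (rank E)) x i j : trivs tau -> tdom tau x ->
  tmap tau x (frame tau i x) 0 j = (i == j)%:R.
Proof.
move=> ttau dx; have [_ _ /(_ _ ttau _ dx) [_ Kt] _] := bundleE.
by rewrite /frame Kt !mxE eqxx /= eq_sym.
Qed.

Lemma dual_frame_sum (tau : triv E (rank E)) x (l : dual (E x)) (v : E x) :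
  trivs tau -> tdom tau x -> l v = \sum_i l (frame tau i x) * tmap tau x v 0 i.
Proof.
move=> ttau dx; rewrite {1}(frame_sum v ttau dx) linear_sum.
by apply: eq_bigr => i _; rewrite linearZ; exact: mulrC.
Qed.

Lemma coframe_sum (tau : triv E (rank E)) x (l : dual (E x)) :
  trivs tau -> tdom tau x -> l = \sum_i l (frame tau i x) *: coframe tau i x.
Proof.
move=> ttau dx; apply/lfunP => v; rewrite (dual_frame_sum l v ttau dx) sum_lfunE.
by apply: eq_bigr => i _; rewrite scale_lfunE coframeE.
Qed.

Lemma trivs_open (tau : triv E (rank E)) : trivs tau -> open (tdom tau).
Proof. by case: bundleE => h _ _ _; exact: h. Qed.

Lemma trivs_cover (x : M) : exists2 tau : triv E (rank E), trivs tau & tdom tau x.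
Proof. by case: bundleE. Qed.

Lemma smooth_transition (tau tau' : triv E (rank E)) i j : trivs tau -> trivs tau' ->
  smooth_on (tdom tau' `&` tdom tau) (fun x => tmap tau' x (frame tau i x) 0 j).
Proof. by move=> ttau ttau'; case: bundleE => _ _ _ /(_ _ ttau i _ ttau' j). Qed.

(** One trivialisation around each point suffices: in any other one the components change by
    transition functions, which are smooth. *)
Lemma smooth_section_on_local U X : open U ->
  (forall x, U x -> exists2 tau : triv E (rank E), trivs tau /\ tdom tau x &
     forall i, smooth_on (tdom tau `&` U) (fun x => tmap tau x (X x) 0 i)) ->
  smooth_section_on U X.
Proof.
move=> oU h tau' ttau' j; apply: smooth_on_local => x [dx' Ux].
have [tau [ttau dx] sX] := h x Ux.
have ot := trivs_open ttau; have ot' := trivs_open ttau'.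
exists (tdom tau' `&` (tdom tau `&` U)) => //.
have oI : open (tdom tau' `&` (tdom tau `&` U)) by do 2![apply: openI => //].
apply: (smooth_on_ext charts (f := fun x =>
  \sum_i tmap tau x (X x) 0 i * tmap tau' x (frame tau i x) 0 j)) => //.
  move=> y [_ [dy _]]; rewrite {2}(frame_sum (X y) ttau dy) linear_sum summxE.
  by apply: eq_bigr => i _; rewrite linearZ mxE.
apply: (smooth_on_sum charts) => // i; apply: (smooth_on_mul charts) => //.
  by apply: smooth_on_subset (sX i) => y [].
by apply: smooth_on_subset (smooth_transition i j ttau ttau') => y [? []].
Qed.

Lemma smooth_pairing xi X : smooth_cosection xi -> smooth_section X ->
  smooth_fun (fun x => xi x (X x)).
Proof.
move=> sxi sX; apply: smooth_on_local => x _.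
have [tau ttau dx] := trivs_cover x; exists (tdom tau) => //.
have ot := trivs_open ttau.
apply: (smooth_on_ext charts (f := fun x =>
  \sum_i xi x (frame tau i x) * tmap tau x (X x) 0 i)) => //.
  by move=> y dy; rewrite -(dual_frame_sum _ _ ttau dy).
apply: (smooth_on_sum charts) => // i; apply: (smooth_on_mul charts) => //.
  by have := sxi tau ttau i; rewrite setIT.
by have := sX tau ttau i; rewrite setIT.
Qed.

Lemma smooth_section0 : smooth_section (fun x => 0 : E x).
Proof.
move=> tau ttau i; rewrite setIT.
apply: (smooth_on_ext charts (f := fun=> 0)); first exact: trivs_open.
  by move=> x _; rewrite linear0 mxE.
exact: smooth_on_cst.
Qed.

Lemma smooth_sectionM (f : M -> R) X : smooth_fun f -> smooth_section X ->
  smooth_section (fun x => f x *: X x).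
Proof.
move=> sf sX tau ttau i.
have ot : open (tdom tau `&` setT) by rewrite setIT; exact: trivs_open.
apply: (smooth_on_ext charts (f := fun x => f x * tmap tau x (X x) 0 i)) => //.
  by move=> x _; rewrite linearZ mxE.
apply: (smooth_on_mul charts) => //; last exact: sX.
exact: smooth_on_subset sf.
Qed.

Lemma smooth_cosectionM (f : M -> R) xi : smooth_fun f -> smooth_cosection xi ->
  smooth_cosection (fun x => f x *: xi x).
Proof.
move=> sf sX tau ttau i.
have ot : open (tdom tau `&` setT) by rewrite setIT; exact: trivs_open.
apply: (smooth_on_ext charts (f := fun x => f x * xi x (frame tau i x))) => //.
  by move=> x _; rewrite scale_lfunE.
apply: (smooth_on_mul charts) => //; last exact: sX.
exact: smooth_on_subset sf.
Qed.

Lemma smooth_section_cutoff (K : set M) chi U X :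
  closed K -> K `<=` U -> open U -> smooth_fun chi ->
  (forall x, ~ K x -> chi x = 0) -> smooth_section_on U X ->
  smooth_section (fun x => chi x *: X x).
Proof.
move=> cK KU oU schi chi0 sX tau ttau i; rewrite setIT.
have ot := trivs_open ttau.
apply: (smooth_on_ext charts (f := fun x => chi x * tmap tau x (X x) 0 i)) => //.
  by move=> x _; rewrite linearZ mxE.
apply: (smooth_on_cutoff charts cK KU) => //.
by rewrite setIC; exact: sX.
Qed.

Lemma smooth_coframe (tau : triv E (rank E)) j : trivs tau ->
  smooth_cosection_on (tdom tau) (coframe tau j).
Proof.
move=> ttau tau' ttau' i.
have ot := trivs_open ttau; have ot' := trivs_open ttau'.
apply: (smooth_on_ext charts (f := fun x => tmap tau x (frame tau' i x) 0 j)).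
- exact: openI.
- by move=> x _; rewrite coframeE.
- by rewrite setIC; exact: smooth_transition.
Qed.

Lemma smooth_msec0 (f : M -> R) : smooth_fun f ->
  smooth_multisection 0 (@msec0 R M E f).
Proof.
move=> sf; split=> [x|tau ttau [|j J]] /=.
- split=> [[]|[|? ?]|[]] //= *; rewrite ?mulr0 ?addr0 //.
- by apply: smooth_on_subset sf.
- exact: smooth_on_cst.
Qed.

Lemma smooth_msec1 X : smooth_section X -> smooth_multisection 1 (msec1 X).
Proof.
move=> sX; split=> [x|tau ttau [|j [|k J]]] /=.
- split=> [[|? []]|[|? [|? ?]] [|? ?] a xi eta|[|? []]] //=; rewrite ?mulr0 ?addr0 //.
  by rewrite add_lfunE scale_lfunE.
- exact: smooth_on_cst.
- apply: (smooth_on_ext charts (f := fun x => tmap tau x (X x) 0 j)).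
  + exact: trivs_open.
  + by move=> x _; rewrite coframeE.
  + by have := sX tau ttau j; rewrite setIT.
- exact: smooth_on_cst.
Qed.

Lemma smooth_multisectionM k (f : M -> R) (D : multisection E) : smooth_fun f ->
  smooth_multisection k D -> smooth_multisection k (fun x s => f x * D x s).
Proof.
move=> sf [mD sD]; split=> [x|tau ttau J].
  have [D0 Dl Da] := mD x; split=> [s ks|s1 s2 a xi eta|s1 s2 xi].
  - by rewrite D0 ?mulr0.
  - by rewrite Dl; ring.
  - by rewrite Da mulr0.
apply: (smooth_on_mul charts); first exact: trivs_open.
  exact: smooth_on_subset sf.
exact: sD.
Qed.

Lemma smooth_multisectionD k (D D' : multisection E) :
  smooth_multisection k D -> smooth_multisection k D' ->
  smooth_multisection k (fun x s => D x s + D' x s).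
Proof.
move=> [mD sD] [mD' sD']; split=> [x|tau ttau J].
  have [D0 Dl Da] := mD x; have [D0' Dl' Da'] := mD' x.
  split=> [s ks|s1 s2 a xi eta|s1 s2 xi].
  - by rewrite D0 ?D0' ?addr0.
  - by rewrite Dl Dl'; ring.
  - by rewrite Da Da' addr0.
apply: (smooth_on_add charts); [exact: trivs_open|exact: sD|exact: sD'].
Qed.

Lemma smooth_multisection0 k : smooth_multisection k (fun (x : M) (s : seq (dual (E x))) => 0 : R).
Proof.
split=> [x|tau ttau J]; last exact: smooth_on_cst.
by split=> // *; rewrite mulr0 addr0.
Qed.

End Bundles.

(** * Bundles and sections over M x R *)

Section LineBundle.
Context (R : realType) (M : manifold_data R) (E : bundle_data M).
Hypothesis charts : forall c : chart R M (mdim M), atlas c -> is_chart c.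
Hypothesis cover : forall x : M, exists2 c : chart R M (mdim M), atlas c & cdom c x.
Hypothesis bundleE : is_bundle E.
Let L := line_prod M.
Let EL := line_bundle_prod E.

Lemma setX_setTI (U V : set M) :
  (U `*` [set: R]) `&` (V `*` setT) = (U `&` V) `*` setT.
Proof. by apply/seteqP; split=> [[x t] [[/= ? _] [/= ? _]]|[x t] [[/= ? ?] _]]. Qed.

Lemma line_bundle : is_bundle EL.
Proof.
have [op cov can sm] := bundleE; split.
- by move=> _ [tau ttau <-]; apply: open_cylinder; exact: op.
- move=> [x t]; have [tau ttau dx] := cov x.
  by eexists; [exists tau|].
- by move=> _ [tau ttau <-] [x t] [/= dx _]; exact: can.
- move=> _ [tau ttau <-] i _ [tau' ttau' <-] j /=.
  have /(smooth_on_fst) := sm tau ttau i tau' ttau' j.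
  by rewrite -setX_setTI.
Qed.

Lemma smooth_section_slice (X : section EL) t :
  smooth_section X -> smooth_section (slice X t).
Proof.
move=> sX tau ttau i; rewrite setIT.
have := sX _ (ex_intro2 _ _ tau ttau erefl) i; rewrite setIT.
exact: smooth_on_slice.
Qed.

Definition coslice (xi : cosection EL) (t : R) : cosection E := fun x => xi (x, t).

Lemma smooth_cosection_slice (xi : cosection EL) t :
  smooth_cosection xi -> smooth_cosection (coslice xi t).
Proof.
move=> sX tau ttau i; rewrite setIT.
have := sX _ (ex_intro2 _ _ tau ttau erefl) i; rewrite setIT.
exact: smooth_on_slice.
Qed.

Definition mslice (D : multisection EL) (t : R) : multisection E := fun x => D (x, t).

Lemma smooth_multisection_slice k (D : multisection EL) t :
  smooth_multisection k D -> smooth_multisection k (mslice D t).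
Proof.
move=> [mD sD]; split=> [x|tau ttau J]; first exact: (mD (x, t)).
exact: smooth_on_slice (sD _ (ex_intro2 _ _ tau ttau erefl) J).
Qed.

Lemma smooth_section_fst (X : section E) :
  smooth_section X -> @smooth_section R L EL (fun p => X p.1).
Proof.
move=> sX _ [tau ttau <-] i; have := sX tau ttau i; rewrite !setIT /=.
exact: smooth_on_fst.
Qed.

Lemma smooth_cosection_fst (xi : cosection E) :
  smooth_cosection xi -> @smooth_cosection R L EL (fun p => xi p.1).
Proof.
move=> sX _ [tau ttau <-] i; have := sX tau ttau i; rewrite !setIT /=.
exact: smooth_on_fst.
Qed.

Lemma smooth_multisection_fst k (D : multisection E) :
  smooth_multisection k D -> @smooth_multisection R L EL k (fun p => D p.1).
Proof.
move=> [mD sD]; split=> [p|_ [tau ttau <-] J]; first exact: (mD p.1).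
exact: smooth_on_fst (sD tau ttau J).
Qed.

(** The trivialisations of the product bundle do not depend on t: the components of [X] are
    derivable along the line over [x], and a covector is a fixed linear combination of them. *)
Lemma smooth_section_vderivable (X : section EL) (x : M) (t : R) :
  smooth_section X -> vderivable (fun s => X (x, s) : E x) t.
Proof.
move=> sX l; have [tau ttau dx] := trivs_cover bundleE x.
rewrite (_ : (fun s => _) =
    (fun s => \sum_i tmap tau x (X (x, s)) 0 i * l (frame tau i x))); last first.
  apply/funext => s; rewrite (dual_frame_sum bundleE l _ ttau dx).
  by apply: eq_bigr => i _; exact: mulrC.
have h i : derivable (fun s : R => tmap tau x (X (x, s)) 0 i : R) t 1.
  have := sX _ (ex_intro2 _ _ tau ttau erefl) i; rewrite setIT => sXi.
  exact: (smooth_on_derivable_line charts (cover x) sXi).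
by have [] := is_derive_bigsum (fun i =>
  is_derive_mulr (l (frame tau i x)) (derivableP (h i))).
Qed.

Lemma smooth_cosection_vderivable (xi : cosection EL) (x : M) (t : R) :
  smooth_cosection xi -> vderivable (fun s => xi (x, s) : dual (E x)) t.
Proof.
move=> sX; apply: vderivable_dualP => v; have [tau ttau dx] := trivs_cover bundleE x.
rewrite (_ : (fun s => _) =
    (fun s => \sum_i xi (x, s) (frame tau i x) * tmap tau x v 0 i)); last first.
  by apply/funext => s; rewrite (dual_frame_sum bundleE _ _ ttau dx).
have h i : derivable (fun s : R => xi (x, s) (frame tau i x) : R) t 1.
  have := sX _ (ex_intro2 _ _ tau ttau erefl) i; rewrite setIT => sXi.
  exact: (smooth_on_derivable_line charts (cover x) sXi).
by have [] := is_derive_bigsum (fun i =>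
  is_derive_mulr (tmap tau x v 0 i) (derivableP (h i))).
Qed.

End LineBundle.

(** * The exterior product *)

Section Wedge.
Context (R : realType) (T : Type).
Implicit Types (D E F : seq T -> R) (s : seq T).

(** The degree involution of the exterior algebra, which is the sign in the recursion of [wedge]. It
    is multiplicative ([sgn_wedge]) and anticommutes with contraction ([sgn_cons]). *)
Definition sgn D s : R := (-1) ^+ size s * D s.

Definition hom (k : nat) D := forall s, size s != k -> D s = 0.

Lemma wedge_cons D E xi s : wedge D E (xi :: s) =
  wedge (fun u => D (xi :: u)) E s + wedge (sgn D) (fun u => E (xi :: u)) s.
Proof. by []. Qed.

Lemma wedge_linl a D D' E s :
  wedge (fun u => a * D u + D' u) E s = a * wedge D E s + wedge D' E s.
Proof.
elim: s D D' E => [|xi s IH] D D' E /=; first by ring.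
rewrite IH mulrDr addrACA; congr (_ + _); rewrite -IH.
by congr wedge; apply/funext => u; ring.
Qed.

Lemma wedge_linr a D E E' s :
  wedge D (fun u => a * E u + E' u) s = a * wedge D E s + wedge D E' s.
Proof.
elim: s D E E' => [|xi s IH] D E E' /=; first by ring.
by rewrite !IH; ring.
Qed.

Lemma wedge0l E s : wedge (fun=> 0) E s = 0.
Proof.
have E0 : wedge (fun=> 0) E s = -1 * wedge (fun=> 0) E s + wedge (fun=> 0) E s.
  by rewrite -wedge_linl; congr wedge; apply/funext => u; ring.
by rewrite E0 mulN1r addNr.
Qed.

Lemma wedge0r D s : wedge D (fun=> 0) s = 0.
Proof.
have E0 : wedge D (fun=> 0) s = -1 * wedge D (fun=> 0) s + wedge D (fun=> 0) s.
  by rewrite -wedge_linr; congr wedge; apply/funext => u; ring.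
by rewrite E0 mulN1r addNr.
Qed.

Lemma wedgeZl a D E s : wedge (fun u => a * D u) E s = a * wedge D E s.
Proof.
rewrite -[RHS]addr0 -(wedge0l E s) -wedge_linl.
by congr wedge; apply/funext => u; rewrite addr0.
Qed.

Lemma wedgeZr a D E s : wedge D (fun u => a * E u) s = a * wedge D E s.
Proof.
rewrite -[RHS]addr0 -(wedge0r D s) -wedge_linr.
by congr wedge; apply/funext => u; rewrite addr0.
Qed.

Lemma wedgeDl D D' E s : wedge (fun u => D u + D' u) E s = wedge D E s + wedge D' E s.
Proof.
rewrite -[wedge D E s]mul1r -wedge_linl.
by congr wedge; apply/funext => u; rewrite mul1r.
Qed.

Lemma wedgeDr D E E' s : wedge D (fun u => E u + E' u) s = wedge D E s + wedge D E' s.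
Proof.
rewrite -[wedge D E s]mul1r -wedge_linr.
by congr wedge; apply/funext => u; rewrite mul1r.
Qed.

Lemma wedgeNl D E s : wedge (fun u => - D u) E s = - wedge D E s.
Proof.
by rewrite -mulN1r -wedgeZl; congr wedge; apply/funext => u; rewrite mulN1r.
Qed.

Lemma wedgeNr D E s : wedge D (fun u => - E u) s = - wedge D E s.
Proof.
by rewrite -mulN1r -wedgeZr; congr wedge; apply/funext => u; rewrite mulN1r.
Qed.

Lemma sgn_cons D xi : (fun u => sgn D (xi :: u)) = (fun u => - sgn (fun v => D (xi :: v)) u).
Proof. by apply/funext => u; rewrite /sgn /= exprS; ring. Qed.

Lemma sgnK D : sgn (sgn D) = D.
Proof.
by apply/funext => u; rewrite /sgn mulrA -exprD addnn -mul2n exprM sqrrN expr1n expr1n mul1r.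
Qed.

Lemma sgn0 : sgn (fun=> 0 : R) = (fun=> 0) :> (seq T -> R).
Proof. by apply/funext => u; rewrite /sgn mulr0. Qed.

Lemma sgn_wedge D E s : sgn (wedge D E) s = wedge (sgn D) (sgn E) s.
Proof.
elim: s D E => [|xi s IH] D E; first by rewrite /sgn /= !expr0 !mul1r.
rewrite [RHS]wedge_cons !sgn_cons wedgeNl wedgeNr -!IH /sgn /= exprS.
by rewrite -/(sgn _); ring.
Qed.

(** Contraction is an antiderivation for either bracketing, so both sides obey the same recursion;
    the multiplicativity of [sgn] matches the signs. *)
Lemma wedgeA D E F s : wedge (wedge D E) F s = wedge D (wedge E F) s.
Proof.
elim: s D E F => [|xi s IH] D E F; first by rewrite /= mulrA.
rewrite !wedge_cons.
rewrite (_ : sgn (wedge D E) = wedge (sgn D) (sgn E)); last first.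
  by apply/funext => u; rewrite sgn_wedge.
by rewrite wedgeDl !IH wedgeDr addrA.
Qed.

Lemma hom_cons k D xi : hom k.+1 D -> hom k (fun u => D (xi :: u)).
Proof. by move=> hD s ks; rewrite hD. Qed.

Lemma hom0_cons D xi : hom 0 D -> (fun u => D (xi :: u)) = (fun=> 0).
Proof. by move=> hD; apply/funext => u; rewrite hD. Qed.

Lemma hom_sgnE k D : hom k D -> sgn D = (fun u => (-1) ^+ k * D u).
Proof.
move=> hD; apply/funext => u; rewrite /sgn; have [->//|ku] := eqVneq (size u) k.
by rewrite hD ?mulr0.
Qed.

Lemma hom_sgn k D : hom k D -> hom k (sgn D).
Proof. by move=> hD s ks; rewrite /sgn hD ?mulr0. Qed.

Lemma hom_wedge a b D E : hom a D -> hom b E -> hom (a + b)%N (wedge D E).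
Proof.
move=> hD hE s; elim: s a b D E hD hE => [|xi s IH] a b D E hD hE.
  case: a hD => [|a] hD; last by move=> _ /=; rewrite (hD [::]) ?mul0r.
  by case: b hE => [|b] hE // _ /=; rewrite (hE [::]) ?mulr0.
rewrite wedge_cons => abs.
rewrite (_ : wedge _ E s = 0) ?add0r.
  case: b hE abs => [|b] hE abs; first by rewrite (hom0_cons _ hE) wedge0r.
  have {}abs : size s != (a + b)%N by move: abs; rewrite addnS.
  exact: (IH a b _ _ (hom_sgn hD) (hom_cons xi hE) abs).
case: a hD abs => [|a] hD abs; first by rewrite (hom0_cons _ hD) wedge0l.
exact: (IH a b _ _ (hom_cons xi hD) hE abs).
Qed.

(** Exchanging the factors exchanges the two terms of the recursion; lowering one degree by one
    changes (-1)^(ab) by exactly the sign that [sgn] of the other factor contributes. *)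
Lemma wedgeC a b D E s : hom a D -> hom b E ->
  wedge D E s = (-1) ^+ (a * b)%N * wedge E D s.
Proof.
elim: s a b D E => [|xi s IH] a b D E hD hE.
  case: a hD => [|a] hD /=; first by rewrite mul0n mul1r mulrC.
  by rewrite hD // mul0r mulr0 mulr0.
rewrite !wedge_cons (hom_sgnE hD) (hom_sgnE hE) !wedgeZl mulrDr addrC.
congr (_ + _).
  case: b hE => [|b] hE; first by rewrite (hom0_cons _ hE) wedge0l wedge0r !mulr0.
  rewrite (IH a b) //; last exact: hom_cons.
  by rewrite mulrA -exprD mulnS.
case: a hD => [|a] hD; first by rewrite (hom0_cons _ hD) wedge0l wedge0r !mulr0.
rewrite (IH a b) //; last exact: hom_cons.
rewrite mulrA -exprD mulSn; congr (_ * _).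
by rewrite addnAC exprD addnn -muln2 (exprM _ b) sqrr_sign mul1r.
Qed.

Definition scalar0 (a : R) s : R := if s is [::] then a else 0.

Lemma wedge_scalar0 a D s : wedge (scalar0 a) D s = a * D s.
Proof.
elim: s D => [|xi s IH] D //=.
rewrite wedge0l add0r -(IH (fun u => D (xi :: u))); congr wedge; apply/funext => -[|? ?] /=.
  by rewrite expr0 mul1r.
by rewrite mulr0.
Qed.

Lemma is_derive_wedge (D E : R -> seq T -> R) (D' E' : seq T -> R) (t : R) s :
  (forall u, is_derive t 1 (fun r => D r u) (D' u)) ->
  (forall u, is_derive t 1 (fun r => E r u) (E' u)) ->
  is_derive t 1 (fun r => wedge (D r) (E r) s) (wedge D' (E t) s + wedge (D t) E' s).
Proof.
elim: s D E D' E' => [|xi s IH] D E D' E' dD dE /=.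
  have := is_deriveM (dD [::]) (dE [::]).
  by rewrite /GRing.scale /= addrC [X in X + _]mulrC.
have dsD u : is_derive t 1 (fun r => (-1) ^+ size u * D r u) ((-1) ^+ size u * D' u).
  have := is_derive_mulr ((-1) ^+ size u) (dD u); rewrite mulrC.
  by rewrite (_ : (fun r => D r u * _) = (fun r => (-1) ^+ size u * D r u)) //;
    apply/funext => r; rewrite mulrC.
have h1 := IH _ _ _ _ (fun u => dD (xi :: u)) dE.
have h2 := IH _ _ _ _ dsD (fun u => dE (xi :: u)).
by have := is_deriveD h1 h2; rewrite addrACA.
Qed.

End Wedge.

(** * Exterior products of multivectors *)

Section Multivectors.
Context (R : realType) (V : vectType R).
Implicit Types (D E : seq (dual V) -> R).

Definition multilinear D := forall (s1 s2 : seq (dual V)) (a : R) (xi eta : dual V),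
  D (s1 ++ (a *: xi + eta) :: s2) = a * D (s1 ++ xi :: s2) + D (s1 ++ eta :: s2).

Definition alternating D := forall (s1 s2 : seq (dual V)) (xi : dual V),
  D (s1 ++ [:: xi, xi & s2]) = 0.

Lemma multilinear_wedge D E : multilinear D -> multilinear E -> multilinear (wedge D E).
Proof.
move=> lD lE s1; elim: s1 D E lD lE => [|x s1 IH] D E lD lE s2 a xi eta.
  rewrite /= (_ : (fun u => D (_ :: u)) = (fun u => a * D (xi :: u) + D (eta :: u)));
    last by apply/funext => u; exact: (lD [::]).
  rewrite (_ : (fun u => E (_ :: u)) = (fun u => a * E (xi :: u) + E (eta :: u)));
    last by apply/funext => u; exact: (lE [::]).
  by rewrite wedge_linl wedge_linr; ring.
rewrite !cat_cons !wedge_cons.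
rewrite IH // => [|s1' *]; last exact: (lD (x :: s1')).
rewrite IH => [||s1' *]; last exact: (lE (x :: s1')).
  by ring.
by move=> s1' s2' b y z; rewrite /sgn lD !size_cat /=; ring.
Qed.

(** After two contractions with the same covector the mixed terms cancel, because contraction and
    [sgn] anticommute; the other two terms contract a single factor twice. *)
Lemma alternating_wedge D E : alternating D -> alternating E -> alternating (wedge D E).
Proof.
move=> aD aE s1; elim: s1 D E aD aE => [|x s1 IH] D E aD aE s2 xi.
  rewrite cat0s wedge_cons (wedge_cons (sgn D)) (wedge_cons (fun u => D (xi :: u))).
  rewrite sgnK sgn_cons wedgeNl.
  rewrite (_ : (fun u => D [:: xi, xi & u]) = (fun=> 0));
    last by apply/funext => u; exact: (aD [::]).
  rewrite (_ : (fun u => E [:: xi, xi & u]) = (fun=> 0));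
    last by apply/funext => u; exact: (aE [::]).
  by rewrite wedge0l wedge0r; ring.
rewrite cat_cons wedge_cons.
rewrite IH // => [|s1' *]; last exact: (aD (x :: s1')).
rewrite IH ?addr0 // => [|s1' *]; last exact: (aE (x :: s1')).
by move=> s1' s2' y; rewrite /sgn aD mulr0.
Qed.

Lemma multivector_wedge a b D E : multivector a D -> multivector b E ->
  multivector (a + b)%N (wedge D E).
Proof.
move=> [hD lD aD] [hE lE aE]; split.
- exact: hom_wedge.
- exact: multilinear_wedge.
- exact: alternating_wedge.
Qed.

Lemma multilinear_sum D (n : nat) (a : 'I_n -> R) (x : 'I_n -> dual V) s1 s2 :
  multilinear D ->
  D (s1 ++ (\sum_i a i *: x i) :: s2) = \sum_i a i * D (s1 ++ x i :: s2).
Proof.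
move=> lD; have D0 : D (s1 ++ 0 :: s2) = 0.
  by have := lD s1 s2 (-1) 0 0; rewrite scaler0 addr0 mulN1r addNr.
elim/big_rec2: _ => // i y1 y2 _ <-; exact: lD.
Qed.

Lemma multivector2_skew D xi eta : multivector 2 D -> D [:: xi; eta] = - D [:: eta; xi].
Proof.
move=> [_ lD aD]; have := aD [::] [::] (xi + eta); rewrite /= => h.
have e1 : D [:: xi + eta; xi + eta] = D [:: xi; xi + eta] + D [:: eta; xi + eta].
  by have := lD [::] [:: xi + eta] 1 xi eta; rewrite scale1r mul1r.
have e2 z : D [:: z; xi + eta] = D [:: z; xi] + D [:: z; eta].
  by have := lD [:: z] [::] 1 xi eta; rewrite scale1r mul1r.
have z0 z : D [:: z; z] = 0 := aD [::] [::] z.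
move: h; by rewrite e1 !e2 !z0 add0r addr0 => /eqP; rewrite addr_eq0 => /eqP.
Qed.

Lemma multivector_contract k D xi : multivector k.+1 D ->
  multivector k (fun s => D (xi :: s)).
Proof.
move=> [hD lD aD]; split=> [s ks|s1 s2 a x y|s1 s2 x].
- by rewrite hD.
- exact: (lD (xi :: s1)).
- exact: (aD (xi :: s1)).
Qed.

Lemma multivector_lin k a D E : multivector k D -> multivector k E ->
  multivector k (fun s => a * D s + E s).
Proof.
move=> [hD lD aD] [hE lE aE]; split=> [s ks|s1 s2 b x y|s1 s2 x].
- by rewrite hD // hE //; ring.
- by rewrite lD lE; ring.
- by rewrite aD aE; ring.
Qed.

Lemma multivector_sgn k D : multivector k D -> multivector k (sgn D).
Proof.
move=> [hD lD aD]; rewrite (hom_sgnE hD); split=> [s ks|s1 s2 b x y|s1 s2 x].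
- by rewrite hD ?mulr0.
- by rewrite lD; ring.
- by rewrite aD mulr0.
Qed.

Lemma multivector_zero k : multivector k (fun _ : seq (dual V) => 0 : R).
Proof. by split=> // *; rewrite mulr0 addr0. Qed.

End Multivectors.

(** * Graphs of bivectors *)

Section Sharp.
Context (R : realType) (V : vectType R).
Implicit Types (D : seq (dual V) -> R) (xi eta : dual V).

Lemma dual_vcoord_sum xi :
  xi = \sum_(i < \dim (fullv : {vspace V})) xi (vbasis (fullv : {vspace V}))`_i *: vcoord i.
Proof.
apply/lfunP => v; rewrite sum_lfunE dual_sum; apply: eq_bigr => i _.
by rewrite scale_lfunE; exact: mulrC.
Qed.

Definition sharp D xi : V :=
  \sum_(i < \dim (fullv : {vspace V})) D [:: xi; vcoord i] *: (vbasis (fullv : {vspace V}))`_i.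

Lemma sharpE D xi eta : multivector 2 D -> eta (sharp D xi) = D [:: xi; eta].
Proof.
move=> [_ lD _]; rewrite /sharp linear_sum {2}(dual_vcoord_sum eta).
rewrite (multilinear_sum (D := D) _ _ [:: xi] [::] lD).
by apply: eq_bigr => i _; rewrite linearZ; exact: mulrC.
Qed.

Lemma multivector2_linl D a xi xi' eta : multivector 2 D ->
  D [:: a *: xi + xi'; eta] = a * D [:: xi; eta] + D [:: xi'; eta].
Proof. by move=> [_ lD _]; exact: (lD [::]). Qed.

Lemma multivector2_Zl D a xi eta : multivector 2 D ->
  D [:: a *: xi; eta] = a * D [:: xi; eta].
Proof.
move=> mD; have := multivector2_linl a xi 0 eta mD; rewrite addr0 => ->.
have := multivector2_linl (-1) 0 0 eta mD.
by rewrite scaler0 addr0 mulN1r addNr => ->; rewrite addr0.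
Qed.

Lemma multivector2_Dl D xi xi' eta : multivector 2 D ->
  D [:: xi + xi'; eta] = D [:: xi; eta] + D [:: xi'; eta].
Proof. by move=> mD; have := multivector2_linl 1 xi xi' eta mD; rewrite scale1r mul1r. Qed.

Lemma multivector2_Nl D xi eta : multivector 2 D ->
  D [:: - xi; eta] = - D [:: xi; eta].
Proof. by move=> mD; rewrite -scaleN1r multivector2_Zl // mulN1r. Qed.

End Sharp.

Section GraphSharp.
Context (R : realType) (A : algebroid_data R) (pi : multisection A).
Hypothesis charts : forall c : chart R (base A) (mdim (base A)), atlas c -> is_chart c.
Hypothesis bundleA : is_bundle A.
Arguments pi : clear implicits.
Hypothesis spi : smooth_multisection 2 pi.

Lemma graph_sharpP x (v : A x) (xi : dual (A x)) :
  graph_sharp pi (v, xi) <-> v = sharp (pi x) xi.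
Proof.
have [mpi _] := spi; split=> [h|-> eta]; last by rewrite sharpE.
by apply: dual_separates => l; rewrite sharpE // -h.
Qed.

Lemma graph_sharp_lin x a (p q : A x * dual (A x)) :
  graph_sharp pi p -> graph_sharp pi q -> graph_sharp pi (a *: p + q).
Proof.
have [mpi _] := spi; move=> hp hq eta /=.
by rewrite dualP hp hq multivector2_linl.
Qed.

Lemma graph_sharp_skew x (v w : A x) (xi eta : dual (A x)) :
  graph_sharp pi (v, xi) -> graph_sharp pi (w, eta) -> xi w = - eta v.
Proof.
have [mpi _] := spi; move=> hp hq.
by rewrite hp hq (multivector2_skew _ _ (mpi x)).
Qed.

(** If an isotropic [W] contains the graph, pairing an element (v, xi) of [W] with all the elements
    (pi^sharp eta, eta) forces eta(v) = pi(xi, eta), that is v = pi^sharp xi. *)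
Lemma graph_sharp_maximally_isotropic x : maximally_isotropic (graph_sharp pi (x := x)).
Proof.
have [mpi _] := spi; split=> [[v xi] [w eta] hp hq|W iW gW [v xi] Wp eta].
  by rewrite /pairing_plus /= (graph_sharp_skew hp hq) addNr mulr0.
have Weta : (sharp (pi x) eta, eta) \in W by apply: gW; exact/graph_sharpP.
have := iW _ _ Wp Weta; rewrite /pairing_plus /= sharpE //.
move=> /eqP; rewrite mulf_eq0 invr_eq0 pnatr_eq0 /= addrC addr_eq0 => /eqP ->.
by rewrite (multivector2_skew _ _ (mpi x)) opprK.
Qed.

(** The elements (pi^sharp e^i, e^i), for a local coframe e^i, form a frame: the second components
    alone give freeness, and they determine the coefficients of any element of the graph. *)
Lemma graph_sharp_subbundle : is_subbundle (graph_sharp pi).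
Proof.
have [mpi sm] := spi; move=> x0; have [tau ttau dx0] := trivs_cover bundleA x0.
have ot := trivs_open bundleA ttau.
exists (tdom tau), (rank A), (fun i x => sharp (pi x) (coframe tau i x)),
  (coframe tau); split => //.
  move=> i; split; last exact: smooth_coframe.
  apply: smooth_section_on_local => // x dx; exists tau => // j.
  rewrite setIid; apply: (smooth_on_ext charts _ _ (sm tau ttau [:: i; j])) => //.
  by move=> y dy; rewrite -coframeE sharpE.
move=> x dx; set b := [tuple _ | i < _].
have bE (i : 'I_(rank A)) : b`_i = (sharp (pi x) (coframe tau i x), coframe tau i x).
  by rewrite -tnth_nth tnth_mktuple.
have gb (i : 'I_(rank A)) : graph_sharp pi b`_i by rewrite bE; exact/graph_sharpP.
have sum2 (k : 'I_(rank A) -> R) :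
    (\sum_i k i *: b`_i).2 = \sum_i k i *: coframe tau i x.
  by rewrite (big_morph snd (id1 := 0) (op1 := +%R)) //; apply: eq_bigr => i _; rewrite bE.
have gsum (k : 'I_(rank A) -> R) : graph_sharp pi (\sum_i k i *: b`_i).
  elim/big_ind: _ => [|p q hp hq|i _].
  - move=> eta; rewrite linear0; have [_ lpi _] := mpi x.
    by have := @multilinear_sum _ _ (pi x) 0 (fun=> 0) (fun=> 0) [::] [:: eta] lpi;
      rewrite !big_ord0 => ->.
  - by rewrite -[p]scale1r; exact: graph_sharp_lin.
  (* The difference of an element with itself provides the zero of the graph, so that
     [graph_sharp_lin] yields stability under scaling. *)
  - have h0 : graph_sharp pi (b`_i - b`_i).
      by have := graph_sharp_lin (-1) (gb i) (gb i); rewrite scaleN1r addrC.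
    by have := graph_sharp_lin (k i) (gb i) h0; rewrite subrr addr0.
split.
  apply/freeP => k k0 j; have := congr1 (fun p : (A x * dual (A x))%type => p.2 (frame tau j x)) k0.
  rewrite /= sum2 sum_lfunE (bigD1 j) //= scale_lfunE coframeE (tmap_frame _ _ _ ttau) //.
  rewrite eqxx big1 => [|i ij]; last first.
    by rewrite scale_lfunE coframeE (tmap_frame bundleA) // eq_sym (negbTE ij); exact: mulr0.
  by rewrite addr0 zero_lfunE => <-; exact/esym/mulr1.
move=> [v xi]; split=> [/graph_sharpP ->|/coord_span ->]; last exact: gsum.
pose k i := xi (frame tau i x).
have -> : (sharp (pi x) xi, xi) = \sum_i k i *: b`_i.
  have E2 : (\sum_i k i *: b`_i).2 = xi.
    by rewrite sum2 [RHS](coframe_sum bundleA _ ttau dx).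
  have /graph_sharpP := gsum k.
  by case: (\sum_i k i *: b`_i) E2 => ? ? /= -> ->.
by apply: memv_suml => i _; apply/memvZ/memv_span; rewrite mem_nth // size_tuple.
Qed.

End GraphSharp.

(** * Dirac structures *)

Section LieAlgebroid.
Context (R : realType) (A : algebroid_data R).
Hypothesis lieA : is_lie_algebroid A.

Lemma lie_charts (c : chart R (base A) (mdim (base A))) : atlas c -> is_chart c.
Proof. by case: lieA => [[[_ _ h _ _] _] _ _ _]; exact: h. Qed.

Lemma lie_cover (x : base A) :
  exists2 c : chart R (base A) (mdim (base A)), atlas c & cdom c x.
Proof. by case: lieA => [[[_ _ _ h _] _] _ _ _]. Qed.

Lemma lie_bundle : is_bundle A.
Proof. by case: lieA => [[]]. Qed.

Lemma smooth_fun_cst (a : R) : smooth_fun (fun _ : base A => a).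
Proof. exact: smooth_on_cst. Qed.

Lemma smooth_sectionZ (a : R) (X : section A) :
  smooth_section X -> smooth_section (fun x => a *: X x).
Proof.
exact: (smooth_sectionM lie_charts lie_bundle (smooth_fun_cst a)).
Qed.

Lemma bracketZl a (X Y : section A) : smooth_section X -> smooth_section Y ->
  bracket (fun x => a *: X x) Y = (fun x => a *: bracket X Y x).
Proof.
move=> sX sY; have [_ _ [_ lin _ _] _] := lieA.
have s0 : smooth_section (fun x => 0 : A x) := smooth_section0 lie_charts lie_bundle.
have b0 : bracket (fun x => 0 : A x) Y = (fun x => 0).
  have := lin (-1) X X Y sX sX sY.
  rewrite (_ : (fun x => -1 *: X x + X x) = (fun x => 0)); last first.
    by apply: functional_extensionality_dep => x; rewrite scaleN1r addNr.
  by move=> ->; apply: functional_extensionality_dep => x; rewrite scaleN1r addNr.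
have := lin a X (fun x => 0) Y sX s0 sY; rewrite b0.
rewrite (_ : (fun x => a *: X x + 0) = (fun x => a *: X x)); last first.
  by apply: functional_extensionality_dep => x; rewrite addr0.
by move=> ->; apply: functional_extensionality_dep => x; rewrite addr0.
Qed.

Lemma bracketZr a (X Y : section A) : smooth_section X -> smooth_section Y ->
  bracket X (fun x => a *: Y x) = (fun x => a *: bracket X Y x).
Proof.
move=> sX sY; have [_ _ [_ _ skew _] _] := lieA.
rewrite skew //; last exact: smooth_sectionZ.
rewrite bracketZl // (skew X Y) //.
by apply: functional_extensionality_dep => x; rewrite scalerN.
Qed.

Lemma anchorZ a (x : base A) (v : A x) f : smooth_fun f ->
  anchor (a *: v) f = a * anchor v f.
Proof.
move=> sf; have [_ [_ lin _] _ _] := lieA.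
have a0 : anchor (0 : A x) f = 0.
  by have := lin x (-1) 0 0 f sf; rewrite scaler0 addr0 mulN1r addNr.
by have := lin x a v 0 f sf; rewrite a0 !addr0.
Qed.

Lemma anchor_funZ a (x : base A) (v : A x) f : smooth_fun f ->
  anchor v (fun y => a * f y) = a * anchor v f.
Proof.
move=> sf; have [_ [tan _ _] _ _] := lieA.
have s0 : smooth_fun (fun _ : base A => 0 : R) by exact: smooth_fun_cst.
have a0 : anchor v (fun=> 0) = 0.
  have h := (tan x v _ _ s0 s0).1 (-1).
  rewrite (_ : (fun _ => -1 * 0 + 0) = (fun=> 0)) in h; last first.
    by apply/funext => y; rewrite mulr0 addr0.
  by rewrite h mulN1r addNr.
have := (tan x v _ _ sf s0).1 a; rewrite a0 addr0 => <-.
by congr anchor; apply/funext => y; rewrite addr0.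
Qed.

Lemma anchor_funN (x : base A) (v : A x) f : smooth_fun f ->
  anchor v (fun y => - f y) = - anchor v f.
Proof.
move=> sf; rewrite -mulN1r -anchor_funZ //.
by congr anchor; apply/funext => y; rewrite mulN1r.
Qed.

Lemma dA1Zl a (eta : cosection A) (X Z : section A) x :
  smooth_cosection eta -> smooth_section X -> smooth_section Z ->
  dA1 eta (fun y => a *: X y) Z x = a * dA1 eta X Z x.
Proof.
move=> seta sX sZ; rewrite /dA1 /act.
have sp := smooth_pairing lie_charts lie_bundle seta.
rewrite anchorZ; last exact: sp.
rewrite (_ : (fun y => eta y (a *: X y)) = (fun y => a * eta y (X y))); last first.
  by apply/funext => y; rewrite linearZ.
rewrite anchor_funZ; last exact: sp.
by rewrite bracketZl // dualZ; ring.
Qed.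

End LieAlgebroid.

Section CourantForm.
Context (R : realType) (A : algebroid_data R) (phi0 : cosection A).

(* On sections of an isotropic subbundle the antisymmetric pairing is
   - eta(X), so the exact terms of the bracket combine into d(eta(X)). *)
Lemma courant_form_isotropic (X : section A) (xi : cosection A) (Y : section A)
    (eta : cosection A) (Z : section A) x :
  (forall y, xi y (Y y) = - eta y (X y)) ->
  act Z (fun y => - eta y (X y)) x = - act Z (fun y => eta y (X y)) x ->
  courant_form phi0 X xi Y eta Z x =
  dAphi1 phi0 eta X Z x - dAphi1 phi0 xi Y Z x + dAphi0 phi0 (fun y => eta y (X y)) Z x.
Proof.
move=> skew actN; rewrite /courant_form /lie_der.
have -> : (fun y => xi y (Y y)) = (fun y => - eta y (X y)) by apply/funext.
have -> : (fun y => pairing_minus (X y, xi y) (Y y, eta y)) = (fun y => - eta y (X y)).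
  by apply/funext => y; rewrite /pairing_minus /= skew; field.
by rewrite /dAphi0 /dA0 actN; ring.
Qed.

End CourantForm.

Lemma is_derive_expRN (R : realType) (t : R) :
  is_derive t 1 (fun s : R => expR (- s)) (- expR (- t)).
Proof.
have dN : is_derive t (1 : R) (fun s : R => - s) (-1) := is_deriveN (is_derive_id t 1).
have [d e] := dN; have [h1 h2] := is_derive1_comp d (is_derive_expR (- t)).
by split; [exact: h1|move: h2; rewrite !derive1E e mulrN1].
Qed.

(** The equality of one-forms in [dirac_tilde], evaluated on Z at (x, t). Here [E], [F] are e^t,
    e^{-t}; [px], [py], [q] are phi0 on X, Y, Z; [d1], [d2] are the slicewise d_A eta (X, Z), d_A xi
    (Y, Z); [ez], [xz], [dez], [dxz] are eta, xi and their t-derivatives on Z; [c] is eta(X), [dex]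
    is (d eta/dt)(X), [m] is rho_A(Z) applied to eta(X), and [w] is pi(d xi/dt, eta). *)
Lemma tilde_courant_identity (R : comNzRingType)
    (E F d1 d2 px py q ez xz c dez dxz dex m w : R) : F * E = 1 ->
  F * (E * d1 + (E * px * ez - q * (E * c))
    - (E * d2 + (E * py * xz - q * (E * - c))) + (E * m + q * (E * c)))
    + (px * (dez - ez) - py * (dxz - xz)) =
  d1 + px * dez - q * dex - (d2 + py * dxz - q * (F * - w))
    + (m + q * (dex + (- c + F * w))).
Proof.
move=> FE; transitivity (F * E * (d1 + (px * ez - q * c)
  - (d2 + (py * xz + q * c)) + (m + q * c)) + (px * (dez - ez) - py * (dxz - xz))).
  by ring.
by rewrite FE; ring.
Qed.

(** * From Dirac structures over M to M x R *)

Section TildeDirac.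
Context (R : realType) (A : algebroid_data R) (phi0 : cosection A).
Hypothesis lieA : is_lie_algebroid A.
Let charts := lie_charts lieA.
Let cover := lie_cover lieA.
Let bundleA := lie_bundle lieA.
Let tA := tilde phi0.

Implicit Types (X Y Z : section tA) (xi eta : cosection tA).

Definition dtv (X : section tA) (x : base A) (t : R) : A x :=
  dvec (fun s => X (x, s) : A x) t.

Definition dtc (xi : cosection tA) (x : base A) (t : R) : dual (A x) :=
  dvec (fun s => xi (x, s) : dual (A x)) t.

Lemma derive1_pairing xi X x t : smooth_cosection xi -> smooth_section X ->
  derive1 (fun s : R => xi (x, s) (X (x, s)) : R) t =
  dtc xi x t (X (x, t)) + xi (x, t) (dtv X x t).
Proof.
move=> sxi sX; rewrite derive1E.
have [_ ->] := is_derive_pairing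
  (smooth_cosection_vderivable charts cover bundleA (t := t) (x := x) sxi)
  (smooth_section_vderivable charts cover bundleA (t := t) (x := x) sX).
by [].
Qed.

Lemma tilde_bracketE X Y x t :
  bracket X Y (x, t) = bracket (slice X t) (slice Y t) x
    + (phi0 x (X (x, t)) : R) *: dtv Y x t - (phi0 x (Y (x, t)) : R) *: dtv X x t.
Proof. by []. Qed.

(** By the product rule the anchors produce t-derivatives of the sections and of the form; the
    former cancel against those in the bracket, and only the derivative of the form survives. *)
Lemma tilde_dA1 eta X Z x t :
  smooth_cosection eta -> smooth_section X -> smooth_section Z ->
  dA1 eta X Z (x, t) = dA1 (coslice eta t) (slice X t) (slice Z t) x
    + phi0 x (X (x, t)) * dtc eta x t (Z (x, t))
    - phi0 x (Z (x, t)) * dtc eta x t (X (x, t)).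
Proof.
move=> seta sX sZ; rewrite /dA1 /act tilde_bracketE /= /tilde_anchor /=.
rewrite !derive1_pairing // !dualD dualN !dualZ.
by rewrite /slice /coslice; ring.
Qed.

(** Supplies the second hypothesis of [courant_form_isotropic] over M x R, where the pairing has to
    be derivable in t as well. *)
Lemma tilde_act_pairingN eta X Z x t :
  smooth_cosection eta -> smooth_section X ->
  act Z (fun p => - eta p (X p)) (x, t) = - act Z (fun p => eta p (X p)) (x, t).
Proof.
move=> seta sX; rewrite /act /= /tilde_anchor /=.
rewrite (anchor_funN lieA); last first.
  exact: (smooth_pairing charts bundleA (smooth_cosection_slice t seta)
    (smooth_section_slice t sX)).
rewrite opprD -mulrN; congr (_ + _ * _).
have h := is_derive_pairing
  (smooth_cosection_vderivable charts cover bundleA (t := t) (x := x) seta)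
  (smooth_section_vderivable charts cover bundleA (t := t) (x := x) sX).
by rewrite !derive1E; have [_ ->] := is_deriveN h; have [_ ->] := h.
Qed.

Lemma dAphi1_0 (eta : cosection tA) X Z p :
  dAphi1 (fun q => 0 : dual (tA q)) eta X Z p = dA1 eta X Z p.
Proof. by rewrite /dAphi1 !zero_lfunE !mul0r subrr addr0. Qed.

Lemma dAphi0_0 (f : base tA -> R) Z p :
  dAphi0 (fun q => 0 : dual (tA q)) f Z p = act Z f p.
Proof. by rewrite /dAphi0 zero_lfunE mul0r addr0. Qed.

Section Graph.
Context (pi : multisection A).
Arguments pi : clear implicits.
Hypothesis spi : smooth_multisection 2 pi.
Let pit := tilde_multisection phi0 pi.

Lemma smooth_tilde_multisection : smooth_multisection 2 pit.
Proof.
have := smooth_multisectionM (line_charts charts) (line_bundle bundleA)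
  (smooth_fun_expRM charts (-1)) (smooth_multisection_fst spi).
rewrite (_ : (fun p s => _) = pit) //.
by apply: functional_extensionality_dep => p; apply/funext => s; rewrite mulN1r.
Qed.

Lemma tilde_graphE x t (v : A x) (xi theta : dual (A x)) :
  graph_sharp pit (x := (x, t)) (v, xi) -> theta v = expR (- t) * pi x [:: xi; theta] :> R.
Proof. by move=> /(_ theta). Qed.

Lemma tilde_graph_scale x t (v : A x) (xi : dual (A x)) :
  graph_sharp pit (x := (x, t)) (v, xi) -> graph_sharp pi (expR t *: v, xi).
Proof.
move=> h eta; rewrite dualZ (tilde_graphE _ h) mulrA -expRD subrr expR0.
exact: mul1r.
Qed.

Lemma tilde_graph_dt X xi x t (theta : dual (A x)) :
  smooth_section X -> smooth_cosection xi ->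
  (forall p, graph_sharp pit (X p, xi p)) ->
  theta (dtv X x t) = - theta (X (x, t)) + expR (- t) * pi x [:: dtc xi x t; theta] :> R.
Proof.
move=> sX sxi g; have [mpi _] := spi.
(* Turning pi(-, theta) into a covector [L] on the dual space makes its derivative along [xi] the
   value of [L] at [dtc xi]. *)
have lL : linear (fun l : dual (A x) => pi x [:: l; theta] : R^o).
  by move=> a l l'; exact: multivector2_linl.
have LE := linfun_linear lL; set L := linfun _ in LE.
have hX := is_derive_dual
  (smooth_section_vderivable charts cover bundleA (t := t) (x := x) sX) theta.
have hL := is_derive_dual
  (smooth_cosection_vderivable charts cover bundleA (t := t) (x := x) sxi) L.
have hE := is_derive_expRN t.
have h := is_deriveM hE hL.
have E : (fun s : R => theta (X (x, s)) : R) =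
    (fun s : R => expR (- s)) * (fun s => L (xi (x, s)) : R).
  by apply/funext => s; rewrite (tilde_graphE theta (g (x, s))); have /= <- := LE (xi (x, s)).
rewrite -E in h; have [_ e1] := h; have [_ e2] := hX.
rewrite -[LHS]e2 e1 /GRing.scale /= (tilde_graphE theta (g (x, t))).
have /= <- := LE (xi (x, t)); have /= <- := LE (dtc xi x t); rewrite /dtc.
by rewrite addrC mulrN mulrC.
Qed.

Let phi0t : cosection tA := fun q => 0.

Lemma tilde_subbundle : is_subbundle (graph_sharp pit).
Proof.
exact: (graph_sharp_subbundle (A := tA) (line_charts charts)
  (line_bundle bundleA) smooth_tilde_multisection).
Qed.

Lemma tilde_maximally_isotropic p : maximally_isotropic (graph_sharp pit (x := p)).
Proof. exact: (graph_sharp_maximally_isotropic (A := tA) smooth_tilde_multisection). Qed.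

Lemma tilde_graph_skew p (v w : tA p) (xi eta : dual (tA p)) :
  graph_sharp pit (v, xi) -> graph_sharp pit (w, eta) -> xi w = - eta v.
Proof. exact: (graph_sharp_skew smooth_tilde_multisection). Qed.

Lemma dirac_tilde : dirac_structure phi0 (graph_sharp pi) ->
  dirac_structure phi0t (graph_sharp pit).
Proof.
have [mpi _] := spi.
move=> [_ _ clos]; split; [exact: tilde_subbundle|exact: tilde_maximally_isotropic|].
move=> X xi Y eta sX sxi sY seta gX gY.
have sXt t : smooth_section (slice X t) by exact: smooth_section_slice.
have sYt t : smooth_section (slice Y t) by exact: smooth_section_slice.
have sxit t : smooth_cosection (coslice xi t) by exact: smooth_cosection_slice.
have setat t : smooth_cosection (coslice eta t) by exact: smooth_cosection_slice.
pose eX t : section A := fun x => expR t *: slice X t x.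
pose eY t : section A := fun x => expR t *: slice Y t x.
have seX t : smooth_section (eX t) by exact: smooth_sectionZ.
have seY t : smooth_section (eY t) by exact: smooth_sectionZ.
have geX t x : graph_sharp pi (eX t x, coslice xi t x) := tilde_graph_scale (gX (x, t)).
have geY t x : graph_sharp pi (eY t x, coslice eta t x) := tilde_graph_scale (gY (x, t)).
(* Closure of the graph over M is applied on each slice separately, and the resulting forms are
   collected by choice. *)
have H t : exists z : cosection A,
    (forall Z : section A, smooth_section Z -> forall x, z x (Z x) =
      courant_form phi0 (eX t) (coslice xi t) (eY t) (coslice eta t) Z x) /\
    (forall x, graph_sharp pi (bracket (eX t) (eY t) x, z x)).
  have [z h1 h2] := clos _ _ _ _ (seX t) (sxit t) (seY t) (setat t) (geX t) (geY t).
  by exists z.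
have [z hz] := choice H.
have FE (t : R) : expR (- t) * expR t = 1 by rewrite -expRD addNr expR0.
(* The form is read off from the bracket: [X_t, Y_t] = e^{-2t} [e^t X_t, e^t Y_t] = e^{-2t} pi^sharp
   z, and dY/dt = e^{-t} pi^sharp (d eta/dt - eta), likewise for X. Hence the extended bracket is
   e^{-t} pi^sharp of the form given here. *)
exists (fun p : base tA => expR (- p.2) *: z p.2 p.1
  + ((phi0 p.1 (X p) : R) *: (dtc eta p.1 p.2 - eta p)
  - (phi0 p.1 (Y p) : R) *: (dtc xi p.1 p.2 - xi p)) : dual (tA p)).
  move=> Z sZ [x t].
  have sZt : smooth_section (slice Z t) by exact: smooth_section_slice.
  rewrite courant_form_isotropic; last 2 first.
  - by move=> q; exact: tilde_graph_skew.
  - exact: tilde_act_pairingN.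
  rewrite !dAphi1_0 dAphi0_0 !tilde_dA1 // /act /= /tilde_anchor /= derive1_pairing //.
  have h1 := tilde_graph_dt t (eta (x, t)) sX sxi gX.
  have h2 := tilde_graphE (dtc xi x t) (gY (x, t)).
  rewrite (multivector2_skew _ _ (mpi x)) in h2.
  have h3 := tilde_graph_skew (gX (x, t)) (gY (x, t)).
  have ez := (hz t).1 _ sZt x.
  rewrite courant_form_isotropic in ez; last 2 first.
  - by move=> y; exact: (graph_sharp_skew spi).
  - by rewrite /act (anchor_funN lieA) //; exact: (smooth_pairing charts bundleA).
  move: ez; rewrite /dAphi1 !(dA1Zl lieA) // /dAphi0 /dA0 /act.
  have -> : (fun y => coslice eta t y (eX t y)) =
      (fun y => expR t * (coslice eta t y (slice X t y) : R)).
    by apply/funext => y; rewrite dualZ.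
  rewrite (anchor_funZ lieA); last exact: (smooth_pairing charts bundleA).
  rewrite /eX /eY /slice /coslice !dualZ !dual_addE !dual_oppE !dual_scaleE.
  rewrite !dual_addE !dual_oppE => ez; move: (FE t) h1 h2 h3 => /= Ft h1 h2 h3.
  by rewrite ez h1 h2 h3; exact: tilde_courant_identity.
move=> [x t] theta.
have gz := (hz t).2 x theta.
rewrite (bracketZl lieA) // (bracketZr lieA) // !dualZ in gz.
have hb := tilde_bracketE X Y x t.
suff : theta (bracket X Y (x, t)) = expR (- t) * pi x [:: expR (- t) *: z t x
    + ((phi0 x (X (x, t)) : R) *: (dtc eta x t - eta (x, t))
    - (phi0 x (Y (x, t)) : R) *: (dtc xi x t - xi (x, t))); theta] :> R by [].
rewrite !(multivector2_Dl _ _ _ (mpi x)).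
rewrite !(multivector2_Nl _ _ (mpi x)) !(multivector2_Zl _ _ _ (mpi x)).
rewrite !(multivector2_Dl _ _ _ (mpi x)) !(multivector2_Nl _ _ (mpi x)) -gz.
rewrite hb !dualD dualN !dualZ.
have h1 := tilde_graph_dt t theta sX sxi gX.
have h2 := tilde_graph_dt t theta sY seta gY.
have h3 := tilde_graphE theta (gX (x, t)).
have h4 := tilde_graphE theta (gY (x, t)).
move: (FE t) h1 h2 h3 h4 => /= Ft h1 h2 h3 h4.
by rewrite h1 h2 h3 h4; ring: Ft.
Qed.

End Graph.

End TildeDirac.

(** * From Dirac structures over M x R back to M *)

Section TildeDiracConverse.
Context (R : realType) (A : algebroid_data R) (phi0 : cosection A).
Hypothesis lieA : is_lie_algebroid A.
Let charts := lie_charts lieA.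
Let cover := lie_cover lieA.
Let bundleA := lie_bundle lieA.
Let tA := tilde phi0.

Lemma derive1_curve (V : vectType R) (c : R -> V) (t : R) (v : V) :
  vderivable c t -> (forall l : dual V, derive1 (fun s : R => l (c s) : R) t = l v) ->
  dvec c t = v.
Proof.
move=> dc h; apply: dual_separates => l; rewrite -h derive1E.
by have [_ ->] := is_derive_dual dc l.
Qed.

Definition section_fst (X : section A) : section tA := fun p => X p.1.

Definition cosection_exp (xi : cosection A) : cosection tA :=
  fun p => expR p.2 *: xi p.1.

Lemma smooth_section_fst_tilde X : smooth_section X -> smooth_section (section_fst X).
Proof. exact: smooth_section_fst. Qed.

Lemma smooth_cosection_exp xi : smooth_cosection xi -> smooth_cosection (cosection_exp xi).
Proof.
move=> sxi; have := smooth_cosectionM (line_charts charts) (line_bundle bundleA)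
  (smooth_fun_expRM charts 1) (smooth_cosection_fst sxi).
rewrite (_ : (fun p => expR (1 * p.2) *: xi p.1) = cosection_exp xi) //.
by apply: functional_extensionality_dep => p; rewrite mul1r.
Qed.

Lemma dtv_section_fst X x t : smooth_section X -> dtv (section_fst X : section tA) x t = 0.
Proof.
move=> sX; apply: derive1_curve => [|l].
  exact: (smooth_section_vderivable charts cover bundleA (smooth_section_fst_tilde sX)).
transitivity (derive1 (cst (l (X x) : R)) t); first by [].
by rewrite linear0 derive1_cst.
Qed.

Lemma dtc_cosection_exp xi x t : smooth_cosection xi ->
  dtc (cosection_exp xi : cosection tA) x t = expR t *: xi x.
Proof.
move=> sxi; have dxi := smooth_cosection_vderivable charts cover bundleA (x := x)
  (t := t) (smooth_cosection_exp sxi).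
apply/lfunP => v; have [_ <-] := is_derive_eval dxi v.
have [_ e] := is_derive_mulr (xi x v : R) (is_derive_expR t).
transitivity ('D_1 (fun s : R => expR s * (xi x v : R)) t).
  by congr ('D_1 _ t); apply/funext => s; rewrite -dual_scaleE.
by rewrite e dual_scaleE.
Qed.

Lemma coslice_cosection_exp xi : coslice (cosection_exp xi : cosection tA) 0 = xi.
Proof.
by apply: functional_extensionality_dep => x; rewrite /coslice /cosection_exp /= expR0 scale1r.
Qed.

Lemma graph_sharp_exp (pi : multisection A) (X : section A) (xi : cosection A) :
  smooth_multisection 2 pi ->
  (forall x, graph_sharp pi (X x, xi x)) ->
  forall p, graph_sharp (tilde_multisection phi0 pi) (section_fst X p, cosection_exp xi p).
Proof.
move=> [mpi _] g [x t] theta.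
suff : theta (X x) = expR (- t) * pi x [:: expR t *: xi x; theta] :> R by [].
by rewrite (multivector2_Zl _ _ _ (mpi x)) mulrA -expRD addNr expR0 mul1r; exact: g.
Qed.

Let phi0t : cosection tA := fun q => 0.

Lemma dirac_untilde (pi : multisection A) : smooth_multisection 2 pi ->
  dirac_structure phi0t (graph_sharp (tilde_multisection phi0 pi)) ->
  dirac_structure phi0 (graph_sharp pi).
Proof.
move=> spi [_ _ clos]; split.
- exact: graph_sharp_subbundle.
- by move=> x; exact: graph_sharp_maximally_isotropic.
move=> X xi Y eta sX sxi sY seta gX gY.
have sXt := smooth_section_fst_tilde sX.
have sYt := smooth_section_fst_tilde sY.
have sxit := smooth_cosection_exp sxi.
have setat := smooth_cosection_exp seta.
have gXt := graph_sharp_exp spi gX.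
have gYt := graph_sharp_exp spi gY.
have [z zE gz] := clos _ _ _ _ sXt sxit sYt setat gXt gYt.
(* At t = 0 the factor e^t is 1, so the slices are the given sections and forms. The form e^t xi is
   its own t-derivative, which is how [tilde_dA1] yields the terms in phi0 /\ xi. *)
exists (fun x => z (x, 0) : dual (A x)).
  move=> Z sZ x; have sZt := smooth_section_fst_tilde sZ.
  have -> : (z (x, 0) (Z x) : R) = z (x, 0) (section_fst Z (x, 0)) by [].
  rewrite zE // courant_form_isotropic; last 2 first.
  - by move=> p; exact: (tilde_graph_skew lieA spi).
  - exact: (tilde_act_pairingN lieA).
  rewrite courant_form_isotropic; last 2 first.
  - by move=> y; exact: (graph_sharp_skew spi).
  - by rewrite /act (anchor_funN lieA) //; exact: (smooth_pairing charts bundleA).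
  rewrite !dAphi1_0 dAphi0_0 !(tilde_dA1 lieA) // !coslice_cosection_exp.
  rewrite !dtc_cosection_exp // expR0 !scale1r.
  rewrite /act /= /tilde_anchor (derive1_pairing lieA _ _ setat sXt).
  rewrite dtc_cosection_exp // dtv_section_fst // linear0 expR0 scale1r.
  rewrite (_ : (fun y => cosection_exp eta (y, 0) (section_fst X (y, 0))) =
    (fun y => eta y (X y) : R)); last first.
    by apply/funext => y; rewrite /cosection_exp /= expR0 scale1r.
  rewrite /dAphi1 /dAphi0 /dA0 /act /section_fst /slice /=.
  by ring.
move=> x theta; have gzx := gz (x, 0) theta.
have : theta (bracket (section_fst X : section tA) (section_fst Y) (x, 0)) =
  expR (- 0) * pi x [:: z (x, 0); theta] :> R := gzx.
by rewrite tilde_bracketE !dtv_section_fst // !scaler0 addr0 subr0 oppr0 expR0 mul1r.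
Qed.

End TildeDiracConverse.

(** * Nijenhuis relations over M and over M x R *)

Section Nijenhuis.
Context (R : realType) (A : algebroid_data R) (phi0 : cosection A).
Hypothesis lieA : is_lie_algebroid A.
Let charts := lie_charts lieA.
Let cover := lie_cover lieA.
Let bundleA := lie_bundle lieA.
Let tA := tilde phi0.
Context (Q : relation A).
Arguments Q : clear implicits.
Let Qt : relation tA := fun p => Q p.1.

Lemma dtv_relation (X Y : section tA) x t (a b : dual (A x)) :
  smooth_section X -> smooth_section Y ->
  (forall p, Q p.1 (X p, Y p)) -> costar Q (a, b) ->
  b (dtv X x t) = a (dtv Y x t).
Proof.
move=> sX sY QXY ab.
have [_ <-] := is_derive_dual
  (smooth_section_vderivable charts cover bundleA (t := t) (x := x) sX) b.
have [_ <-] := is_derive_dual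
  (smooth_section_vderivable charts cover bundleA (t := t) (x := x) sY) a.
by congr ('D_1 _ t); apply/funext => s; exact: ab (QXY (x, s)).
Qed.

(** Over M x R each coefficient phi0(X_i) or phi0(Y_i) of the torsion multiplies a difference such
    as alpha(dY_2/dt) - beta(dX_2/dt), zero by [dtv_relation]. Conversely, sections over M are
    extended constantly in t, and the derivatives themselves vanish. *)
Lemma nijenhuis_tilde : nijenhuis Q <-> nijenhuis (A := tA) Qt.
Proof.
split=> nij X1 Y1 X2 Y2 sX1 sY1 sX2 sY2 Q1 Q2 al be ga sal sbe sga ab bg.
  move=> [x t].
  have sl (X : section tA) : smooth_section X -> smooth_section (slice X t).
    exact: smooth_section_slice.
  have scl (a : cosection tA) : smooth_cosection a -> smooth_cosection (coslice a t).
    exact: smooth_cosection_slice.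
  have := nij _ _ _ _ (sl _ sX1) (sl _ sY1) (sl _ sX2) (sl _ sY2)
    (fun y => Q1 (y, t)) (fun y => Q2 (y, t)) _ _ _ (scl _ sal) (scl _ sbe) (scl _ sga)
    (fun y => ab (y, t)) (fun y => bg (y, t)) x.
  rewrite /torsion !tilde_bracketE /coslice /= => n0.
  have e1 := dtv_relation t sX1 sY1 Q1 (ab (x, t)).
  have e2 := dtv_relation t sX2 sY2 Q2 (ab (x, t)).
  have e3 := dtv_relation t sX1 sY1 Q1 (bg (x, t)).
  have e4 := dtv_relation t sX2 sY2 Q2 (bg (x, t)).
  move: n0; rewrite !dualD !dualN !dualZ e1 e2 e3 e4 => n0.
  by rewrite -[RHS]n0; ring.
move=> x.
have sl X : smooth_section X -> smooth_section (section_fst X : section tA).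
  exact: smooth_section_fst_tilde.
have scl (a : cosection A) : smooth_cosection a ->
    smooth_cosection (fun p => a p.1 : dual (tA p)).
  exact: smooth_cosection_fst.
have := nij _ _ _ _ (sl _ sX1) (sl _ sY1) (sl _ sX2) (sl _ sY2)
  (fun p => Q1 p.1) (fun p => Q2 p.1) _ _ _ (scl _ sal) (scl _ sbe) (scl _ sga)
  (fun p => ab p.1) (fun p => bg p.1) (x, 0).
rewrite /torsion !tilde_bracketE !(dtv_section_fst phi0 lieA) //.
by rewrite !scaler0 !addr0 !subr0.
Qed.

End Nijenhuis.

(** Both graphs carry the same factor e^{-t}, so it is absorbed into the covector that the two
    elements share. *)
Lemma N_rel_tilde (R : realType) (A : algebroid_data R) (phi0 : cosection A)
    (pi1 pi2 : multisection A) :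
  smooth_multisection 2 pi1 -> smooth_multisection 2 pi2 ->
  N_rel (graph_sharp (tilde_multisection phi0 pi1))
    (graph_sharp (tilde_multisection phi0 pi2)) =
  (fun p : base (tilde phi0) => N_rel (graph_sharp pi1) (graph_sharp pi2) (x := p.1)).
Proof.
move=> [mpi1 _] [mpi2 _]; apply: functional_extensionality_dep => -[x t].
apply/seteqP; split=> -[u v] [al [g2 g1]].
  exists (expR (- t) *: al); split=> theta.
    by rewrite (multivector2_Zl _ _ _ (mpi2 x)); exact: g2.
  by rewrite (multivector2_Zl _ _ _ (mpi1 x)); exact: g1.
have e (pi : multisection A) theta : (forall x, multivector 2 (pi x)) ->
    expR (- t) * pi x [:: expR t *: al; theta] = pi x [:: al; theta].
  by move=> mpi; rewrite (multivector2_Zl _ _ _ (mpi x)) mulrA -expRD addNr expR0 mul1r.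
exists (expR t *: al); split=> theta.
  by have /= := g2 theta; rewrite -(e _ theta mpi2).
by have /= := g1 theta; rewrite -(e _ theta mpi1).
Qed.

(** * Schouten brackets *)

Lemma signr_congr (R : pzRingType) m n : odd m = odd n -> (-1) ^+ m = (-1) ^+ n :> R.
Proof. by move=> mn; rewrite -signr_odd mn signr_odd. Qed.

(** * Multisections over M x R differentiated in t *)

Section TDerivative.
Context (R : realType) (M : manifold_data R) (E : bundle_data M).
Hypothesis charts : forall c : chart R M (mdim M), atlas c -> is_chart c.
Hypothesis cover : forall x : M, exists2 c : chart R M (mdim M), atlas c & cdom c x.
Hypothesis bundleE : is_bundle E.
Let EL := line_bundle_prod E.

Definition dtm (D : multisection EL) (x : M) (t : R) (s : seq (dual (E x))) : R :=
  derive1 (fun r : R => D (x, r) s) t.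

Lemma smooth_multisection_derivable k (D : multisection EL) (x : M) (t : R)
    (s : seq (dual (E x))) :
  smooth_multisection k D -> derivable (fun r : R => D (x, r) s) t 1.
Proof.
move=> [mD sD]; have [tau ttau dx] := trivs_cover bundleE x.
have lD (r : R) : multilinear (D (x, r)) by case: (mD (x, r)).
(* Smoothness is known on coframe lists only. The covectors of [s] are expanded one by one, so the
   statement is generalised to lists that begin with coframe elements. *)
suff h J : derivable (fun r : R => D (x, r) ([seq coframe tau j x | j <- J] ++ s)) t 1.
  exact: (h [::]).
elim: s J => [|xi s IH] J.
  rewrite cats0; have := sD _ (ex_intro2 _ _ tau ttau erefl) J => sJ.
  exact: (smooth_on_derivable_line charts (cover x) sJ).
rewrite (_ : (fun r => _) = (fun r : R => \sum_i
    D (x, r) ([seq coframe tau j x | j <- rcons J i] ++ s) * xi (frame tau i x))).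
  by have [] := is_derive_bigsum (fun i =>
    is_derive_mulr (xi (frame tau i x)) (derivableP (IH (rcons J i)))).
apply/funext => r; rewrite {1}(coframe_sum bundleE xi ttau dx).
rewrite (multilinear_sum (D := D (x, r))) //; apply: eq_bigr => i _.
by rewrite map_rcons cat_rcons mulrC.
Qed.

Lemma is_derive_dtm k (D : multisection EL) (x : M) (t : R) (s : seq (dual (E x))) :
  smooth_multisection k D -> is_derive t 1 (fun r : R => D (x, r) s) (dtm D t s).
Proof.
by move=> sD; rewrite /dtm derive1E; apply: derivableP;
  exact: smooth_multisection_derivable sD.
Qed.

Lemma dtm_eq (D : multisection EL) (x : M) (t : R) (s : seq (dual (E x))) d :
  is_derive t 1 (fun r : R => D (x, r) s) d -> dtm D t s = d.
Proof. by rewrite /dtm derive1E; case. Qed.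

Lemma is_derive_lin (f g : R -> R) (df dg a t : R) :
  is_derive t 1 f df -> is_derive t 1 g dg ->
  is_derive t 1 (fun r => a * f r + g r) (a * df + dg).
Proof. by move=> hf hg; exact: (is_deriveD (is_deriveZ a hf) hg). Qed.

Lemma dtm_lin k (c : R) (D D' : multisection EL) (x : M) (t : R) (s : seq (dual (E x))) :
  smooth_multisection k D -> smooth_multisection k D' ->
  dtm (fun p u => c * D p u + D' p u) t s = c * dtm D t s + dtm D' t s.
Proof.
move=> sD sD'.
have h := is_derive_lin c (is_derive_dtm t s sD) (is_derive_dtm t s sD').
exact: (@dtm_eq (fun p u => c * D p u + D' p u) x t s _ h).
Qed.

Lemma dtm_wedge j k (D D' : multisection EL) (x : M) (t : R) (s : seq (dual (E x))) :
  smooth_multisection j D -> smooth_multisection k D' ->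
  dtm (mwedge D D') t s =
  wedge (dtm D t (x := x)) (D' (x, t)) s + wedge (D (x, t)) (dtm D' t (x := x)) s.
Proof.
move=> sD sD'.
have h := (@is_derive_wedge R (dual (E x)) (fun r => D (x, r)) (fun r => D' (x, r)) _ _ t s
  (fun u => is_derive_dtm t u sD) (fun u => is_derive_dtm t u sD')).
exact: (@dtm_eq (mwedge D D') x t s _ h).
Qed.

Lemma multivector_dtm k (D : multisection EL) (x : M) (t : R) :
  smooth_multisection k D -> multivector k (dtm D t (x := x)).
Proof.
move=> sD; have [mD _] := sD.
have hD u := is_derive_dtm (x := x) t u sD.
have dcst (s : seq (dual (E x))) : (forall r, D (x, r) s = 0) -> dtm D t s = 0.
  move=> D0; apply: dtm_eq; rewrite (_ : (fun r => _) = cst 0).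
    exact: is_derive_cst.
  exact/funext.
split=> [s ks|s1 s2 a xi eta|s1 s2 xi].
- by apply: dcst => r; have [-> //] := mD (x, r).
- apply: dtm_eq.
  rewrite (_ : (fun r => _) = (fun r => a * D (x, r) (s1 ++ xi :: s2) +
    D (x, r) (s1 ++ eta :: s2))); first exact: is_derive_lin.
  by apply/funext => r; have [_ -> _] := mD (x, r).
- by apply: dcst => r; have [_ _ ->] := mD (x, r).
Qed.

End TDerivative.

(** * The Schouten bracket over M x R built from one over M *)

Section TildeSchouten.
Context (R : realType) (A : algebroid_data R) (phi0 : cosection A).
Arguments phi0 : clear implicits.
Hypothesis lieA : is_lie_algebroid A.
Let charts := lie_charts lieA.
Let cover := lie_cover lieA.
Let bundleA := lie_bundle lieA.
Let tA := tilde phi0.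
Context (B : multisection A -> multisection A -> multisection A).
Arguments B : clear implicits.
Hypothesis schoutenB : is_schouten B.

Definition iphi (D : multisection tA) (x : base A) (t : R) (s : seq (dual (A x))) : R :=
  D (x, t) (phi0 x :: s).

(* [sgn] multiplies an (a-1)-vector by (-1)^(a-1), so that the sign in front of the
   second term does not require the degree of D1 as an argument. *)
Definition tilde_schouten (D1 D2 : multisection tA) : multisection tA :=
  fun p s => B (mslice D1 p.2) (mslice D2 p.2) p.1 s
    + wedge (sgn (iphi D1 p.2 (x := p.1))) (dtm D2 p.2 (x := p.1)) s
    - wedge (dtm D1 p.2 (x := p.1)) (iphi D2 p.2 (x := p.1)) s.

Arguments tilde_schouten D1 D2 x s : clear implicits.

Implicit Types D : multisection tA.

Lemma hom_iphi k D x t : smooth_multisection k.+1 D -> hom k (iphi D t (x := x)).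
Proof. by move=> [mD _] s ks; have [D0 _ _] := mD (x, t); exact: D0. Qed.

Lemma iphi0 D x t : smooth_multisection 0 D -> iphi D t (x := x) = (fun=> 0).
Proof. by move=> [mD _]; apply/funext => s; have [D0 _ _] := mD (x, t); exact: D0. Qed.

Lemma hom_dtm k D (x : base A) (t : R) : smooth_multisection k D -> hom k (dtm D t (x := x)).
Proof. by move=> sD; have [] := multivector_dtm charts cover bundleA x t sD. Qed.

Lemma hom_at k D p : smooth_multisection k D -> hom k (D p).
Proof. by move=> [mD _]; have [] := mD p. Qed.

(** The sign is (a - 1) + (a - 1) b = (a - 1)(b + 1) modulo 2. This makes the two added terms of
    [tilde_schouten] mirror images of each other, which is its skew-symmetry. *)
Lemma sgn_iphi_wedge a b D (x : base A) (t : R) (E : seq (dual (A x)) -> R) s :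
  smooth_multisection a D -> hom b E ->
  wedge (sgn (iphi D t (x := x))) E s =
  (-1) ^+ (a.+1 * b.+1)%N * wedge E (iphi D t (x := x)) s.
Proof.
case: a => [|a] sD hE.
  by rewrite iphi0 // sgn0 wedge0l wedge0r mulr0.
have hi := hom_iphi (x := x) t sD.
rewrite (hom_sgnE hi) wedgeZl (wedgeC _ hi hE) mulrA -exprD; congr (_ * _).
by apply: signr_congr; rewrite !oddD !oddM /=; case: (odd a); case: (odd b).
Qed.

Lemma multivector_iphi k D x t : smooth_multisection k.+1 D ->
  multivector k (iphi D t (x := x)).
Proof. by move=> [mD _]; exact: (multivector_contract (phi0 x) (mD (x, t))). Qed.

Lemma tilde_schouten_multivector a b D1 D2 :
  smooth_multisection a D1 -> smooth_multisection b D2 ->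
  forall p, multivector (a + b).-1 (tilde_schouten D1 D2 p).
Proof.
move=> sD1 sD2 [x t]; have [mB _ _ _ _] := schoutenB.
have h1 := mB _ _ _ _ (smooth_multisection_slice t sD1)
  (smooth_multisection_slice t sD2) x.
have d1 := multivector_dtm charts cover bundleA x t sD1.
have d2 := multivector_dtm charts cover bundleA x t sD2.
have h2 : multivector (a + b).-1 (wedge (sgn (iphi D1 t (x := x))) (dtm D2 t (x := x))).
  (* The truncated [(a + b).-1] equals (a - 1) + b only for a > 0; for a = 0 the contraction kills
     the function, and zero has every degree. *)
  case: a sD1 {h1 d1} => [|a] sD1; last first.
    exact: (multivector_wedge (multivector_sgn (multivector_iphi x t sD1)) d2).
  rewrite (_ : wedge _ _ = (fun=> 0)); first exact: multivector_zero.
  apply/funext => s; by rewrite iphi0 // sgn0 wedge0l.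
have h3 : multivector (a + b).-1 (wedge (dtm D1 t (x := x)) (iphi D2 t (x := x))).
  case: b sD2 {h1 d2 h2} => [|b] sD2; last first.
    have := multivector_wedge d1 (multivector_iphi x t sD2).
    by rewrite (_ : (a + b.+1).-1 = (a + b)%N) //; lia.
  rewrite (_ : wedge _ _ = (fun=> 0)); first exact: multivector_zero.
  by apply/funext => s; rewrite iphi0 // wedge0r.
have := multivector_lin (-1) h3 (multivector_lin 1 h1 h2).
rewrite (_ : (fun s => _) = tilde_schouten D1 D2 (x, t)) //.
by apply/funext => s; rewrite /tilde_schouten /= mul1r; ring.
Qed.

Lemma tilde_schouten_linear a b (c : R) D1 D2 D2' :
  smooth_multisection a D1 -> smooth_multisection b D2 -> smooth_multisection b D2' ->
  tilde_schouten D1 (fun x s => c * D2 x s + D2' x s) =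
  (fun x s => c * tilde_schouten D1 D2 x s + tilde_schouten D1 D2' x s).
Proof.
move=> sD1 sD2 sD2'; have [_ lB _ _ _] := schoutenB.
apply: functional_extensionality_dep => -[x t]; apply/funext => s.
rewrite /tilde_schouten /=.
have -> : mslice (fun p u => c * D2 p u + D2' p u) t =
  (fun x (u : seq (dual (A x))) => c * mslice D2 t u + mslice D2' t u) by [].
rewrite (lB _ _ c _ _ _ (smooth_multisection_slice t sD1)
  (smooth_multisection_slice t sD2) (smooth_multisection_slice t sD2')).
have -> : dtm (fun p u => c * D2 p u + D2' p u) t (x := x) =
    (fun u => c * dtm D2 t u + dtm D2' t u).
  by apply/funext => u; exact: (dtm_lin charts cover bundleA c t u sD2 sD2').
have -> : iphi (fun p u => c * D2 p u + D2' p u) t (x := x) =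
    (fun u => c * iphi D2 t u + iphi D2' t u) by [].
by rewrite !wedge_linr; ring.
Qed.

Lemma tilde_schouten_skew a1 a2 D1 D2 :
  smooth_multisection a1 D1 -> smooth_multisection a2 D2 ->
  tilde_schouten D1 D2 =
  (fun x s => - ((-1) ^+ (a1.+1 * a2.+1) * tilde_schouten D2 D1 x s)).
Proof.
move=> sD1 sD2; have [_ _ _ _ skew] := schoutenB.
apply: functional_extensionality_dep => -[x t]; apply/funext => s.
rewrite /tilde_schouten /=.
rewrite (skew _ _ _ _ (smooth_multisection_slice t sD1)
  (smooth_multisection_slice t sD2)).
rewrite (sgn_iphi_wedge t s sD1 (hom_dtm (x := x) t sD2)).
rewrite (sgn_iphi_wedge t s sD2 (hom_dtm (x := x) t sD1)).
rewrite (mulnC a2.+1 a1.+1).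
have := signrMK (a1.+1 * a2.+1) (wedge (dtm D1 t (x := x)) (iphi D2 t (x := x)) s).
set e := (-1) ^+ _ => e2; rewrite -{1}e2.
by ring.
Qed.

(** Contraction with phi0 is an antiderivation of the exterior product and d/dt is a derivation, so
    each added term splits in two as the bracket does. *)
Lemma tilde_schouten_leibniz a1 a2 a3 D1 D2 D3 :
  smooth_multisection a1 D1 -> smooth_multisection a2 D2 -> smooth_multisection a3 D3 ->
  tilde_schouten D1 (mwedge D2 D3) =
  (fun x s => mwedge (tilde_schouten D1 D2) D3 x s +
     (-1) ^+ (a1.+1 * a2) * mwedge D2 (tilde_schouten D1 D3) x s).
Proof.
move=> sD1 sD2 sD3; have [_ _ _ leib _] := schoutenB.
apply: functional_extensionality_dep => -[x t]; apply/funext => s.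
rewrite {1}/tilde_schouten /=.
have -> : mslice (mwedge D2 D3) t = mwedge (mslice D2 t) (mslice D3 t) by [].
rewrite (leib _ _ _ _ _ _ (smooth_multisection_slice t sD1)
  (smooth_multisection_slice t sD2) (smooth_multisection_slice t sD3)).
have -> : dtm (mwedge D2 D3) t (x := x) = (fun u =>
    wedge (dtm D2 t (x := x)) (D3 (x, t)) u + wedge (D2 (x, t)) (dtm D3 t (x := x)) u).
  by apply/funext => u; exact: (dtm_wedge charts cover bundleA t u sD2 sD3).
have -> : iphi (mwedge D2 D3) t (x := x) = (fun u =>
    wedge (iphi D2 t (x := x)) (D3 (x, t)) u +
    wedge (sgn (D2 (x, t))) (iphi D3 t (x := x)) u) by [].
rewrite /mwedge !wedgeDr.
have -> : tilde_schouten D1 D2 (x, t) = (fun u =>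
    (B (mslice D1 t) (mslice D2 t) x u
    + wedge (sgn (iphi D1 t (x := x))) (dtm D2 t (x := x)) u)
    + - wedge (dtm D1 t (x := x)) (iphi D2 t (x := x)) u) by [].
rewrite !wedgeDl wedgeNl wedgeNr -!wedgeA /mslice /=.
have h2 := hom_at (p := (x, t)) sD2.
have d1 := hom_dtm (x := x) t sD1.
(* In the two mixed terms [D2] stands on the wrong side of a contraction or derivative of [D1].
   Moving it costs (-1)^((a1 - 1) a2) here, and (-1)^(a2 + a1 a2) in [e2], where [sgn] contributes
   a2: both are the Leibniz sign. *)
have e1 : wedge (wedge (sgn (iphi D1 t (x := x))) (D2 (x, t))) (dtm D3 t (x := x)) s =
    (-1) ^+ (a1.+1 * a2) *
    wedge (wedge (D2 (x, t)) (sgn (iphi D1 t (x := x)))) (dtm D3 t (x := x)) s.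
  rewrite -wedgeZl; congr wedge; apply/funext => u.
  case: a1 sD1 {d1} => [|a1] sD1.
    by rewrite iphi0 // sgn0 wedge0l wedge0r mulr0.
  rewrite (wedgeC _ (hom_sgn (hom_iphi (x := x) t sD1)) h2); congr (_ * _).
  by apply: signr_congr; rewrite !oddM /= negbK.
have e2 : wedge (wedge (dtm D1 t (x := x)) (sgn (D2 (x, t)))) (iphi D3 t (x := x)) s =
    (-1) ^+ (a1.+1 * a2) *
    wedge (wedge (D2 (x, t)) (dtm D1 t (x := x))) (iphi D3 t (x := x)) s.
  rewrite -wedgeZl; congr wedge; apply/funext => u.
  rewrite (hom_sgnE h2) wedgeZr (wedgeC _ d1 h2) mulrA -exprD; congr (_ * _).
by rewrite e1 e2; ring.
Qed.

Lemma tilde_schouten00 (f g : base tA -> R) : smooth_fun f -> smooth_fun g ->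
  tilde_schouten (msec0 f) (msec0 g) = (fun x s => 0).
Proof.
move=> sf sg; have [_ _ [B00 _ _] _ _] := schoutenB.
apply: functional_extensionality_dep => -[x t]; apply/funext => s.
rewrite /tilde_schouten /=.
rewrite [mslice (msec0 f) t](_ : _ = msec0 (fun x => f (x, t))) //.
rewrite [mslice (msec0 g) t](_ : _ = msec0 (fun x => g (x, t))) //.
rewrite B00; try exact: (smooth_fun_slice).
have s0 h : iphi (msec0 h : multisection tA) t (x := x) = (fun=> 0) by [].
by rewrite !s0 wedge0r sgn0 wedge0l; ring.
Qed.

Lemma iphi_msec1 (X : section tA) x t :
  iphi (msec1 X : multisection tA) t (x := x) = scalar0 (phi0 x (X (x, t)) : R).
Proof. by apply/funext => -[|? ?]. Qed.

Lemma sgn_scalar0 (T : Type) (a : R) : sgn (scalar0 a) = scalar0 a :> (seq T -> R).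
Proof.
apply/funext => -[|? ?]; rewrite /sgn /=; first by rewrite expr0 mul1r.
by rewrite mulr0.
Qed.

Lemma tilde_schouten10 (X : section tA) (f : base tA -> R) :
  smooth_section X -> smooth_fun f ->
  tilde_schouten (msec1 X) (msec0 f) = msec0 (act X f).
Proof.
move=> sX sf; have [_ _ [_ B10 _] _ _] := schoutenB.
apply: functional_extensionality_dep => -[x t]; apply/funext => s.
rewrite /tilde_schouten /=.
rewrite [mslice (msec1 X) t](_ : _ = msec1 (slice X t)) //.
rewrite [mslice (msec0 f) t](_ : _ = msec0 (fun x => f (x, t))) //.
rewrite B10; [|exact: smooth_section_slice|exact: (smooth_fun_slice)].
rewrite iphi_msec1 sgn_scalar0 wedge_scalar0.
rewrite [iphi (msec0 f) t (x := x)](_ : _ = (fun=> 0)) // wedge0r subr0.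
case: s => [|xi s] //=.
by rewrite /dtm [derive1 _ _](_ : _ = 0) ?mulr0 ?addr0 //; exact: derive1_cst.
Qed.

Lemma tilde_schouten11 (X Y : section tA) :
  smooth_section X -> smooth_section Y ->
  tilde_schouten (msec1 X) (msec1 Y) = msec1 (bracket X Y).
Proof.
move=> sX sY; have [_ _ [_ _ B11] _ _] := schoutenB.
apply: functional_extensionality_dep => -[x t]; apply/funext => s.
have sX1 := smooth_msec1 (line_charts charts) (line_bundle bundleA) sX.
have sY1 := smooth_msec1 (line_charts charts) (line_bundle bundleA) sY.
rewrite /tilde_schouten /=.
rewrite [mslice (msec1 X) t](_ : _ = msec1 (slice X t)) //.
rewrite [mslice (msec1 Y) t](_ : _ = msec1 (slice Y t)) //.
rewrite B11; try exact: smooth_section_slice.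
rewrite !iphi_msec1 sgn_scalar0 wedge_scalar0.
have h0 a : hom 0 (scalar0 a : seq (dual (A x)) -> R) by case.
rewrite (wedgeC _ (hom_dtm (x := x) t sX1) (h0 _)) muln0 expr0 mul1r wedge_scalar0.
case: s => [|xi [|eta s]] /=.
- by rewrite /dtm !derive1_cst; ring.
- rewrite -[RHS]/((xi : dual (A x)) (bracket X Y (x, t)) : R) tilde_bracketE !dualD dualN !dualZ.
  have e (Z : section tA) : smooth_section Z ->
      dtm (msec1 Z : multisection tA) t [:: xi] = xi (dtv Z x t).
    move=> sZ; apply: dtm_eq.
    exact: (is_derive_dual (smooth_section_vderivable charts cover bundleA sZ)).
  by rewrite !e // addrA.
- by rewrite /dtm !derive1_cst; ring.
Qed.

Lemma is_schouten_tilde : is_schouten tilde_schouten.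
Proof.
split.
- by move=> a b D1 D2 sD1 sD2 p; exact: tilde_schouten_multivector.
- by move=> a b c D1 D2 D2' sD1 sD2 sD2'; exact: tilde_schouten_linear sD1 sD2 sD2'.
- by split; [exact: tilde_schouten00|exact: tilde_schouten10|exact: tilde_schouten11].
- exact: tilde_schouten_leibniz.
- exact: tilde_schouten_skew.
Qed.

End TildeSchouten.

(** * Poisson from Jacobi structures, and restriction of Schouten brackets *)

Section JacobiPoisson.
Context (R : realType) (A : algebroid_data R) (phi0 : cosection A).
Arguments phi0 : clear implicits.
Hypothesis lieA : is_lie_algebroid A.
Let charts := lie_charts lieA.
Let cover := lie_cover lieA.
Let bundleA := lie_bundle lieA.
Let tA := tilde phi0.

(** Linearity is an axiom in the second argument; skew-symmetry carries it to the first. *)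
Lemma schoutenZl (B : multisection A -> multisection A -> multisection A) a b c D1 D2 :
  is_schouten B -> smooth_multisection a D1 -> smooth_multisection b D2 ->
  B (fun x s => c * D1 x s) D2 = (fun x s => c * B D1 D2 x s).
Proof.
move=> [_ lB _ _ skew] sD1 sD2.
have s0 : smooth_multisection a (fun (x : base A) (s : seq (dual (A x))) => 0 : R).
  exact: smooth_multisection0.
have Br0 : B D2 (fun x s => 0) = (fun x s => 0).
  have h := lB _ _ (-1) _ _ _ sD2 s0 s0.
  rewrite (_ : (fun x s => -1 * 0 + 0) = (fun x s => 0)) in h; last first.
    by apply: functional_extensionality_dep => x; apply/funext => s; rewrite mulr0 addr0.
  rewrite h; apply: functional_extensionality_dep => x; apply/funext => s.
  by rewrite mulN1r addNr.
have sc : smooth_multisection a (fun x s => c * D1 x s).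
  exact: (smooth_multisectionM charts bundleA (smooth_fun_cst c)).
rewrite (skew _ _ _ _ sc sD2) (skew _ _ _ _ sD1 sD2).
have := lB _ _ c _ _ _ sD2 sD1 s0.
rewrite (_ : (fun x s => c * D1 x s + 0) = (fun x s => c * D1 x s)); last first.
  by apply: functional_extensionality_dep => x; apply/funext => s; rewrite addr0.
move=> ->; rewrite Br0.
by apply: functional_extensionality_dep => x; apply/funext => s; ring.
Qed.

Lemma schoutenZr (B : multisection A -> multisection A -> multisection A) a b c D1 D2 :
  is_schouten B -> smooth_multisection a D1 -> smooth_multisection b D2 ->
  B D1 (fun x s => c * D2 x s) = (fun x s => c * B D1 D2 x s).
Proof.
move=> sB sD1 sD2; have [_ _ _ _ skew] := sB.
have sc : smooth_multisection b (fun x s => c * D2 x s).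
  exact: (smooth_multisectionM charts bundleA (smooth_fun_cst c)).
rewrite (skew _ _ _ _ sD1 sc) (schoutenZl c sB sD2 sD1) (skew _ _ _ _ sD1 sD2).
by apply: functional_extensionality_dep => x; apply/funext => s; ring.
Qed.

(** The t-derivative of e^{-t} pi is - e^{-t} pi, so the two added terms of [tilde_schouten] become
    e^{-2t} times the phi0-terms of [jacobi_bracket], whose coefficients a_i - 1 are 1 for
    bivectors. *)
Lemma poisson_of_jacobi (pi : multisection A) :
  jacobi_structure phi0 pi -> poisson_structure (tilde_multisection phi0 pi).
Proof.
move=> [spi [B sB jac]]; have spit := smooth_tilde_multisection phi0 lieA spi.
split=> //; exists (@tilde_schouten R A phi0 B); first exact: is_schouten_tilde.
move=> [x t] s; rewrite /tilde_schouten /=.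
have mE : mslice (tilde_multisection phi0 pi) t = (fun x s => expR (- t) * pi x s) by [].
have sc : smooth_multisection 2 (fun x s => expR (- t) * pi x s).
  exact: (smooth_multisectionM charts bundleA (smooth_fun_cst _)).
rewrite mE (schoutenZl _ sB spi sc) (schoutenZr _ sB spi spi).
have [mpi _] := spi.
have hi : hom 1 (fun u => pi x (phi0 x :: u)).
  by have [h _ _] := multivector_contract (phi0 x) (mpi x).
have -> : iphi (tilde_multisection phi0 pi) t (x := x) =
    (fun u => expR (- t) * pi x (phi0 x :: u)) by [].
have -> : dtm (tilde_multisection phi0 pi) t (x := x) = (fun u => - expR (- t) * pi x u).
  by apply/funext => u; apply: dtm_eq; exact: (is_derive_mulr (pi x u) (is_derive_expRN t)).
rewrite (hom_sgnE (k := 1)); last first.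
  by move=> u hu; rewrite hi ?mulr0.
rewrite !wedgeZl !wedgeZr.
have := jac x s; rewrite /jacobi_bracket /mwedge /contract.
rewrite (_ : 2%:R - 1 = 1 :> R); last by rewrite mulr2n addrK.
set w1 := wedge _ _ s; set w2 := wedge _ _ s => J.
transitivity (expR (- t) * expR (- t) * (B pi pi x s + 1 * w1 - (-1) ^+ 3 * 1 * w2)).
  by ring.
by rewrite J mulr0.
Qed.

Definition pullm (D : multisection A) : multisection tA := fun p => D p.1.

Lemma smooth_pullm k D : smooth_multisection k D -> smooth_multisection k (pullm D).
Proof. exact: smooth_multisection_fst. Qed.

(** A bracket on A extracted from one over M x R of which only the axioms are known. *)
Definition schouten_slice (B : multisection tA -> multisection tA -> multisection tA)
  (D1 D2 : multisection A) : multisection A := fun x s => B (pullm D1) (pullm D2) (x, 0) s.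

(** Pullbacks of smooth objects are smooth and respect exterior products, and on them the anchor and
    bracket of the extended algebroid reduce to those of A, all t-derivatives being zero. *)
Lemma is_schouten_slice B : is_schouten B -> is_schouten (schouten_slice B).
Proof.
move=> [mB lB [B00 B10 B11] leib skew]; split.
- move=> a b D1 D2 sD1 sD2 x.
  exact: (mB _ _ _ _ (smooth_pullm sD1) (smooth_pullm sD2) (x, 0)).
- move=> a b c D1 D2 D2' sD1 sD2 sD2'.
  have h := lB _ _ c _ _ _ (smooth_pullm sD1) (smooth_pullm sD2) (smooth_pullm sD2').
  by apply: functional_extensionality_dep => x; apply/funext => s;
    have := congr1 (fun D : multisection tA => D (x, 0) s) h.
- split.
  + move=> f g sf sg.
    have h := B00 _ _ (smooth_fun_fst sf) (smooth_fun_fst sg).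
    by apply: functional_extensionality_dep => x; apply/funext => s;
      have := congr1 (fun D : multisection tA => D (x, 0) s) h.
  + move=> X f sX sf.
    have h := B10 _ _ (smooth_section_fst_tilde (phi0 := phi0) sX) (smooth_fun_fst sf).
    apply: functional_extensionality_dep => x; apply/funext => s.
    have := congr1 (fun D : multisection tA => D (x, 0) s) h.
    have -> : act (section_fst X : section tA) (fun p => f p.1) =
        (fun p : base tA => act X f p.1).
      apply/funext => -[y t]; rewrite /act /= /tilde_anchor /=.
      by rewrite [derive1 _ _](_ : _ = 0) ?mulr0 ?addr0 //; exact: derive1_cst.
    by [].
  + move=> X Y sX sY.
    have h := B11 _ _ (smooth_section_fst_tilde (phi0 := phi0) sX)
      (smooth_section_fst_tilde (phi0 := phi0) sY).
    apply: functional_extensionality_dep => x; apply/funext => s.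
    have := congr1 (fun D : multisection tA => D (x, 0) s) h.
    have -> : bracket (section_fst X : section tA) (section_fst Y : section tA) =
        section_fst (bracket X Y).
      apply: functional_extensionality_dep => -[y t].
      by rewrite tilde_bracketE !(dtv_section_fst phi0 lieA) // !scaler0 addr0 subr0.
    by [].
- move=> a1 a2 a3 D1 D2 D3 sD1 sD2 sD3.
  have h := leib _ _ _ _ _ _ (smooth_pullm sD1) (smooth_pullm sD2) (smooth_pullm sD3).
  by apply: functional_extensionality_dep => x; apply/funext => s;
    have := congr1 (fun D : multisection tA => D (x, 0) s) h.
- move=> a1 a2 D1 D2 sD1 sD2.
  have h := skew _ _ _ _ (smooth_pullm sD1) (smooth_pullm sD2).
  by apply: functional_extensionality_dep => x; apply/funext => s;
    have := congr1 (fun D : multisection tA => D (x, 0) s) h.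
Qed.

End JacobiPoisson.

(** * Jacobi structures from Poisson structures *)

Section PoissonJacobi.
Context (R : realType) (A : algebroid_data R) (phi0 : cosection A).
Arguments phi0 : clear implicits.
Hypothesis lieA : is_lie_algebroid A.
Let charts := lie_charts lieA.
Let cover := lie_cover lieA.
Let bundleA := lie_bundle lieA.
Let tA := tilde phi0.
Context (B : multisection tA -> multisection tA -> multisection tA).
Arguments B : clear implicits.
Hypothesis schoutenB : is_schouten B.

Let expN (p : base tA) : R := expR (- p.2).
Let F : multisection tA := msec0 expN.

Lemma smooth_expN : smooth_fun expN.
Proof.
have := smooth_fun_expRM charts (-1).
by rewrite (_ : (fun p => _) = expN) //; apply/funext => p; rewrite mulN1r.
Qed.

Lemma smooth_F : smooth_multisection 0 F.
Proof. by apply: smooth_msec0; exact: smooth_expN. Qed.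

Lemma anchor_cst (x : base A) (v : A x) (a : R) : anchor v (fun=> a) = 0.
Proof.
have [_ [tan _ _] _ _] := lieA.
have s1 : smooth_fun (fun _ : base A => 1 : R) := smooth_fun_cst 1.
have h1 : anchor v (fun=> 1) = 0.
  have := (tan x v _ _ s1 s1).2.
  rewrite (_ : (fun _ => 1 * 1) = (fun=> 1)); last first.
    by apply/funext => y; rewrite mulr1.
  by rewrite mul1r => /eqP; rewrite addrC -subr_eq subrr eq_sym => /eqP.
have := anchor_funZ lieA a v s1; rewrite h1 mulr0 => <-.
by congr anchor; apply/funext => y; rewrite mulr1.
Qed.

(** Up to sign this is the anchor of X on e^{-t}: the part along M kills a function of t alone, and
    phi0(X) d/dt gives - e^{-t} phi0(X). *)
Lemma schouten_expN1 (X : section A) : smooth_section X ->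
  B F (msec1 (section_fst X : section tA)) =
  msec0 (fun p : base tA => expN p * phi0 p.1 (X p.1)).
Proof.
move=> sX; have [_ _ [_ B10 _] _ skew] := schoutenB.
have sXt := smooth_section_fst_tilde (phi0 := phi0) sX.
have sF := smooth_F.
have sX1 := smooth_msec1 (line_charts charts) (line_bundle bundleA) sXt.
rewrite (skew _ _ _ _ sF sX1) (B10 _ _ sXt smooth_expN).
apply: functional_extensionality_dep => -[x t]; apply/funext => -[|xi s]; last first.
  by rewrite /= mulr0 oppr0.
rewrite /= /act /= /tilde_anchor /= /expN /= anchor_cst derive1E.
have [_ ->] := is_derive_expRN t.
rewrite mul1n expr2 /section_fst /=; ring.
Qed.

(** On two coframe elements the product is a 2 x 2 determinant of components; on lists of any other
    length it vanishes. *)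
Lemma smooth_multisection_wedge11 (X Y : section A) : smooth_section X ->
  smooth_section Y -> smooth_multisection 2 (mwedge (msec1 X) (msec1 Y)).
Proof.
move=> sX sY; have sX1 := smooth_msec1 charts bundleA sX.
have sY1 := smooth_msec1 charts bundleA sY.
have [mX cX] := sX1; have [mY cY] := sY1.
split=> [x|tau ttau J]; first exact: multivector_wedge (mX x) (mY x).
have ot := trivs_open bundleA ttau.
have cst0 : smooth_on (tdom tau) (fun=> 0 : R) := smooth_on_cst _ _.
have [sJ|nJ] := eqVneq (size J) 2%N; last first.
  apply: (smooth_on_ext charts ot _ cst0) => x _.
  have [h _ _] := multivector_wedge (mX x) (mY x).
  by rewrite /mwedge h // size_map.
case: J sJ => [|j [|k [|]]] // _.
have cm (Z : section A) (i : 'I_(rank A)) : smooth_section Z ->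
    smooth_on (tdom tau) (fun x => tmap tau x (Z x) 0 i).
  by move=> sZ; have := sZ tau ttau i; rewrite setIT.
apply: (smooth_on_ext charts (f := fun x =>
  tmap tau x (X x) 0 j * tmap tau x (Y x) 0 k +
  (-1) * (tmap tau x (X x) 0 k * tmap tau x (Y x) 0 j))) => //.
  move=> x _; rewrite /mwedge /= !coframeE expr0 expr1; ring.
apply: (smooth_on_add charts) => //; first by apply: (smooth_on_mul charts) => //; exact: cm.
apply: (smooth_on_mul charts) => //; first exact: smooth_on_cst.
by apply: (smooth_on_mul charts) => //; exact: cm.
Qed.

(* [F, D] contracts D with - dF, which is F phi0 as D does not depend on t. *)
Definition exp_contracts (D : multisection A) := smooth_multisection 2 D /\
  B F (pullm D : multisection tA) = (fun p s => expN p * D p.1 (phi0 p.1 :: s)).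

(** The Leibniz rule gives [F, X] /\ Y - X /\ [F, Y], and contraction with phi0 gives phi0(X) Y -
    phi0(Y) X with the same signs. *)
Lemma exp_contracts_wedge (X Y : section A) : smooth_section X -> smooth_section Y ->
  exp_contracts (mwedge (msec1 X) (msec1 Y)).
Proof.
move=> sX sY; split; first exact: smooth_multisection_wedge11.
have [_ _ _ leib _] := schoutenB.
have sF := smooth_F.
have sXt := smooth_section_fst_tilde (phi0 := phi0) sX.
have sYt := smooth_section_fst_tilde (phi0 := phi0) sY.
have sX1 := smooth_msec1 (line_charts charts) (line_bundle bundleA) sXt.
have sY1 := smooth_msec1 (line_charts charts) (line_bundle bundleA) sYt.
have -> : (pullm (mwedge (msec1 X) (msec1 Y)) : multisection tA) =
  mwedge (msec1 (section_fst X : section tA)) (msec1 (section_fst Y : section tA)) by [].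
rewrite (leib _ _ _ _ _ _ sF sX1 sY1) !schouten_expN1 //.
apply: functional_extensionality_dep => -[x t]; apply/funext => s.
have h1 (Z : section A) : hom 1 (msec1 Z x) by case=> [|? []].
have h0 (a : R) : hom 0 (scalar0 a : seq (dual (A x)) -> R) by case.
have c1 (Z : section A) : (fun u => msec1 Z x (phi0 x :: u)) = scalar0 (phi0 x (Z x) : R).
  by apply/funext => -[|? ?].
have m0 (g : base tA -> R) : (msec0 g : multisection tA) (x, t) = scalar0 (g (x, t)) by [].
have m1 (Z : section A) : (msec1 (section_fst Z : section tA)) (x, t) = msec1 Z x by [].
rewrite /mwedge !m0 !m1 wedge_cons !c1 (hom_sgnE (h1 X)) wedgeZl.
rewrite !(wedgeC _ (h1 X) (h0 _)) !wedge_scalar0 /= mul1n muln0 !expr0 !expr1.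
by ring.
Qed.

Lemma exp_contracts_lin a D D' : exp_contracts D -> exp_contracts D' ->
  exp_contracts (fun x s => a * D x s + D' x s).
Proof.
move=> [sD hD] [sD' hD']; split.
  apply: (smooth_multisectionD charts bundleA) => //.
  exact: (smooth_multisectionM charts bundleA (smooth_fun_cst a)).
have [_ lB _ _ _] := schoutenB.
have := lB _ _ a _ _ _ smooth_F (smooth_pullm phi0 sD) (smooth_pullm phi0 sD').
rewrite hD hD' => h.
have -> : (pullm (fun x s => a * D x s + D' x s) : multisection tA) =
  (fun p s => a * D p.1 s + D' p.1 s) by [].
rewrite h; apply: functional_extensionality_dep => p; apply/funext => s; ring.
Qed.

Lemma exp_contracts0 : exp_contracts (fun x s => 0).
Proof.
have s0 : smooth_multisection 2 (fun (x : base A) (s : seq (dual (A x))) => 0 : R).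
  exact: smooth_multisection0.
split=> //; have [_ lB _ _ _] := schoutenB.
have := lB _ _ (-1) _ _ _ smooth_F (smooth_pullm phi0 s0) (smooth_pullm phi0 s0).
rewrite (_ : (fun p s => -1 * _ + _) = (pullm (fun x s => 0) : multisection tA));
  last first.
  by apply: functional_extensionality_dep => p; apply/funext => s; rewrite /pullm; ring.
move=> ->; apply: functional_extensionality_dep => p; apply/funext => s.
by rewrite mulr0 mulN1r addNr.
Qed.

Lemma exp_contracts_sum n (D : 'I_n -> multisection A) :
  (forall i, exp_contracts (D i)) -> exp_contracts (fun x s => \sum_i D i x s).
Proof.
move=> hD.
suff h r : exp_contracts (fun x s => \sum_(i <- r) D i x s) by exact: h.
elim: r => [|i r IH].
  rewrite (_ : (fun x s => _) = (fun x s => 0)); first exact: exp_contracts0.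
  by apply: functional_extensionality_dep => x; apply/funext => s; rewrite big_nil.
have := exp_contracts_lin 1 (hD i) IH.
rewrite (_ : (fun x s => 1 * _ + _) = (fun x s => \sum_(j <- i :: r) D j x s)) //.
by apply: functional_extensionality_dep => x; apply/funext => s; rewrite big_cons mul1r.
Qed.

(* A bump function cuts the local frame expansion of [D] into a global sum of
   products of sections, and [F, -] is linear over functions of the base. *)
Lemma exp_contracts_all (D : multisection A) :
  smooth_multisection 2 D -> exp_contracts D.
Proof.
move=> sD; split=> //; have [mD cD] := sD.
apply: functional_extensionality_dep => -[x t]; apply/funext => s.
have [tau ttau dx] := trivs_cover bundleA x.
have ot := trivs_open bundleA ttau.
have manA : is_manifold (base A) by case: lieA => [[]].
have [chi [K [schi chix cK KU chi0]]] := bump_function manA ot dx.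
(* The sum below runs over all ordered pairs (i, j), hence the factor 1/2. One factor chi goes into
   the coefficient and one into each frame section, so that all three are globally smooth; this is
   the origin of chi^3. *)
pose c i j y := 2^-1 * (chi y * D y [:: coframe tau i y; coframe tau j y]).
have sc i j : smooth_fun (c i j).
  apply: (smooth_on_mul charts openT); first exact: smooth_on_cst.
  apply: (smooth_on_cutoff charts cK KU ot openT schi chi0).
  by rewrite setIT; exact: (cD tau ttau [:: i; j]).
pose e i : section A := fun y => chi y *: frame tau i y.
have se i : smooth_section (e i).
  apply: (smooth_section_cutoff charts bundleA cK KU ot schi chi0).
  by have [_ _ _ h] := bundleA; exact: h.
have sce i j : smooth_section (fun y => c i j y *: e i y).
  exact: (smooth_sectionM charts bundleA).
have := exp_contracts_sum (fun i => exp_contracts_sum (fun j =>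
  exp_contracts_wedge (sce i j) (se j))).
have -> : (fun y u => \sum_i \sum_j
    mwedge (msec1 (fun y => c i j y *: e i y)) (msec1 (e j)) y u) =
    (fun y u => chi y ^+ 3 * D y u).
  apply: functional_extensionality_dep => y; apply/funext => u.
  have [mDy lDy _] := mD y.
  have hw i j : hom 2 (mwedge (msec1 (fun y => c i j y *: e i y)) (msec1 (e j)) y).
    by have [m _] := smooth_multisection_wedge11 (sce i j) (se j); have [] := m y.
  have [su|nu] := eqVneq (size u) 2%N; last first.
    rewrite mDy // mulr0; apply: big1 => i _; apply: big1 => j _; exact: hw.
  case: u su => [|xi [|eta [|]]] // _.
  have wE i j : mwedge (msec1 (fun y => c i j y *: e i y)) (msec1 (e j)) y [:: xi; eta] =
      c i j y * chi y ^+ 2 * (xi (frame tau i y) * eta (frame tau j y)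
        - eta (frame tau i y) * xi (frame tau j y)) :> R.
    by rewrite /mwedge /= /e !dualZ expr0 expr1; ring.
  (* The frame expansion is valid on [tdom tau] only; elsewhere chi vanishes and both sides are
     zero. *)
  have [dy|ndy] := pselect (tdom tau y); last first.
    have c0 : chi y = 0 by apply: chi0 => /KU.
    rewrite c0 expr0n mul0r; apply: big1 => i _; apply: big1 => j _.
    by rewrite wE c0 expr0n mulr0 mul0r.
  have exp2 a b : D y [:: a; b] = \sum_i \sum_j
      a (frame tau i y) * b (frame tau j y) * D y [:: coframe tau i y; coframe tau j y].
    rewrite {1}(coframe_sum bundleA a ttau dy).
    rewrite (multilinear_sum (D := D y) _ _ [::] [:: b] lDy); apply: eq_bigr => i _ /=.
    rewrite {1}(coframe_sum bundleA b ttau dy).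
    rewrite (multilinear_sum (D := D y) _ _ [:: coframe tau i y] [::] lDy) mulr_sumr.
    by apply: eq_bigr => j _; rewrite /= mulrA.
  transitivity (2^-1 * chi y ^+ 3 * (D y [:: xi; eta] - D y [:: eta; xi])).
    rewrite !exp2 -sumrB mulr_sumr; apply: eq_bigr => i _.
    rewrite -sumrB mulr_sumr; apply: eq_bigr => j _.
    by rewrite wE /c; ring.
  by rewrite [in X in _ - X](multivector2_skew _ _ (mD y)); field.
move=> [_ h].
have [_ _ [B00 _ _] leib _] := schoutenB.
pose g (p : base tA) : R := chi p.1 ^+ 3.
have sg : smooth_fun g.
  apply: (smooth_fun_fst (f := fun y => chi y ^+ 3)).
  apply: (smooth_on_ext charts openT (f := fun y => chi y * (chi y * chi y))).
    by move=> y _; ring.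
  by do 2![apply: (smooth_on_mul charts openT) => //].
have sg0 : smooth_multisection 0 (msec0 g : multisection tA) by exact: smooth_msec0.
(* Since [F, g] = 0 for functions, the Leibniz rule gives [F, g D] = g [F, D]; at x the factor g =
   chi^3 is nonzero and can be cancelled. *)
have := leib _ _ _ _ _ _ smooth_F sg0 (smooth_pullm phi0 sD).
rewrite (B00 _ _ smooth_expN sg).
have -> : mwedge (msec0 g) (pullm D : multisection tA) =
    (pullm (fun y u => chi y ^+ 3 * D y u) : multisection tA).
  apply: functional_extensionality_dep => -[y r]; apply/funext => u.
  exact: (wedge_scalar0 (chi y ^+ 3) (D y) u).
rewrite h => hB; have := congr1 (fun T : multisection tA => T (x, t) s) hB.
rewrite /mwedge wedge0l add0r muln0 expr0 mul1r.
have -> : (msec0 g : multisection tA) (x, t) = scalar0 (chi x ^+ 3) by [].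
rewrite wedge_scalar0 /= => hx.
have nz : chi x ^+ 3 != 0 by rewrite expf_neq0.
by apply: (mulfI nz); rewrite -hx; ring.
Qed.

(** With [F] = e^{-t}, [P] the pullback of pi and [I] = [F, P] = e^{-t} iota_phi0 P, the Leibniz
    rule applied to F /\ P in each argument gives [F P, F P] = 2 F I /\ P + F^2 [P, P], which is
    read at t = 0. *)
Lemma jacobi_of_schouten (pi : multisection A) : smooth_multisection 2 pi ->
  (forall p s, B (tilde_multisection phi0 pi) (tilde_multisection phi0 pi) p s = 0) ->
  forall x s, jacobi_bracket phi0 (schouten_slice B) 2 2 pi pi x s = 0.
Proof.
move=> spi zero x s; have [_ _ [B00 _ _] leib skew] := schoutenB.
have [_ hF] := exp_contracts_all spi.
pose pit := tilde_multisection phi0 pi; pose P : multisection tA := pullm pi.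
have sP : smooth_multisection 2 P := smooth_pullm phi0 spi.
have spit : smooth_multisection 2 pit := smooth_tilde_multisection phi0 lieA spi.
have pitE : pit = mwedge F P.
  apply: functional_extensionality_dep => -[y r]; apply/funext => u.
  exact/esym/(wedge_scalar0 (expR (- r)) (pi y) u).
pose I : multisection tA := fun p u => expN p * pi p.1 (phi0 p.1 :: u).
have FP : B F P = I by [].
have PF : B P F = I.
  rewrite (skew _ _ _ _ sP smooth_F) FP.
  by apply: functional_extensionality_dep => p; apply/funext => u; ring.
have Fpit : B F pit = mwedge F I.
  rewrite pitE (leib _ _ _ _ _ _ smooth_F smooth_F sP) (B00 _ _ smooth_expN smooth_expN) FP.
  apply: functional_extensionality_dep => p; apply/funext => u.
  by rewrite {1}/mwedge wedge0l; ring.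
have pitF : B pit F = mwedge F I.
  rewrite (skew _ _ _ _ spit smooth_F) Fpit.
  by apply: functional_extensionality_dep => p; apply/funext => u; ring.
have pitP : B pit P = (fun p u => mwedge I P p u + mwedge F (B P P) p u).
  rewrite (skew _ _ _ _ spit sP) pitE (leib _ _ _ _ _ _ sP smooth_F sP) PF.
  by apply: functional_extensionality_dep => p; apply/funext => u; ring.
have := zero (x, 0) s; rewrite -/pit {2}pitE.
rewrite (leib _ _ _ _ _ _ spit smooth_F sP) pitF pitP.
have F1 : @F (x, 0) = scalar0 1.
  by apply/funext => -[|? ?] //=; rewrite /expN /= oppr0 expR0.
have I1 : I (x, 0) = (fun u => pi x (phi0 x :: u)).
  by apply/funext => u; rewrite /I /expN /= oppr0 expR0 mul1r.
have FG (G : multisection tA) : mwedge F G (x, 0) = G (x, 0).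
  by apply/funext => u; rewrite /mwedge F1 wedge_scalar0 mul1r.
rewrite FG {1}/mwedge FG {1}/mwedge !I1 FG => h.
have [mpi _] := spi; have [hpi _ _] := mpi x.
have hi : hom 1 (fun u => pi x (phi0 x :: u)) := hom_cons (phi0 x) hpi.
(* The degrees are 2 and 1, so pi and iota_phi0 pi commute and the two phi0-terms of the Jacobi
   bracket coincide. *)
rewrite /jacobi_bracket /mwedge /contract (wedgeC s hpi hi).
rewrite -[RHS]h /schouten_slice.
rewrite (_ : 2%:R - 1 = 1 :> R); last by rewrite mulr2n addrK.
by rewrite muln0 /=; ring.
Qed.

Lemma jacobi_structure_of_schouten (pi : multisection A) : smooth_multisection 2 pi ->
  (forall p s, B (tilde_multisection phi0 pi) (tilde_multisection phi0 pi) p s = 0) ->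
  jacobi_structure phi0 pi.
Proof.
move=> spi zero; split=> //; exists (schouten_slice B).
  exact: is_schouten_slice.
exact: jacobi_of_schouten.
Qed.

End PoissonJacobi.

(** * The equivalence, condition by condition *)

Lemma jacobi_structure_tilde (R : realType) (A : algebroid_data R) (phi0 : cosection A)
    (pi : multisection A) : is_lie_algebroid A -> smooth_multisection 2 pi ->
  jacobi_structure phi0 pi <-> poisson_structure (tilde_multisection phi0 pi).
Proof.
move=> lieA spi; split; first exact: poisson_of_jacobi.
by move=> [_ [B sB zero]]; exact: (jacobi_structure_of_schouten lieA sB spi zero).
Qed.

Lemma dirac_structure_tilde (R : realType) (A : algebroid_data R) (phi0 : cosection A)
    (pi : multisection A) : is_lie_algebroid A -> smooth_multisection 2 pi ->
  dirac_structure phi0 (graph_sharp pi) <->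
  dirac_structure (fun q => 0 : dual (tilde phi0 q))
    (graph_sharp (tilde_multisection phi0 pi)).
Proof.
by move=> lieA spi; split; [exact: dirac_tilde|exact: dirac_untilde].
Qed.

Theorem theorem4p3 (R : realType) (A : algebroid_data R) (phi0 : cosection A)
    (hA : jacobi_algebroid phi0) (pi1 pi2 : multisection A)
    (hpi1 : smooth_multisection 2 pi1) (hpi2 : smooth_multisection 2 pi2) :
  jacobi_pair phi0 pi1 pi2 <->
  poisson_pair (tilde_multisection phi0 pi1) (tilde_multisection phi0 pi2).
Proof.
have [lieA _ _] := hA.
have j1 := jacobi_structure_tilde phi0 lieA hpi1.
have j2 := jacobi_structure_tilde phi0 lieA hpi2.
have d1 := dirac_structure_tilde phi0 lieA hpi1.
have d2 := dirac_structure_tilde phi0 lieA hpi2.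
have n := nijenhuis_tilde phi0 lieA (N_rel (graph_sharp pi1) (graph_sharp pi2)).
rewrite -(N_rel_tilde phi0 hpi1 hpi2) in n.
rewrite /jacobi_pair /poisson_pair /dirac_pair.
by split=> -[/j1 ? /j2 ? [/d1 ? /d2 ? /n ?]].
Qed.
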